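(* Suppose that $A$ is either a Dirichlet or a logrigged subalgebra of a unital $C^*$-algebra $B$. Then any unital completely contractive (resp. completely isometric) homomorphism $\varphi : A \to B(H)$, $H$ a Hilbert space, admits a unique extension to a completely positive and completely contractive (resp. completely positive and completely isometric) map $B \to B(H)$. More generally, if $C$ is a unital operator algebra, and if $\varphi : A \to C$ is a unital contractive homomorphism which possesses an extension to a completely positive map $B \to C$, then that extension is unique.
   Context: A unital subalgebra of $B$ contains the identity of $B$. A unital subalgebra $A$ of $B$ is Dirichlet if $A+A^*$ is norm dense in $B$. A norm-closed unital subalgebra $A$ of $B$ is logrigged if every strictly positive (i.e. positive invertible) $b\in B$ is a norm limit of terms $\sum_{k=1}^n a_k^*a_k$ ($n$ varying), where $a_k\in A$ and where for each such term there exist $b_k\in A$ with $\sum_{k=1}^n b_ka_k=1$, the corresponding expressions $\sum_{k=1}^n b_kb_k^*$ converging in norm to $b^{-1}$. A unital operator algebra $C$ is a norm-closed algebra of operators containing an identity of norm 1, regarded as a unital subalgebra of some $B(H)$; a map into $C$ is completely positive if it is so as a map into $B(H)$. A linear map is completely contractive (completely isometric) if all its amplifications to $n\times n$ matrices are contractive (isometric). *)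

(* Defs.v *)
From HB Require Import structures.
From mathcomp Require Import all_boot all_order all_algebra.
From mathcomp Require Import all_classical all_reals all_analysis.
From mathcomp Require Import complex.

Set Implicit Arguments.
Unset Strict Implicit.
Unset Printing Implicit Defensive.

Import Order.TTheory GRing.Theory Num.Theory.
Import numFieldNormedType.Exports.

Local Open Scope classical_set_scope.
Local Open Scope ring_scope.

(* The scalars are R[i], with R : realType. The norm of a normed module over
   R[i] takes its (nonnegative real) values in R[i], hence [rnorm] below. *)

(* The multiplication is a field of the mixin instead of being inherited from
   [GRing.PzRing], because the hierarchy has no join of rings and normed modules
   below [Num.NumDomain]; the ring structure is declared as an instance below. *)
HB.mixin Record isCStarAlgebra (R : realType) B
    of CompleteNormedModule R[i] B := {
  cstar_one : B ;
  cstar_mul : B -> B -> B ;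
  cstar_mulA : associative cstar_mul ;
  cstar_mul1l : left_id cstar_one cstar_mul ;
  cstar_mul1r : right_id cstar_one cstar_mul ;
  cstar_mulDl : left_distributive cstar_mul +%R ;
  cstar_mulDr : right_distributive cstar_mul +%R ;
  cstar_scaleAl : forall (a : R[i]) (x y : B),
    a *: cstar_mul x y = cstar_mul (a *: x) y ;
  cstar_scaleAr : forall (a : R[i]) (x y : B),
    a *: cstar_mul x y = cstar_mul x (a *: y) ;
  star : B -> B ;
  star_semilinear : forall (a : R[i]) (x y : B),
    star (a *: x + y) = (a^*)%R *: star x + star y ;
  star_mul : forall x y : B, star (cstar_mul x y) = cstar_mul (star y) (star x) ;
  starK : involutive star ;
  cstar_normM : forall x y : B, `|cstar_mul x y| <= `|x| * `|y| ;
  cstar_identity : forall x : B, `|cstar_mul (star x) x| = `|x| ^+ 2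
}.

#[short(type="cstarAlgType")]
HB.structure Definition CStarAlgebra (R : realType) :=
  {B of isCStarAlgebra R B & CompleteNormedModule R[i] B}.

HB.instance Definition _ (R : realType) (B : cstarAlgType R) :=
  GRing.Zmodule_isPzRing.Build (CStarAlgebra.sort B)
    (@cstar_mulA R B) (@cstar_mul1l R B) (@cstar_mul1r R B)
    (@cstar_mulDl R B) (@cstar_mulDr R B).

HB.mixin Record isHilbert (R : realType) H of CompleteNormedModule R[i] H := {
  dot : H -> H -> R[i] ;
  dot_linear : forall (a : R[i]) (x y z : H),
    dot (a *: x + y) z = a * dot x z + dot y z ;
  dot_conj : forall x y : H, dot y x = ((dot x y)^*)%R ;
  dot_norm : forall x : H, `|x| ^+ 2 = dot x x
}.

#[short(type="hilbertType")]
HB.structure Definition Hilbert (R : realType) :=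
  {H of isHilbert R H & CompleteNormedModule R[i] H}.

Section Defs.
Context {R : realType}.

Definition rnorm {V : normedModType R[i]} (x : V) : R := complex.Re `|x|.

Section CStar.
Context {B : cstarAlgType R}.

Definition star_mx n (x : 'M[B]_n) : 'M[B]_n := map_mx star x^T.

Definition positive (b : B) : Prop := exists y : B, b = star y * y.

Definition mx_positive n (x : 'M[B]_n) : Prop :=
  exists y : 'M[B]_n, x = star_mx y *m y.

Definition hmod_norm n (xi : 'cV[B]_n) : R :=
  Num.sqrt (rnorm (\sum_i star (xi i 0) * xi i 0)).

(* The C*-norm of M_n(B): the operator norm of the (faithful) left action of
   M_n(B) on the Hilbert C*-module B^n, whose inner product is
   <xi, eta> = \sum_i xi_i^* eta_i. *)
Definition cstar_mx_norm n (x : 'M[B]_n) : R :=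
  sup [set hmod_norm (x *m xi) | xi in [set xi : 'cV[B]_n | hmod_norm xi <= 1]].

Definition unital_subalgebra (A : set B) : Prop :=
  [/\ A 1,
      forall (c : R[i]) (x y : B), A x -> A y -> A (c *: x + y)
    & forall x y : B, A x -> A y -> A (x * y)].

Definition dirichlet (A : set B) : Prop :=
  unital_subalgebra A /\
  closure [set x + star y | x in A & y in A] = [set: B].

Definition logrigged (A : set B) : Prop :=
  [/\ unital_subalgebra A, closed A &
      forall b b' : B, positive b ->
        b * b' = 1 -> b' * b = 1 ->
        exists (n : nat -> nat) (a c : nat -> nat -> B),
          [/\ forall m k, (k < n m)%N -> A (a m k) /\ A (c m k),
              forall m, \sum_(k < n m) c m k * a m k = 1,
              (fun m => \sum_(k < n m) star (a m k) * a m k) @ \oo --> b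
            & (fun m => \sum_(k < n m) c m k * star (c m k)) @ \oo --> b']].

End CStar.

Section Operators.
Context {H : hilbertType R}.

Definition bounded_op : set (H -> H) :=
  [set T | linear T /\ continuous T].

Definition op_norm (T : H -> H) : R :=
  sup [set rnorm (T x) | x in [set x : H | rnorm x <= 1]].

(* M_n(B(H)) is identified with B(H^n). *)
Definition opmx_apply n (T : 'M[H -> H]_n) (xi : 'I_n -> H) : 'I_n -> H :=
  fun i => \sum_j T i j (xi j).

Definition vec_norm n (xi : 'I_n -> H) : R :=
  Num.sqrt (\sum_i rnorm (xi i) ^+ 2).

Definition opmx_norm n (T : 'M[H -> H]_n) : R :=
  sup [set vec_norm (opmx_apply T xi) |
        xi in [set xi : 'I_n -> H | vec_norm xi <= 1]].

Definition opmx_positive n (T : 'M[H -> H]_n) : Prop :=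
  forall xi : 'I_n -> H, 0 <= \sum_i dot (opmx_apply T xi i) (xi i).

Definition unital_operator_algebra (C : set (H -> H)) : Prop :=
  [/\ C `<=` bounded_op,
      C id /\ op_norm id = 1,
      forall (c : R[i]) (S T : H -> H), C S -> C T -> C (c *: S + T),
      forall S T : H -> H, C S -> C T -> C (S \o T)
    & forall T : H -> H, bounded_op T ->
        (forall e : R, 0 < e -> exists2 S, C S & op_norm (T - S) < e) -> C T].

End Operators.

Section Maps.
Context {B : cstarAlgType R} {H : hilbertType R}.

(* A map defined on a subset A of B is given by a total function B -> (H -> H)
   whose values outside of A are irrelevant. *)
Implicit Types (A : set B) (C : set (H -> H)) (phi Phi : B -> H -> H).

Definition unital_hom A C phi : Prop :=
  [/\ forall a, A a -> C (phi a),
      phi 1 = id,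
      forall (c : R[i]) (x y : B), A x -> A y ->
        phi (c *: x + y) = c *: phi x + phi y
    & forall x y : B, A x -> A y -> phi (x * y) = phi x \o phi y].

Definition contractive_on A phi : Prop :=
  forall a, A a -> op_norm (phi a) <= rnorm a.

Definition completely_contractive_on A phi : Prop :=
  forall n (x : 'M[B]_n), (forall i j, A (x i j)) ->
    opmx_norm (map_mx phi x) <= cstar_mx_norm x.

Definition completely_isometric_on A phi : Prop :=
  forall n (x : 'M[B]_n), (forall i j, A (x i j)) ->
    opmx_norm (map_mx phi x) = cstar_mx_norm x.

Definition completely_positive C Phi : Prop :=
  [/\ forall b, C (Phi b), linear Phi
    & forall n (x : 'M[B]_n), mx_positive x -> opmx_positive (map_mx Phi x)].

Definition extends A phi Phi : Prop := forall a, A a -> Phi a = phi a.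

End Maps.
End Defs.

(* Main.v *)
Require Import Defs.
From HB Require Import structures.
From mathcomp Require Import all_boot all_order all_algebra.
From mathcomp Require Import all_classical all_reals all_analysis.
From mathcomp Require Import complex.
From mathcomp Require Import ring lra.

Set Implicit Arguments.
Unset Strict Implicit.
Unset Printing Implicit Defensive.

Import Order.TTheory GRing.Theory Num.Theory.
Import numFieldNormedType.Exports.

Local Open Scope classical_set_scope.
Local Open Scope ring_scope.

(* A completely positive map [Phi : B -> B(H)] is encoded by the real-valued
   form Re <Phi(b) v, w>; the vectors may range over any space with a positive
   semidefinite inner product, so that GNS spaces need not be completed.

   Uniqueness. If A is Dirichlet, the extension is determined on A + A^*, hence
   by continuity on B. If A is logrigged and Phi, Psi are two extensions, apply
   the Kadison-Schwarz inequality to Phi and the a_k, and to Psi and the b_k^*;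
   since sum b_k a_k = 1, this gives
     <Phi(b) v, v> + <Psi(b^-1) v, v> >= 2 <v, v>
   for strictly positive b. With b = 1 + t h, h selfadjoint, letting t -> 0 from
   both sides yields Phi(h) = Psi(h).

   Existence. The form sum <phi(a_ij) v_j, v_i> on matrices over A, indexed by
   vectors, is nonnegative on accretive matrices: if Re x >= 0 then
   |1 - t x|^2 <= 1 + t^2 |x|^2, and phi is completely contractive. The M. Riesz
   theorem extends it to a positive functional on matrices over B, and such a
   functional is a completely positive form.

   Isometry. If phi is completely isometric, call a matrix X over B positive
   when Re Phi_n(X) >= 0. For each state g of B, the GNS form of g on A is
   nonnegative for this order, so the same theorem extends it to a completely
   positive form, which by uniqueness is the GNS form on B. Hence
   Re Phi_n(X) >= 0 implies Re X >= 0, and Phi is completely isometric. *)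

(** Since [A] need not be selfadjoint, the only order visible on matrices over [A] is that of real
    parts, and nothing says beforehand that [phi] respects it. Accretivity is however a first-order
    property of a norm: [Re x >= 0] exactly when [|1 - t x|^2 <= 1 + O(t^2)] as [t] decreases to 0.
    As [1 - t x] again has entries in [A], complete contractivity carries accretivity from [B^n] to
    [H^n], and complete isometry carries it back. Conversely, norm bounds are encoded as
    accretivity: if [m > 0] bounds [x], the block matrix [[[m, - 2 x], [0, m]]] is accretive, and
    testing a positive functional on it returns the bound. This is how norm estimates for the
    extension follow from its positivity alone. The M. Riesz theorem applies because every matrix
    entry is dominated by scalar diagonal matrices, and scalars lie in [A]. *)

Notation "r %:C" := (real_complex _ r) : ring_scope.

(* Reflexive normalisation of linear combinations, needed because [ring] does
   not apply to modules and noncommutative rings. *)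
Inductive lexpr (K : Type) :=
  | LVar of nat | LZero | LAdd of lexpr K & lexpr K | LOpp of lexpr K
  | LScale of K & lexpr K | LMuln of lexpr K & nat.
Arguments LVar {K}.
Arguments LZero {K}.

Section LinearExpressions.
Variables (K : comPzRingType) (V : lmodType K).
Implicit Types (e : lexpr K) (env : seq V).

Fixpoint leval env e : V :=
  match e with
  | LVar i => nth 0 env i
  | LZero => 0
  | LAdd e1 e2 => leval env e1 + leval env e2
  | LOpp e1 => - leval env e1
  | LScale c e1 => c *: leval env e1
  | LMuln e1 n => leval env e1 *+ n
  end.

Fixpoint lcoef i e : K :=
  match e with
  | LVar j => if eqn i j then 1 else 0
  | LZero => 0
  | LAdd e1 e2 => lcoef i e1 + lcoef i e2
  | LOpp e1 => - lcoef i e1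
  | LScale c e1 => c * lcoef i e1
  | LMuln e1 n => lcoef i e1 *+ n
  end.

Lemma leval_sum env e :
  leval env e = \sum_(i < size env) lcoef i e *: nth 0 env i.
Proof.
elim: e => [j||e1 IH1 e2 IH2|e1 IH1|c e1 IH1|e1 IH1 n] /=.
- have [lt_j|le_j] := ltnP j (size env); last first.
    rewrite nth_default // big1 // => i _.
    case: eqnP => [eq_ij|_]; last by rewrite scale0r.
    by move: (ltn_ord i); rewrite eq_ij ltnNge le_j.
  rewrite eqnE (bigD1 (Ordinal lt_j)) //= eqxx scale1r big1 ?addr0 // => i.
  by rewrite -val_eqE /= => /negPf->; rewrite scale0r.
- by rewrite big1 // => i _; rewrite scale0r.
- by rewrite IH1 IH2 -big_split; apply: eq_bigr => i _; rewrite scalerDl.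
- by rewrite IH1 -sumrN; apply: eq_bigr => i _; rewrite scaleNr.
- by rewrite IH1 scaler_sumr; apply: eq_bigr => i _; rewrite scalerA.
- by rewrite IH1 -sumrMnl; apply: eq_bigr => i _; rewrite scalerMnl.
Qed.

Fixpoint lcoef_eq n e1 e2 : Prop :=
  if n is n'.+1 then lcoef n' e1 = lcoef n' e2 /\ lcoef_eq n' e1 e2 else True.

Lemma leval_eq env e1 e2 :
  lcoef_eq (size env) e1 e2 -> leval env e1 = leval env e2.
Proof.
move=> eq12; rewrite !leval_sum; apply: eq_bigr => i _; congr (_ *: _).
elim: (size env) eq12 i => [_ []//|n IH /= [eq_n eq12] [j]].
rewrite /= ltnS leq_eqVlt => /predU1P[->//|lt_j].
exact: (IH eq12 (Ordinal lt_j)).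
Qed.

End LinearExpressions.

(* Products found through different canonical paths to the ring structure are
   convertible but not syntactically equal. *)
Ltac lsame x y :=
  first
  [ constr_eq x y
  | lazymatch x with
    | 1 => lazymatch y with 1 => idtac end
    | ?a * ?b => lazymatch y with ?c * ?d => lsame a c; lsame b d end
    | ?a ^+ ?n => lazymatch y with ?b ^+ n => lsame a b end
    | star ?a => lazymatch y with star ?b => lsame a b end
    | ?a + ?b => lazymatch y with ?c + ?d => lsame a c; lsame b d end
    | - ?a => lazymatch y with - ?b => lsame a b end
    | fun_of_matrix ?a ?i ?j =>
        lazymatch y with fun_of_matrix ?b i j => lsame a b end
    | ?c *: ?a => lazymatch y with c *: ?b => lsame a b end
    | ?f ?a => lazymatch y with ?g ?b => lsame f g; lsame a b end
    end ].

Ltac latom_index x env :=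
  match env with
  | ?y :: _ => let _ := match O with _ => lsame x y end in constr:(O)
  | _ :: ?env' => let i := latom_index x env' in constr:(S i)
  end.

Ltac latoms e env :=
  match e with
  | 0 => env
  | ?a + ?b => let env := latoms a env in latoms b env
  | - ?a => latoms a env
  | _ *: ?a => latoms a env
  | ?a *+ _ => latoms a env
  | ?x => match O with
          | _ => let _ := latom_index x env in env
          | _ => constr:(x :: env)
          end
  end.

Ltac lreify K e env :=
  match e with
  | 0 => constr:(@LZero K)
  | ?a + ?b => let a' := lreify K a env in let b' := lreify K b env in
               constr:(@LAdd K a' b')
  | - ?a => let a' := lreify K a env in constr:(@LOpp K a')
  | ?c *: ?a => let a' := lreify K a env in constr:(@LScale K c a')
  | ?a *+ ?n => let a' := lreify K a env in constr:(@LMuln K a' n)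
  | ?x => let i := latom_index x env in constr:(@LVar K i)
  end.

Ltac lmod K :=
  lazymatch goal with
  | |- @eq ?T ?a ?b =>
    let env := latoms a (@nil T) in
    let env := latoms b env in
    let ea := lreify K a env in
    let eb := lreify K b env in
    let H := fresh in
    have H := @leval_eq K _ env ea eb;
    cbn [leval nth lcoef_eq size lcoef eqn] in H;
    apply: H; repeat (split; [first [ring | by field] |]); exact: I
  end.

Lemma scalerRR (R : realType) (V : lmodType R[i]) (r s : R) (x : V) :
  r%:C *: (s%:C *: x) = (r * s)%:C *: x.
Proof. by rewrite scalerA -rmorphM. Qed.

Lemma conj_real (R : realType) (r : R) : (r%:C : R[i])^* = r%:C.
Proof. by rewrite conj_Creal // complex_real. Qed.

(** * Real-valued norms and contraction mappings *)

Section RealNorm.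
Variables (R : realType) (V : normedModType R[i]).
Implicit Types x y : V.

Lemma rnormE x : `|x| = (rnorm x)%:C.
Proof. by rewrite RRe_real // normr_real. Qed.

Lemma rnorm_ge0 x : 0 <= rnorm x.
Proof. by rewrite -lecR -rnormE normr_ge0. Qed.

Lemma rnorm0 : rnorm (0 : V) = 0.
Proof. by rewrite /rnorm normr0. Qed.

Lemma rnorm_eq0 x : rnorm x = 0 -> x = 0.
Proof. by move=> x0; apply/eqP; rewrite -normr_eq0 rnormE x0. Qed.

Lemma rnormN x : rnorm (- x) = rnorm x.
Proof. by rewrite /rnorm normrN. Qed.

Lemma rnormB x y : rnorm (x - y) = rnorm (y - x).
Proof. by rewrite -rnormN opprB. Qed.

Lemma ler_rnormD x y : rnorm (x + y) <= rnorm x + rnorm y.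
Proof. by rewrite -lecR rmorphD /= -!rnormE ler_normD. Qed.

Lemma ler_rnormB x y : rnorm (x - y) <= rnorm x + rnorm y.
Proof. by rewrite -(rnormN y) ler_rnormD. Qed.

Lemma rnormZ (c : R[i]) x : rnorm (c *: x) = complex.Re `|c| * rnorm x.
Proof.
by apply: complexI; rewrite rmorphM /= RRe_real ?normr_real // -!rnormE normrZ.
Qed.

Lemma norm_real (r : R) : complex.Re `|r%:C| = `|r|.
Proof. by rewrite normc_def /= expr0n /= addr0 sqrtr_sqr. Qed.

Lemma rnormZr (r : R) x : rnorm (r%:C *: x) = `|r| * rnorm x.
Proof. by rewrite rnormZ norm_real. Qed.

Lemma rnorm_sum (I : Type) (s : seq I) (P : pred I) (F : I -> V) :
  rnorm (\sum_(i <- s | P i) F i) <= \sum_(i <- s | P i) rnorm (F i).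
Proof.
elim/big_rec2: _ => [|i y x _ le_xy]; first by rewrite rnorm0.
by apply: le_trans (ler_rnormD _ _) _; rewrite lerD2l.
Qed.

Lemma cvg_rnorm (u : nat -> V) l : u @ \oo --> l ->
  forall e, 0 < e -> exists n, forall m, (n <= m)%N -> rnorm (u m - l) < e.
Proof.
move=> /cvgrPdist_lt ul e e0; have [|n _ nP] := ul e%:C; first by rewrite ltcR.
by exists n => m /nP /=; rewrite rnormE ltcR rnormB.
Qed.

End RealNorm.

Section RealComplete.
Variables (R : realType) (V : completeNormedModType R[i]).

Lemma rnorm_complete (u : nat -> V) :
  (forall e, 0 < e ->
    exists n, forall i j, (n <= i)%N -> (n <= j)%N -> rnorm (u i - u j) < e) ->
  exists l, forall e, 0 < e ->
    exists n, forall i, (n <= i)%N -> rnorm (u i - l) < e.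
Proof.
move=> cauchy_u; suff /cvg_ex[l ul] : cvg (u @ \oo).
  by exists l; exact: cvg_rnorm.
apply/cauchy_cvgP/cauchy_exP => e e0.
have re : e = (complex.Re e)%:C by rewrite RRe_real // gtr0_real.
have [|n nP] := cauchy_u (complex.Re e); first by rewrite -ltcR -re.
exists (u n); exists n => // i /= ni.
by rewrite -ball_normE /ball_ /= rnormE re ltcR nP.
Qed.

(** The iterates from 0 appear in the conclusion because closed properties preserved by [f], such as
    commutation with a given element, reach the fixed point through them. *)
Lemma contraction_fixpoint (f : V -> V) (r q : R) :
  0 <= q < 1 -> 0 <= r ->
  (forall x, rnorm x <= r -> rnorm (f x) <= r) ->
  (forall x y, rnorm x <= r -> rnorm y <= r ->
     rnorm (f x - f y) <= q * rnorm (x - y)) ->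
  exists x, [/\ rnorm x <= r, f x = x &
    forall e, 0 < e -> exists n, rnorm (iter n f 0 - x) < e].
Proof.
move=> /andP[q0 q1] r0 fr fq; pose u n := iter n f 0.
have ur n : rnorm (u n) <= r by elim: n => [|n /fr//]; rewrite rnorm0.
have uq n m : rnorm (u n - u (n + m)%N) <= q ^+ n * (2 * r).
  elim: n => [|n IH].
    rewrite mul1r mulrDl mul1r; apply: le_trans (ler_rnormB _ _) _.
    exact: lerD.
  rewrite exprS -mulrA; apply: le_trans (fq _ _ (ur n) (ur _)) _.
  exact: ler_wpM2l.
have q_small e : 0 < e -> exists n, q ^+ n * (2 * r) < e.
  move=> e0; have /cvgrPdist_lt qcvg : q ^+ n @[n --> \oo] --> (0 : R).
    by apply: cvg_expr; rewrite ger0_norm.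
  have [|n _ /(_ n (leqnn n))/=] := qcvg (e / (2 * r + 1)).
    by rewrite divr_gt0 // ltr_wpDl // mulr_ge0.
  rewrite sub0r normrN ger0_norm ?exprn_ge0 // ltr_pdivlMr; last first.
    by rewrite ltr_wpDl // mulr_ge0.
  move=> qe; exists n; apply: le_lt_trans qe.
  by rewrite ler_wpM2l ?exprn_ge0 // lerDl.
have u_cauchy e : 0 < e ->
    exists n, forall i j, (n <= i)%N -> (n <= j)%N -> rnorm (u i - u j) < e.
  move=> e0; have [|n ne] := q_small (e / 2); first by rewrite divr_gt0.
  exists n => i j ni nj; have nP k : (n <= k)%N -> rnorm (u n - u k) < e / 2.
    by move=> nk; rewrite -(subnKC nk); exact: le_lt_trans (uq _ _) ne.
  have -> : u i - u j = (u n - u j) - (u n - u i) by lmod R[i].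
  apply: le_lt_trans (ler_rnormB _ _) _.
  by rewrite [ltRHS](splitr e) ltrD ?nP.
have [x xP] := rnorm_complete u_cauchy; exists x.
have xr : rnorm x <= r.
  apply/ler_addgt0Pr => e /xP[n /(_ n (leqnn n)) lt_e].
  have {1}-> : x = u n - (u n - x) by lmod R[i].
  by apply: le_trans (ler_rnormB _ _) _; rewrite lerD // ltW.
split=> //; last by move=> e /xP[n /(_ n (leqnn n))]; exists n.
apply/eqP; rewrite -subr_eq0; apply/eqP/rnorm_eq0/eqP.
rewrite eq_le rnorm_ge0 andbT; apply/ler_addgt0Pl => e e0; rewrite addr0.
have [|n nP] := xP (e / 2); first by rewrite divr_gt0.
have -> : f x - x = (u n.+1 - x) - (u n.+1 - f x) by lmod R[i].
apply: le_trans (ler_rnormB _ _) _; rewrite (splitr e) lerD //.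
  by rewrite ltW // nP.
apply: le_trans (fq _ _ (ur n) xr) _.
rewrite -[leRHS]mul1r ler_pM ?rnorm_ge0 ?(ltW q1) //.
by rewrite ltW // nP.
Qed.

End RealComplete.

(** * Square roots and inverses in a C*-algebra *)

Section CStarBasics.
Variables (R : realType) (B : cstarAlgType R).
Implicit Types (x y a b h : B) (c : R[i]).

Lemma cscalerAl c x y : (c *: x) * y = c *: (x * y).
Proof. by rewrite [RHS]cstar_scaleAl. Qed.

Lemma cscalerAr c x y : x * (c *: y) = c *: (x * y).
Proof. by rewrite [RHS]cstar_scaleAr. Qed.

Lemma starD x y : star (x + y) = star x + star y.
Proof. by rewrite -{1}[x]scale1r star_semilinear conjC1 scale1r. Qed.

Lemma star0 : star (0 : B) = 0.
Proof. by apply: (addrI (star 0)); rewrite -starD !addr0. Qed.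

Lemma starZ c x : star (c *: x) = c^* *: star x.
Proof. by rewrite -[c *: x]addr0 star_semilinear star0 addr0. Qed.

Lemma starZr (r : R) x : star (r%:C *: x) = r%:C *: star x.
Proof. by rewrite starZ conj_real. Qed.

Lemma starN x : star (- x) = - star x.
Proof. by apply: (addrI (star x)); rewrite -starD !subrr star0. Qed.

Lemma starM x y : star (x * y) = star y * star x.
Proof. exact: star_mul. Qed.

Lemma star1 : star (1 : B) = 1.
Proof. by rewrite -[LHS]mul1r -{1}[1]starK -starM mul1r starK. Qed.

Lemma starX x n : star (x ^+ n) = star x ^+ n.
Proof. by elim: n => [|n IH]; rewrite ?expr0 ?star1 // exprS exprSr starM IH.
  Qed.

Lemma star_sum (I : Type) (s : seq I) (P : pred I) (F : I -> B) :
  star (\sum_(i <- s | P i) F i) = \sum_(i <- s | P i) star (F i).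
Proof. exact: (big_morph _ starD star0). Qed.

Lemma ler_rnormM x y : rnorm (x * y) <= rnorm x * rnorm y.
Proof. by rewrite -lecR rmorphM /= -!rnormE; exact: cstar_normM. Qed.

Lemma rnorm_starM x : rnorm (star x * x) = rnorm x ^+ 2.
Proof.
by apply: complexI; rewrite rmorphXn /= -!rnormE; exact: cstar_identity.
Qed.

Lemma rnorm_star x : rnorm (star x) = rnorm x.
Proof.
suff le_star y : rnorm y <= rnorm (star y).
  by apply/eqP; rewrite eq_le le_star -{2}[x]starK le_star.
have [->|y0] := eqVneq (rnorm y) 0; first exact: rnorm_ge0.
rewrite -(ler_pM2r (_ : 0 < rnorm y)) ?lt0r ?y0 ?rnorm_ge0 //.
by rewrite -expr2 -rnorm_starM ler_rnormM.
Qed.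

Lemma rnorm1_le : rnorm (1 : B) <= 1.
Proof.
have := rnorm_starM 1; rewrite star1 mulr1 => n1; have := rnorm_ge0 (1 : B).
by nra.
Qed.

Lemma rnorm_scal_le (r : R) : rnorm (r%:C *: (1 : B)) <= `|r|.
Proof. by rewrite rnormZr -[leRHS]mulr1 ler_wpM2l // rnorm1_le. Qed.

Lemma rnorm_sqr_sa x : star x = x -> rnorm (x * x) = rnorm x ^+ 2.
Proof. by move=> xs; rewrite -rnorm_starM xs. Qed.

Lemma ler_rnormX x n : rnorm (x ^+ n) <= rnorm x ^+ n.
Proof.
elim: n => [|n IH]; first exact: rnorm1_le.
rewrite !exprS; apply: le_trans (ler_rnormM _ _) _.
by rewrite ler_wpM2l ?rnorm_ge0.
Qed.

Lemma rnormX_sa x n : star x = x -> rnorm (x ^+ (2 ^ n)) = rnorm x ^+ (2 ^ n).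
Proof.
move=> xs; elim: n => [|n IH]; first by rewrite !expr1.
rewrite expnS mulnC !exprM -IH -rnorm_sqr_sa ?expr2 //.
by rewrite starX xs.
Qed.

Lemma small_rnorm_eq0 x (C : R) : (forall e, 0 < e -> rnorm x <= C * e) -> x =
  0.
Proof.
move=> small; apply/rnorm_eq0/eqP; rewrite eq_le rnorm_ge0 andbT.
apply/ler_addgt0Pl => e e0; rewrite addr0.
have C1 : 0 < `|C| + 1 by rewrite ltr_wpDl.
apply: le_trans (small (e / (`|C| + 1)) _) _; first by rewrite divr_gt0.
rewrite mulrA ler_pdivrMr // [leRHS]mulrC ler_wpM2r ?(ltW e0) //.
by rewrite (le_trans (ler_norm C)) // lerDl.
Qed.

(* The square root is [1 - z] with [z] a fixed point of [z |-> (x + z^2)/2]. *)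
Lemma sqrt_one_sub x : star x = x -> rnorm x < 1 -> exists y,
  [/\ star y = y, y * y = 1 - x & forall b, b * x = x * b -> b * y = y * b].
Proof.
move=> xs x1; pose f z := (2^-1 : R)%:C *: (x + z * z).
have x0 := rnorm_ge0 x.
have fd z w : rnorm z <= rnorm x -> rnorm w <= rnorm x ->
    rnorm (f z - f w) <= rnorm x * rnorm (z - w).
  move=> zx wx.
  have -> : f z - f w = (2^-1 : R)%:C *: (z * (z - w) + (z - w) * w).
    by rewrite /f !(mulrBr, mulrBl); lmod R[i].
  rewrite rnormZr ger0_norm ?invr_ge0 //.
  have := ler_rnormD (z * (z - w)) ((z - w) * w).
  have := ler_rnormM z (z - w); have := ler_rnormM (z - w) w.
  have := rnorm_ge0 (z - w); have := rnorm_ge0 z; have := rnorm_ge0 w.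
  by nra.
have [||z zx|z w|z [zx fz zlim]] := @contraction_fixpoint R B f (rnorm x)
  (rnorm x).
- by rewrite x0.
- exact: x0.
- rewrite rnormZr ger0_norm ?invr_ge0 //.
  have := ler_rnormD x (z * z); have := ler_rnormM z z; have := rnorm_ge0 z.
  by nra.
- exact: fd.
(* [star z] is a second fixed point in the same ball, and a contraction has only one. *)
have zs : star z = z.
  apply/eqP; rewrite -subr_eq0; apply/eqP/rnorm_eq0.
  have fzs : f (star z) = star z.
    by rewrite -[in RHS]fz /f starZr starD starM xs.
  have := fd (star z) z; rewrite rnorm_star fz fzs => /(_ zx zx).
  have := rnorm_ge0 (star z - z); nra.
have zc (c : B) : c * x = x * c -> c * z = z * c.
  move=> cx; apply/eqP; rewrite -subr_eq0; apply/eqP.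
  apply: (@small_rnorm_eq0 _ (2 * rnorm c)) => e /zlim[n].
  set u := iter n f 0 => ue.
  have cu : c * u = u * c.
    rewrite /u; elim: (n) => [|m IH] /=; first by rewrite mulr0 mul0r.
    by rewrite /f cscalerAr cscalerAl mulrDr mulrDl cx mulrA IH -mulrA IH mulrA.
  have -> : c * z - z * c = (u - z) * c - c * (u - z).
    by rewrite mulrBr mulrBl cu; lmod R[i].
  apply: le_trans (ler_rnormB _ _) _.
  have := ler_rnormM (u - z) c; have := ler_rnormM c (u - z).
  have := rnorm_ge0 c; nra.
exists (1 - z); split=> [||c cx].
- by rewrite starD starN star1 zs.
- have zz : z * z = (2 : R)%:C *: z - x.
    rewrite -[in RHS]fz /f scalerA -rmorphM /= divff ?pnatr_eq0 //.
    by rewrite scale1r addrC addKr.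
  by rewrite mulrBl !mulrBr zz !mulr1 !mul1r; lmod R[i].
- by rewrite mulrBl mulrBr mulr1 mul1r zc.
Qed.

(** The right and left inverses are found separately, as fixed points of [z |-> 1 + x * z] and
    [z |-> 1 + z * x], and then coincide. The radius [r = 1 / (1 - |x|)] solves [1 + |x| * r = r],
    so the ball is invariant; it also gives the norm bound. *)
Lemma neumann x : rnorm x < 1 ->
  exists z, [/\ (1 - x) * z = 1, z * (1 - x) = 1 & (1 - rnorm x) * rnorm z <=
    1].
Proof.
move=> x1; have x0 := rnorm_ge0 x; pose r := (1 - rnorm x)^-1.
have r0 : 0 <= r by rewrite invr_ge0 subr_ge0 ltW.
have re : 1 + rnorm x * r = r.
  by apply: (mulfI (_ : 1 - rnorm x != 0)); rewrite ?subr_eq0 ?gt_eqF // /r;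
    field; rewrite subr_eq0 gt_eqF.
have fixp (f : B -> B) :
    (forall z, rnorm (f z - 1) <= rnorm x * rnorm z) ->
    (forall z w, rnorm (f z - f w) <= rnorm x * rnorm (z - w)) ->
    exists2 z, f z = z & rnorm z <= r.
  move=> f1 fd; have [||z zr|z w _ _|z [zr fz _]] :=
    @contraction_fixpoint R B f r (rnorm x).
  - by rewrite x0.
  - exact: r0.
  - have -> : f z = 1 + (f z - 1) by lmod R[i].
    apply: le_trans (ler_rnormD _ _) _; rewrite -re lerD ?rnorm1_le //.
    by apply: le_trans (f1 z) _; rewrite ler_wpM2l.
  - exact: fd.
  - by exists z.
have [||z fz zr] := fixp (fun z => 1 + x * z).
- by move=> z; rewrite addrC addKr ler_rnormM.
- by move=> z w; rewrite opprD addrACA subrr add0r -mulrBr ler_rnormM.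
have [||w fw _] := fixp (fun z => 1 + z * x).
- by move=> w; rewrite addrC addKr [leRHS]mulrC ler_rnormM.
- by move=> w v; rewrite opprD addrACA subrr add0r -mulrBl [leRHS]mulrC
    ler_rnormM.
have zl : (1 - x) * z = 1 by rewrite mulrBl mul1r -{1}fz addrK.
have wr : w * (1 - x) = 1 by rewrite mulrBr mulr1 -{1}fw addrK.
exists z; split=> //; first by rewrite -[z]mul1r -{1}wr -(mulrA w) zl mulr1.
by rewrite mulrC -ler_pdivlMr ?subr_gt0 // mul1r.
Qed.

Lemma star_inv x y : star x = x -> x * y = 1 -> y * x = 1 -> star y = y.
Proof.
move=> xs xy yx; rewrite -[star y]mulr1 -xy mulrA -{1}xs -starM.
by rewrite xy star1 mul1r.
Qed.

End CStarBasics.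

(** * The positive cone *)

Section PositiveCone.
Variables (R : realType) (B : cstarAlgType R).
Implicit Types (x y a b h : B) (r e : R).
Local Notation "r %:I" := (r%:C *: (1 : B))
  (at level 1, left associativity, format "r %:I").

(* Positivity expressed through the norm: [a] lies in the ball of radius [l]
   around [l]. Unlike the existence of a square root, this is visibly stable
   under sums and limits. *)
Definition pos a := star a = a /\ exists2 l : R, 0 <= l & rnorm (l%:I - a) <= l.

Lemma star_scal r : star (r%:I : B) = r%:I.
Proof. by rewrite starZr star1. Qed.

Lemma star_sub a b : star a = a -> star b = b -> star (a - b) = a - b.
Proof. by move=> ea eb; rewrite starD starN ea eb. Qed.

Lemma star_add a b : star a = a -> star b = b -> star (a + b) = a + b.
Proof. by move=> ea eb; rewrite starD ea eb. Qed.

Lemma scal_comm r x : r%:I * x = x * r%:I.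
Proof. by rewrite cscalerAl cscalerAr mul1r mulr1. Qed.

(* With [k = sqrt (m^2 - h^2)], the element [u = h + i k] satisfies
   [u^* u = m^2], and [h] and [h^2 - k^2] are the real parts of [u] and [u^2].
     *)
Lemma rnorm_sqr_sub h k r : star h = h -> star k = k -> h * k = k * h ->
  0 <= r -> h * h + k * k = r%:I ->
  rnorm h ^+ 2 <= r /\ rnorm (h * h - k * k) <= r.
Proof.
move=> hs ks hk r0 hkr; pose u := h + 'i%C *: k; pose v := h - 'i%C *: k.
have ii : 'i%C * 'i%C = -1 :> R[i] by rewrite -expr2 sqr_i.
have us : star u = v.
  by rewrite starD starZ hs ks complexiE conjCi scaleNr -complexiE.
have vu : v * u = r%:I.
  rewrite /u /v mulrDr !mulrBl !(cscalerAl, cscalerAr) scalerA ii -hkr hk.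
  by rewrite scaleN1r; lmod R[i].
have u2 : rnorm u ^+ 2 <= r.
  by rewrite -rnorm_starM us vu -[leRHS]ger0_norm // rnorm_scal_le.
have vE : rnorm v = rnorm u by rewrite -us rnorm_star.
have u0 := rnorm_ge0 u.
split.
  have -> : h = (2^-1 : R)%:C *: (u + v).
    by rewrite /u /v; lmod R[i].
  rewrite rnormZr ger0_norm ?invr_ge0 //.
  have := ler_rnormD u v; rewrite vE; have := rnorm_ge0 (u + v); nra.
have -> : h * h - k * k = (2^-1 : R)%:C *: (u * u + v * v).
  have -> : u * u + v * v = (2 : R)%:C *: (h * h - k * k).
    rewrite /u /v !(mulrDr, mulrDl, mulNr, mulrN) !(cscalerAl, cscalerAr).
    by rewrite !scalerA ii hk !scaleN1r; lmod R[i].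
  by rewrite scalerRR mulVf ?pnatr_eq0 // scale1r.
rewrite rnormZr ger0_norm ?invr_ge0 //.
have := ler_rnormD (u * u) (v * v).
have := ler_rnormM u u; have := ler_rnormM v v; rewrite vE; nra.
Qed.

(** With [k^2 = m^2 - h^2], the difference [h^2 - k^2] is [2 h^2 - m^2], so this is half of the
    second bound of [rnorm_sqr_sub]. Strictness of [|h| < m] is what [sqrt_one_sub] asks of
    [h^2 / m^2]. *)
Lemma rnorm_sa_sqr h m : star h = h -> rnorm h < m ->
  rnorm ((m ^+ 2 / 2)%:I - h * h) <= m ^+ 2 / 2.
Proof.
move=> hs hm; have m0 : 0 < m by exact: le_lt_trans (rnorm_ge0 h) hm.
pose x := (m ^- 2)%:C *: (h * h).
have xs : star x = x by rewrite starZr starM hs.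
have [|y [ys yy yc]] := sqrt_one_sub xs.
  rewrite rnormZr ger0_norm ?invr_ge0 ?exprn_ge0 ?(ltW m0) //.
  rewrite rnorm_sqr_sa // mulrC ltr_pdivrMr ?exprn_gt0 // mul1r.
  by rewrite ltr_pXn2r ?nnegrE ?rnorm_ge0 ?(ltW m0).
pose k := m%:C *: y.
have mm : m ^+ 2 * m ^- 2 = 1 by rewrite divff // expf_neq0 // gt_eqF.
have kk : h * h + k * k = (m ^+ 2)%:I.
  rewrite /k cscalerAl cscalerAr scalerRR yy scalerBr /x scalerRR -(expr2 m) mm.
  by lmod R[i].
have [||||_] := @rnorm_sqr_sub h k (m ^+ 2) _ _ _ _ kk => //.
- by rewrite starZr ys.
- by rewrite cscalerAr cscalerAl yc // cscalerAr cscalerAl mulrA.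
- by rewrite exprn_ge0 // ltW.
have -> : h * h - k * k = (2 : R)%:C *: (h * h - (m ^+ 2 / 2)%:I).
  have -> : k * k = (m ^+ 2)%:I - h * h by rewrite -kk; lmod R[i].
  rewrite scalerBr scalerRR mulrCA divff ?pnatr_eq0 // mulr1.
  by lmod R[i].
rewrite rnormZr ger0_norm // rnormB; lra.
Qed.

Lemma pos_sa a : pos a -> star a = a. Proof. by case. Qed.

Lemma pos0 : pos 0.
Proof. by split; [exact: star0|exists 0; rewrite // scale0r subr0 rnorm0]. Qed.

Lemma posD a b : pos a -> pos b -> pos (a + b).
Proof.
move=> [ea [l l0 al]] [eb [m m0 bm]]; split; first exact: star_add.
exists (l + m); first exact: addr_ge0.
have -> : (l + m)%:I - (a + b) = (l%:I - a) + (m%:I - b).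
  by lmod R[i].
by apply: le_trans (ler_rnormD _ _) _; exact: lerD.
Qed.

Lemma pos_sum (I : Type) (s : seq I) (P : pred I) (F : I -> B) :
  (forall i, P i -> pos (F i)) -> pos (\sum_(i <- s | P i) F i).
Proof. by move=> posF; elim/big_ind: _ => [|a b|//];
  [exact: pos0|exact: posD]. Qed.

Lemma posZ r a : 0 <= r -> pos a -> pos (r%:C *: a).
Proof.
move=> r0 [ea [l l0 al]]; split; first by rewrite starZr ea.
exists (r * l); first exact: mulr_ge0.
have -> : (r * l)%:I - r%:C *: a = r%:C *: (l%:I - a).
  by rewrite scalerBr scalerRR.
by rewrite rnormZr ger0_norm // ler_wpM2l.
Qed.

Lemma pos_scal_sub r a : star a = a -> rnorm a <= r -> pos (r%:I - a).
Proof.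
move=> ea ar; split; first by apply: star_sub; rewrite ?star_scal.
exists r; first exact: le_trans (rnorm_ge0 a) ar.
by rewrite subKr.
Qed.

Lemma pos_scal r : 0 <= r -> pos r%:I.
Proof. by move=> r0; rewrite -[r%:I]subr0; apply: pos_scal_sub;
  rewrite ?star0 ?rnorm0. Qed.

Lemma pos_sa_sqr h : star h = h -> pos (h * h).
Proof.
move=> hs; split; first by rewrite starM hs.
exists ((rnorm h + 1) ^+ 2 / 2); last by apply: rnorm_sa_sqr; rewrite ?ltrDl.
by rewrite divr_ge0 // exprn_ge0 // addr_ge0 ?rnorm_ge0.
Qed.

Lemma pos_sqrt a e : pos a -> 0 < e -> exists y,
  [/\ star y = y, y * y = a + e%:I & forall b, b * a = a * b -> b * y = y * b].
Proof.
move=> [ea [l l0 al]] e0; have le0 : 0 < l + e by exact: ltr_wpDl.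
pose x := (l + e)^-1%:C *: (l%:I - a).
have xs : star x = x by rewrite starZr star_sub // star_scal.
have [|y [ys yy yc]] := sqrt_one_sub xs.
  rewrite rnormZr ger0_norm ?invr_ge0 ?(ltW le0) // mulrC ltr_pdivrMr // mul1r.
  by apply: le_lt_trans al _; rewrite ltrDl.
exists ((Num.sqrt (l + e))%:C *: y); split.
- by rewrite starZr ys.
- rewrite cscalerAl cscalerAr scalerRR -expr2 sqr_sqrtr ?(ltW le0) // yy.
  rewrite scalerBr /x scalerRR divff ?gt_eqF //.
  by lmod R[i].
- move=> b ba; rewrite cscalerAr cscalerAl yc //.
  by rewrite cscalerAr cscalerAl mulrBr mulrBl -scal_comm ba.
Qed.

(** The unspecified centre in [pos] may be taken to be half the norm: write [a + e = y^2] and apply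
    [rnorm_sa_sqr] to [y] with [m^2 = |a| + 2 e], the second [e] making the inequality strict. *)
Lemma pos_half_norm a : pos a -> rnorm ((rnorm a / 2)%:I - a) <= rnorm a / 2.
Proof.
move=> pa; apply/ler_addgt0Pr => e e0; have [y [ys yy _]] := pos_sqrt pa e0.
have a0 := rnorm_ge0 a.
have ny : rnorm y ^+ 2 <= rnorm a + e.
  rewrite -rnorm_sqr_sa // yy; apply: le_trans (ler_rnormD _ _) _.
  by rewrite lerD2l -[leRHS]ger0_norm ?(ltW e0) ?rnorm_scal_le.
have m0 : 0 <= rnorm a + 2 * e by rewrite addr_ge0 // mulr_ge0 ?(ltW e0).
have := @rnorm_sa_sqr y (Num.sqrt (rnorm a + 2 * e)) ys.
rewrite sqr_sqrtr // yy => /(_ _) H.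
have -> : (rnorm a / 2)%:I - a = ((rnorm a + 2 * e) / 2)%:I - (a + e%:I).
  by lmod R[i].
apply: le_trans (H _) _; last lra.
rewrite -(@ltr_pXn2r _ 2) ?nnegrE ?rnorm_ge0 ?sqrtr_ge0 // sqr_sqrtr //.
by apply: le_lt_trans ny _; rewrite ltrD2l; lra.
Qed.

Lemma pos_ge_half a l : pos a -> rnorm a <= 2 * l -> rnorm (l%:I - a) <= l.
Proof.
move=> pa al.
have -> : l%:I - a = ((rnorm a / 2)%:I - a) + (l - rnorm a / 2)%:I.
  by lmod R[i].
apply: le_trans (ler_rnormD _ _) _.
have := pos_half_norm pa; have := @rnorm_scal_le R B (l - rnorm a / 2).
rewrite ger0_norm; lra.
Qed.

(** The centre of the ball must not depend on the approximant: [(|a| + 1) / 2] serves every positive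
    [b] within distance 1 of [a], by [pos_ge_half]. *)
Lemma pos_closed a : star a = a ->
  (forall e, 0 < e -> exists2 b, pos b & rnorm (a - b) <= e) -> pos a.
Proof.
move=> ea lim; split=> //; exists ((rnorm a + 1) / 2).
  by rewrite divr_ge0 // addr_ge0 ?rnorm_ge0.
apply/ler_addgt0Pr => e e0.
have [|b pb ab] := lim (Num.min 1 e); first by rewrite lt_min ltr01.
have -> : ((rnorm a + 1) / 2)%:I - a = (((rnorm a + 1) / 2)%:I - b) - (a - b).
  by lmod R[i].
apply: le_trans (ler_rnormB _ _) _; rewrite lerD //; last first.
  by apply: le_trans ab _; rewrite ge_min lexx orbT.
apply: pos_ge_half => //.
have -> : b = a - (a - b) by lmod R[i].
apply: le_trans (ler_rnormB _ _) _; rewrite mulrCA divff ?pnatr_eq0 // mulr1.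
by rewrite lerD2l (le_trans ab) // ge_min lexx.
Qed.

Lemma pos_lim a (C : R) : star a = a -> 
  (forall e, 0 < e -> exists2 b, pos b & rnorm (a - b) <= C * e) -> pos a.
Proof.
move=> ea lim; apply: pos_closed => // e e0.
have C1 : 0 < `|C| + 1 by rewrite ltr_wpDl.
have [|b pb ab] := lim (e / (`|C| + 1)); first by rewrite divr_gt0.
exists b => //; apply: le_trans ab _; rewrite mulrA ler_pdivrMr // mulrC.
by rewrite ler_wpM2l ?(ltW e0) // (le_trans (ler_norm C)) // lerDl.
Qed.

(** The square roots of [a + e] and [b + e] commute, so their product is selfadjoint, and its square
    [(a + e) * (b + e)] tends to [a * b]. *)
Lemma pos_mul a b : pos a -> pos b -> a * b = b * a -> pos (a * b).
Proof.
move=> pa pb ab; apply: (@pos_lim _ (rnorm a + rnorm b + 1)).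
  by rewrite starM (pos_sa pa) (pos_sa pb).
move=> e0 e00; set e := Num.min 1 e0.
have e_gt0 : 0 < e by rewrite lt_min ltr01.
have e_le1 : e <= 1 by rewrite ge_min lexx.
have e_le : e <= e0 by rewrite ge_min lexx orbT.
have [y [ys yy yc]] := pos_sqrt pa e_gt0.
have [x [xs xx xc]] := pos_sqrt pb e_gt0.
have yb : b * y = y * b by rewrite yc.
have xy : x * y = y * x by rewrite -xc.
exists ((y * x) * (y * x)).
  by apply: pos_sa_sqr; rewrite starM ys xs.
have -> : y * x * (y * x) = (a + e%:I) * (b + e%:I).
  by rewrite -yy -xx -!mulrA (mulrA x) xy !mulrA.
have -> : a * b - (a + e%:I) * (b + e%:I) =
    - (e%:C *: a + e%:C *: b + e%:C *: e%:I).
  rewrite !(mulrDr, mulrDl) !(cscalerAl, cscalerAr) mul1r !mulr1; lmod R[i].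
rewrite rnormN; apply: le_trans (ler_rnormD _ _) _.
have := ler_rnormD (e%:C *: a) (e%:C *: b); have := @rnorm_scal_le R B e.
rewrite !rnormZr ger0_norm ?(ltW e_gt0) //.
have := rnorm_ge0 a; have := rnorm_ge0 b; have := rnorm_ge0 (1 : B).
by have := @rnorm1_le R B; nra.
Qed.

Lemma posX a n : pos a -> pos (a ^+ n).
Proof.
move=> pa; elim: n => [|n IH].
  by have := pos_scal ler01; rewrite rmorph1 scale1r.
by rewrite exprS; apply: pos_mul => //; rewrite -exprS -exprSr.
Qed.

(** The commuting square roots of [a + e] and [r - a + e] have squares summing to [r + 2 e], so
    [rnorm_sqr_sub] bounds [|a + e|] by [r + 2 e]. Removing [e] costs a third one, hence
    [e = d / 3]. *)
Lemma pos_norm_le_scal a r : 0 <= r -> pos a -> pos (r%:I - a) -> rnorm a <= r.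
Proof.
move=> r0 pa pr; apply/ler_addgt0Pr => d d0; pose e := d / 3.
have e0 : 0 < e by rewrite divr_gt0.
have [y [ys yy yc]] := pos_sqrt pa e0.
have [x [xs xx xc]] := pos_sqrt pr e0.
have xy : y * x = x * y.
  by rewrite yc // -xc // mulrBl mulrBr scal_comm.
have xxyy : y * y + x * x = (r + 2 * e)%:I.
  by rewrite yy xx; lmod R[i].
have [//||+ _] := rnorm_sqr_sub ys xs _ _ xxyy.
  by rewrite addr_ge0 // mulr_ge0 ?(ltW e0).
rewrite -rnorm_sqr_sa // yy => le_re.
have -> : a = a + e%:I - e%:I by lmod R[i].
apply: le_trans (ler_rnormB _ _) _; have := @rnorm_scal_le R B e.
rewrite ger0_norm ?(ltW e0) // /e in le_re *; lra.
Qed.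

Lemma pos_norm_le a b : pos a -> pos (b - a) -> rnorm a <= rnorm b.
Proof.
move=> pa pba; apply: pos_norm_le_scal => //; first exact: rnorm_ge0.
have -> : (rnorm b)%:I - a = ((rnorm b)%:I - b) + (b - a) by lmod R[i].
apply: posD => //; apply: pos_scal_sub => //.
have -> : b = (b - a) + a by lmod R[i].
by apply: star_add; exact: pos_sa.
Qed.

Lemma pos_anti a : pos a -> pos (- a) -> a = 0.
Proof.
move=> pa na; apply/rnorm_eq0/eqP; rewrite eq_le rnorm_ge0 andbT.
by apply: pos_norm_le_scal => //; rewrite scale0r sub0r.
Qed.

End PositiveCone.

Section PowerGrowth.
Variable R : realType.
Implicit Types r d q C M : R.

Lemma bernoulli_ge r n : 0 <= r -> 1 + r *+ n <= (1 + r) ^+ n.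
Proof.
move=> r0; elim: n => [|n IH]; first by rewrite mulr0n addr0 expr0.
rewrite exprS mulrSr.
have : 0 <= r *+ n by rewrite mulrn_wge0.
by move: IH; set u := _ ^+ n; set v := r *+ n; nra.
Qed.

Lemma exprn2_unbounded r M : 1 < r -> exists n, M < r ^+ (2 ^ n.+1).
Proof.
move=> r1; have d0 : 0 < r - 1 by rewrite subr_gt0.
pose n := Num.truncn (`|M| / (r - 1)).
exists n; have -> : r = 1 + (r - 1) by lra.
apply: lt_le_trans (bernoulli_ge _ (ltW d0)).
apply: le_lt_trans (ler_norm M) _; apply: ltr_wpDl => //.
rewrite -mulr_natl -ltr_pdivrMr //; apply: lt_le_trans (truncnS_gt _) _.
by rewrite ler_nat ltnW // ltn_expl.
Qed.

(** Stands in for a comparison of spectral radii: the constant [C] and the missing factor [q] are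
    negligible for large exponents. Only powers of 2 occur because these are the exponents of
    [rnormX_sa]. *)
Lemma le_of_exprn2 d q C : 0 <= d -> 0 <= q ->
  (forall n, d ^+ (2 ^ n) <= C * q ^+ (2 ^ n).-1) -> d <= q.
Proof.
move=> d0 q0 dq; rewrite leNgt; apply/negP => qd.
have [q_eq0|q_neq0] := eqVneq q 0.
  have := dq 1; rewrite q_eq0 expr1 mulr0 leNgt => /negP; apply.
  by rewrite exprn_gt0 // (le_lt_trans q0).
have q_gt0 : 0 < q by rewrite lt0r q_neq0.
have [|n] := @exprn2_unbounded (d / q) (C / q);
  first by rewrite ltr_pdivlMr // mul1r.
rewrite expr_div_n ltr_pdivlMr ?exprn_gt0 // ltNge => /negP; apply.
apply: le_trans (dq n.+1) _; rewrite -mulrA.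
have -> : q ^+ (2 ^ n.+1) = q * q ^+ (2 ^ n.+1).-1.
  by rewrite -exprS prednK // expn_gt0.
by rewrite mulKf.
Qed.

End PowerGrowth.

(** * Positivity of [a^* a] *)

Section KelleyVaught.
Variables (R : realType) (B : cstarAlgType R).
Implicit Types (w x y a b h : B) (r e : R).
Local Notation "r %:I" := (r%:C *: (1 : B))
  (at level 1, left associativity, format "r %:I").

Lemma rnorm_mul_star w : rnorm (w * star w) = rnorm (star w * w).
Proof. by rewrite -{1}[w]starK !rnorm_starM rnorm_star. Qed.

(* [w w^*] and [w^* w] have the same nonzero spectrum. *)
Lemma rnorm_swap w r (k := w * star w) (k' := star w * w) :
  rnorm (k * k + r%:C *: k) <= rnorm (k' * k' + r%:C *: k').
Proof.
set f := k' * k' + _; pose g := k' + r%:I.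
have k's : star k' = k' by rewrite /k' starM starK.
have gs : star g = g by apply: star_add; rewrite ?star_scal.
have fE : f = k' * g by rewrite /g mulrDr cscalerAr mulr1.
have dE : k * k + r%:C *: k = w * g * star w.
  rewrite /k /g /k' !(mulrDr, mulrDl) cscalerAr cscalerAl mulr1.
  by rewrite !mulrA.
have ds : star (w * g * star w) = w * g * star w.
  by rewrite !starM starK gs mulrA.
(* Since [star w * w * g = f], the power [(w * g * star w) ^+ N] is [w * g * f ^+ N.-1 * star w];
   the outer factors make up the constant. *)
rewrite dE; apply: (@le_of_exprn2 _ _ _ (rnorm w * rnorm g * rnorm w)).
- exact: rnorm_ge0.
- exact: rnorm_ge0.
move=> n; rewrite -rnormX_sa //.
have -> : (w * g * star w) ^+ (2 ^ n) = w * (g * f ^+ (2 ^ n).-1) * star w.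
  rewrite -[in LHS](@prednK (2 ^ n)) ?expn_gt0 //.
  elim: _.-1 => [|m IH]; first by rewrite expr1 expr0 mulr1.
  rewrite exprS IH !mulrA -(mulrA _ (star w) w) -/k' -(mulrA _ k' g) -fE.
  rewrite -!mulrA; congr (w * _).
  by rewrite exprS !mulrA.
apply: le_trans (ler_rnormM _ _) _; rewrite rnorm_star mulrAC ler_wpM2r
  ?rnorm_ge0 //.
apply: le_trans (ler_rnormM _ _) _; rewrite -mulrA ler_wpM2l ?rnorm_ge0 //.
apply: le_trans (ler_rnormM _ _) _; rewrite ler_wpM2l ?rnorm_ge0 //.
exact: ler_rnormX.
Qed.

Lemma pos_star_mul_sum w : pos (star w * w + w * star w).
Proof.
pose p := w + star w; pose q := 'i%C *: (w - star w).
have ps : star p = p by rewrite /p starD starK addrC.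
have qs : star q = q.
  rewrite /q starZ starD starN starK complexiE conjCi scaleNr -scalerN.
  by rewrite opprB.
have -> : star w * w + w * star w = (2^-1 : R)%:C *: (p * p + q * q).
  have ii : 'i%C * 'i%C = -1 :> R[i] by rewrite -expr2 sqr_i.
  rewrite /p /q !(cscalerAl, cscalerAr) scalerA ii scaleN1r.
  by rewrite !(mulrDr, mulrDl, mulrN, mulNr); lmod R[i].
by apply: posZ; rewrite ?invr_ge0 //; apply: posD; exact: pos_sa_sqr.
Qed.

(* If the spectrum of [w^* w] is bounded above by 1 then that of [w w^*] is
   bounded below by -1 while still being bounded above by 1, as the two spectra
   agree; the quadratic polynomial [t^2 + m t / 2] detects this on norms. *)
Lemma rnorm_star_mul_le w : pos (1%:I - star w * w) -> rnorm (star w * w) <= 3.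
Proof.
move=> pk'; have := @rnorm_swap w (rnorm (star w * w) / 2).
set k := w * star w; set k' := star w * w; set m := rnorm k'.
have mk : rnorm k = m by rewrite /k /m rnorm_mul_star.
have m0 : 0 <= m by exact: rnorm_ge0.
have ks : star k = k by rewrite /k starM starK.
have pk : pos (k + 1%:I).
  have -> : k + 1%:I = (k' + k) + (1%:I - k') by lmod R[i].
  by apply: posD => //; exact: pos_star_mul_sum.
have n1 : rnorm ((m / 2)%:I + k') <= m / 2 + 1.
  have -> : (m / 2)%:I + k' = (((m + 1) / 2)%:I - (1%:I - k')) + (2^-1)%:I.
    by lmod R[i].
  apply: le_trans (ler_rnormD _ _) _.
  have : rnorm (((m + 1) / 2)%:I - (1%:I - k')) <= (m + 1) / 2.
    apply: pos_ge_half => //; apply: le_trans (ler_rnormB _ _) _.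
    have := @rnorm_scal_le R B 1; rewrite normr1 -/m; lra.
  have := @rnorm_scal_le R B 2^-1; rewrite ger0_norm ?invr_ge0 //; lra.
have n2 : rnorm (k' * k' + (m / 2)%:C *: k') <= m * (m / 2 + 1).
  have -> : k' * k' + (m / 2)%:C *: k' = k' * ((m / 2)%:I + k').
    by rewrite mulrDr cscalerAr mulr1 addrC.
  by apply: le_trans (ler_rnormM _ _) _; rewrite ler_wpM2l.
have n3 : m ^+ 2 <= rnorm (k * k + (m / 2)%:C *: k) + m / 2.
  rewrite -mk -rnorm_sqr_sa // mk.
  have -> : m / 2 = `|m / 2| by rewrite ger0_norm // divr_ge0.
  apply: le_trans (_ : rnorm (k * k + (m / 2)%:C *: k + (m / 2)%:I) <= _).
    apply: pos_norm_le; first exact: pos_sa_sqr.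
    have -> : k * k + (m / 2)%:C *: k + (m / 2)%:I - k * k =
      (m / 2)%:C *: (k + 1%:I) by lmod R[i].
    by apply: posZ; rewrite ?divr_ge0.
  apply: le_trans (ler_rnormD _ _) _; rewrite ger0_norm ?divr_ge0 // lerD2l.
  by have := @rnorm_scal_le R B (m / 2); rewrite ger0_norm ?divr_ge0.
(* The bounds combine to [m^2 <= m (m / 2 + 1) + m / 2], that is [m (m - 3) <= 0]. *)
move=> n4; rewrite leNgt; apply/negP => m3.
have {n2 n4} n5 := le_trans n4 n2.
have mm : 0 < m * (m - 3) by rewrite mulr_gt0 //; lra.
move: n3; rewrite expr2; lra.
Qed.

(** A geometric sum turns the expression into [1 - h] plus terms [h^2 (1 - h)^i], whose positivity
    uses only the norm bound on [h]. It can thus feed [rnorm_star_mul_le] before [h] is known to be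
    positive. *)
Lemma pos_one_sub_mul_exp h n : star h = h -> rnorm h <= 1 ->
  pos (1%:I - h * (1 - h) ^+ n).
Proof.
move=> hs h1; have p1 : pos (1 - h).
  by have := pos_scal_sub hs h1; rewrite rmorph1 scale1r.
have hc : h * (1 - h) = (1 - h) * h by rewrite mulrBr mulrBl mulr1 mul1r.
have -> : 1%:I - h * (1 - h) ^+ n =
    (1 - h) + \sum_(i < n) (h * h) * (1 - h) ^+ i.
  rewrite -mulr_sumr -mulrA.
  have -> : h * \sum_(i < n) (1 - h) ^+ i = 1 - (1 - h) ^+ n.
    have := subrX1 (1 - h) n; rewrite addrAC subrr sub0r mulNr => E.
    by rewrite -[LHS]opprK -E opprB.
  by rewrite mulrBr mulr1; lmod R[i].
apply: posD => //; apply: pos_sum => i _; apply: pos_mul.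
- exact: pos_sa_sqr.
- exact: posX.
- have hX : h * (1 - h) ^+ i = (1 - h) ^+ i * h by exact: commrX.
  by rewrite -[LHS]mulrA hX [LHS]mulrA hX -[LHS]mulrA.
Qed.

(** After scaling, [h = b^* b] has norm at most 1. Suppose [s = 1 - h] has norm [S > 1]. For
    [w = b s^(N/2)] one has [w^* w = h s^N], of norm at most 3 whatever [N] is. Then
    [s^(N+1) = s^N - h s^N] yields [S^N (S - 1) <= 3], which fails for large [N]. *)
Lemma pos_star_mul a : pos (star a * a).
Proof.
suff main (b : B) : rnorm (star b * b) <= 1 -> pos (star b * b).
  have c0 : 0 < rnorm a + 1 by rewrite ltr_wpDl ?rnorm_ge0.
  pose b := (rnorm a + 1)^-1%:C *: a.
  have -> : a = (rnorm a + 1)%:C *: b.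
    by rewrite /b scalerRR divff ?gt_eqF // scale1r.
  rewrite starZr cscalerAl cscalerAr scalerRR; apply: posZ.
    by rewrite -expr2 sqr_ge0.
  apply: main; rewrite rnorm_starM rnormZr ger0_norm ?invr_ge0 ?(ltW c0) //.
  rewrite exprn_ile1 ?mulr_ge0 ?invr_ge0 ?rnorm_ge0 ?(ltW c0) //.
  by rewrite mulrC ler_pdivrMr // mul1r lerDl.
set h := star b * b => h1; pose s := 1 - h; pose S := rnorm s.
have hs : star h = h by rewrite /h starM starK.
have ss : star s = s by rewrite /s star_sub ?star1.
have hc : h * s = s * h by rewrite /s mulrBr mulrBl mulr1 mul1r.
split=> //; exists 1 => //; rewrite rmorph1 scale1r -/s -/S.
rewrite leNgt; apply/negP => S1.
have S0 : 0 < S by rewrite (lt_trans ltr01).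
have [n] := @exprn2_unbounded R S (3 / (S - 1)) S1.
rewrite ltr_pdivrMr ?subr_gt0 // ltNge => /negP; apply.
pose w := b * s ^+ (2 ^ n).
have wE : star w * w = h * s ^+ (2 ^ n.+1).
  rewrite /w starM starX ss mulrA -(mulrA _ (star b)) -/h.
  have hX : h * s ^+ (2 ^ n) = s ^+ (2 ^ n) * h by exact: commrX.
  by rewrite -hX -mulrA -exprD addnn -mul2n -expnS.
have := @rnorm_star_mul_le w; rewrite wE => /(_ (pos_one_sub_mul_exp _ hs h1))
  w3.
set N := (2 ^ n.+1)%N in w3 *.
have N0 : (0 < N)%N by rewrite expn_gt0.
have SN : rnorm (s ^+ N) = S ^+ N by rewrite rnormX_sa.
(* [N + 1] is not a power of 2; the lower bound comes from splitting the exponent [2 N] as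
   [(N + 1) + (N - 1)]. *)
have SN1 : S ^+ N.+1 <= rnorm (s ^+ N.+1).
  have := rnormX_sa n.+2 ss; rewrite expnS mul2n -addnn -/N -{1}(prednK N0).
  rewrite addnC addnS -addSn exprD => E.
  have := ler_rnormM (s ^+ N.+1) (s ^+ N.-1); rewrite E -/S.
  rewrite -{2}(prednK N0) addnS -addSn exprD => le1.
  rewrite -(@ler_pM2r _ (S ^+ N.-1)) ?exprn_gt0 //; apply: le_trans le1 _.
  by rewrite ler_wpM2l ?rnorm_ge0 // ler_rnormX.
have sE : s ^+ N.+1 = s ^+ N - h * s ^+ N by rewrite exprS {1}/s mulrBl mul1r.
have := ler_rnormB (s ^+ N) (h * s ^+ N); rewrite -sE SN => le2.
rewrite mulrBr mulr1 -exprSr; lra.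
Qed.

End KelleyVaught.

Section OrderConsequences.
Variables (R : realType) (B : cstarAlgType R).
Implicit Types (x y a b c h : B) (r e : R).
Local Notation "r %:I" := (r%:C *: (1 : B))
  (at level 1, left associativity, format "r %:I").

Lemma pos_conj x a : pos a -> pos (star x * a * x).
Proof.
move=> pa; apply: (@pos_lim _ _ _ (rnorm (star x * x))).
  by rewrite !starM starK (pos_sa pa) mulrA.
move=> e e0; have [y [ys yy _]] := pos_sqrt pa e0.
exists (star (y * x) * (y * x)); first exact: pos_star_mul.
have -> : star (y * x) * (y * x) = star x * (a + e%:I) * x.
  by rewrite -yy starM ys !mulrA.
rewrite mulrDr mulrDl cscalerAr mulr1 cscalerAl.
by rewrite opprD addrA subrr sub0r rnormN rnormZr ger0_norm ?(ltW e0) // mulrC.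
Qed.

Lemma scal_sub_sqr a r : star a = a -> rnorm a < r ->
  exists y, star y = y /\ r%:I - a = star y * y.
Proof.
move=> sa ar; have re : 0 < r - rnorm a by rewrite subr_gt0.
have [y [ys yy _]] := pos_sqrt (pos_scal_sub sa (lexx _)) re.
by exists y; split=> //; rewrite ys yy; lmod R[i].
Qed.

Lemma invertible_sqrt c e : pos c -> 0 < e -> exists d d',
  [/\ star d = d, star d' = d', d * d = c + e%:I, d * d' = 1 & d' * d = 1].
Proof.
move=> pc e0; have [d [ds dd _]] := pos_sqrt pc e0.
have [cs [l l0 cl]] := pc; have le0 : 0 < l + e by exact: ltr_wpDl.
pose x := (l + e)^-1%:C *: (l%:I - c).
have [|z [xz zx _]] := @neumann _ _ x.
  rewrite rnormZr ger0_norm ?invr_ge0 ?(ltW le0) // mulrC ltr_pdivrMr // mul1r.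
  by apply: le_lt_trans cl _; rewrite ltrDl.
have ddx : d * d = (l + e)%:C *: (1 - x).
  by rewrite dd scalerBr /x scalerRR divff ?gt_eqF //; lmod R[i].
pose w := (l + e)^-1%:C *: z.
have dw : d * d * w = 1.
  by rewrite ddx /w cscalerAl cscalerAr xz scalerRR divff ?gt_eqF // scale1r.
have wd : w * (d * d) = 1.
  by rewrite ddx /w cscalerAl cscalerAr zx scalerRR mulVf ?gt_eqF // scale1r.
have dw_wd : d * w = w * d.
  by rewrite -[LHS]mul1r -wd -[RHS]mulr1 -dw !mulrA.
exists d, (d * w); split=> //; last by rewrite dw_wd -mulrA.
  by apply: (star_inv ds); rewrite ?mulrA ?dw // dw_wd -mulrA.
by rewrite mulrA.
Qed.

End OrderConsequences.

(** * The Hilbert module [B^n] *)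

Section HilbertModule.
Variables (R : realType) (B : cstarAlgType R) (n : nat).
Implicit Types (x : 'M[B]_n) (z w : 'cV[B]_n) (r e t m : R).
Local Notation "r %:I" := (r%:C *: (1 : B))
  (at level 1, left associativity, format "r %:I").

Definition ip z w : B := \sum_i star (z i 0) * w i 0.

Lemma hmod_norm_ge0 z : 0 <= hmod_norm z.
Proof. exact: sqrtr_ge0. Qed.

Lemma sqr_hmod_norm z : hmod_norm z ^+ 2 = rnorm (ip z z).
Proof. by rewrite sqr_sqrtr ?rnorm_ge0. Qed.

Lemma pos_ip z : pos (ip z z).
Proof. by apply: pos_sum => i _; exact: pos_star_mul. Qed.

Lemma star_ip z w : star (ip z w) = ip w z.
Proof. by rewrite star_sum; apply: eq_bigr => i _; rewrite starM starK. Qed.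

Lemma le_hmod_norm z r : 0 <= r -> pos ((r ^+ 2)%:I - ip z z) -> hmod_norm z <=
  r.
Proof.
move=> r0 pr; rewrite -(@ler_pXn2r _ 2) ?nnegrE ?hmod_norm_ge0 // sqr_hmod_norm.
by apply: pos_norm_le_scal pr; rewrite ?sqr_ge0 //; exact: pos_ip.
Qed.

(** The right [B]-module structure of [B^n]. It commutes with the left action of matrices, so a
    vector can be normalised by an element of [B]. *)
Definition colmul z (b : B) : 'cV[B]_n := \col_i (z i 0 * b).

Lemma ip_colmul z w b c : ip (colmul z b) (colmul w c) = star b * ip z w * c.
Proof.
rewrite /ip mulr_sumr mulr_suml; apply: eq_bigr => i _.
by rewrite !mxE starM !mulrA.
Qed.

Lemma mulmx_colmul x z b : x *m colmul z b = colmul (x *m z) b.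
Proof.
apply/matrixP => i j; rewrite !mxE mulr_suml.
by apply: eq_bigr => k _; rewrite !mxE mulrA.
Qed.

Lemma hmod_norm_colmul z r : hmod_norm (colmul z r%:I) = `|r| * hmod_norm z.
Proof.
rewrite /hmod_norm -/(ip _ _) ip_colmul star_scal.
rewrite cscalerAl cscalerAr mulr1 mul1r scalerRR rnormZr.
by rewrite sqrtrM ?normr_ge0 // -expr2 ger0_norm ?sqr_ge0 // sqrtr_sqr.
Qed.

Lemma rnorm_entry_le z i : rnorm (z i 0) <= hmod_norm z.
Proof.
rewrite -(@ler_pXn2r _ 2) ?nnegrE ?hmod_norm_ge0 ?rnorm_ge0 // sqr_hmod_norm.
rewrite -rnorm_starM; apply: pos_norm_le; first exact: pos_star_mul.
rewrite /ip (bigD1 i) //= addrAC subrr add0r.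
by apply: pos_sum => j _; exact: pos_star_mul.
Qed.

(** A crude bound, but some finite bound must be known before the supremum in [cstar_mx_norm] says
    anything. *)
Lemma mx_bounded x :
  exists2 M, 0 <= M & forall z, hmod_norm (x *m z) <= M * hmod_norm z.
Proof.
pose C := \sum_i \sum_j rnorm (x i j).
have C0 : 0 <= C by apply: sumr_ge0 => i _; apply: sumr_ge0 => j _;
  exact: rnorm_ge0.
exists (n%:R * C) => [|z]; first by rewrite mulr_ge0.
have entry i : rnorm ((x *m z) i 0) <= C * hmod_norm z.
  rewrite mxE; apply: le_trans (rnorm_sum _ _ _) _.
  apply: le_trans (_ : \sum_j rnorm (x i j) * hmod_norm z <= _).
    apply: ler_sum => j _; apply: le_trans (ler_rnormM _ _) _.
    by rewrite ler_wpM2l ?rnorm_ge0 // rnorm_entry_le.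
  rewrite -mulr_suml ler_wpM2r ?hmod_norm_ge0 // /C [leRHS](bigD1 i) //= lerDl.
  by apply: sumr_ge0 => k _; apply: sumr_ge0 => j _; exact: rnorm_ge0.
have K0 : 0 <= C * hmod_norm z by rewrite mulr_ge0 ?hmod_norm_ge0.
rewrite -(@ler_pXn2r _ 2) ?nnegrE ?mulr_ge0 ?hmod_norm_ge0 // sqr_hmod_norm.
apply: le_trans (rnorm_sum _ _ _) _.
apply: le_trans (_ : \sum_(i < n) (C * hmod_norm z) ^+ 2 <= _).
  apply: ler_sum => i _; rewrite rnorm_starM.
  by rewrite ler_pXn2r ?nnegrE ?rnorm_ge0.
rewrite sumr_const card_ord -mulrA [leRHS]exprMn -[leLHS]mulr_natl ler_wpM2r
  ?sqr_ge0 //.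
by case: (n) => [|k]; rewrite ?expr0n // -natrX ler_nat leq_pmulr.
Qed.

(* Paschke: a bound on norms upgrades to a bound in the order of [B], by
   normalising [z] with [(ip z z + e)^(-1/2)]. *)
Lemma ip_mulmx_le x m : 0 <= m ->
  (forall z, hmod_norm (x *m z) <= m * hmod_norm z) ->
  forall z, pos ((m ^+ 2)%:C *: ip z z - ip (x *m z) (x *m z)).
Proof.
move=> m0 xm z; apply: (@pos_lim _ _ _ (m ^+ 2)).
  by apply: star_sub; rewrite ?starZr star_ip.
move=> e e0; have [d [d' [ds d's dd dd' d'd]]] := invertible_sqrt (pos_ip z) e0.
set c := ip z z in dd *; set k := ip _ _.
have le1 : hmod_norm (colmul z d') <= 1.
  apply: le_hmod_norm => //; rewrite ip_colmul -/c d's expr1n.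
  have -> : 1%:I - d' * c * d' = e%:C *: (star d' * d').
    have -> : c = d * d - e%:I by rewrite dd; lmod R[i].
    rewrite mulrBr mulrBl mulrA d'd mul1r dd' !(cscalerAl, cscalerAr) mulr1 d's.
    by lmod R[i].
  by apply: posZ; rewrite ?(ltW e0) //; exact: pos_star_mul.
have le2 : rnorm (d' * k * d') <= m ^+ 2.
  have -> : d' * k * d' = ip (x *m colmul z d') (x *m colmul z d').
    by rewrite mulmx_colmul ip_colmul d's.
  rewrite -sqr_hmod_norm ler_pXn2r ?nnegrE ?hmod_norm_ge0 //.
  by apply: le_trans (xm _) _; rewrite ler_piMr.
exists ((m ^+ 2)%:C *: (d * d) - k).
  have -> : (m ^+ 2)%:C *: (d * d) - k = star d * ((m ^+ 2)%:I - d' * k * d') *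
    d.
    rewrite ds mulrBr mulrBl !(cscalerAr, cscalerAl) mulr1 !mulrA dd' mul1r.
    by rewrite -mulrA d'd mulr1.
  apply/pos_conj/pos_scal_sub => //.
  by rewrite !starM star_ip d's mulrA.
have -> : (m ^+ 2)%:C *: c - k - ((m ^+ 2)%:C *: (d * d) - k) = - (m ^+ 2 *
  e)%:I.
  by rewrite dd; lmod R[i].
rewrite rnormN; apply: le_trans (rnorm_scal_le _ _) _.
by rewrite ger0_norm // mulr_ge0 ?sqr_ge0 // ltW.
Qed.

Definition one_sub (t : R) x : 'M[B]_n := \matrix_(i, j) ((i == j)%:R - t%:C *:
  x i j).

Lemma mulmx_one_sub t x z i : (one_sub t x *m z) i 0 = z i 0 - t%:C *: (x *m z)
  i 0.
Proof.
rewrite !mxE; under eq_bigr => j _ do rewrite mxE mulrBl cscalerAl.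
rewrite sumrB (bigD1 i) //= eqxx mul1r big1 ?addr0 ?scaler_sumr // => j.
by rewrite eq_sym => /negPf->; rewrite mul0r.
Qed.

Lemma ip_one_sub t x z : ip (one_sub t x *m z) (one_sub t x *m z) =
  ip z z - t%:C *: (ip z (x *m z) + star (ip z (x *m z))) +
  (t ^+ 2)%:C *: ip (x *m z) (x *m z).
Proof.
rewrite star_ip /ip -big_split /= !scaler_sumr -sumrB -big_split /=.
apply: eq_bigr => i _.
rewrite mulmx_one_sub starD starN starZr !(mulrDr, mulrDl, mulrN, mulNr).
by rewrite !(cscalerAl, cscalerAr); lmod R[i].
Qed.

Definition accretive x := forall z, pos (ip z (x *m z) + star (ip z (x *m z))).

Lemma accretive_one_sub x M t : accretive x -> 0 <= M -> 0 <= t ->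
  (forall z, hmod_norm (x *m z) <= M * hmod_norm z) ->
  forall z, hmod_norm (one_sub t x *m z) <= Num.sqrt (1 + t ^+ 2 * M ^+ 2) *
    hmod_norm z.
Proof.
move=> ax M0 t0 xM z.
have s0 : 0 <= 1 + t ^+ 2 * M ^+ 2 by rewrite addr_ge0 // mulr_ge0 // sqr_ge0.
rewrite -(@ler_pXn2r _ 2) ?nnegrE ?mulr_ge0 ?hmod_norm_ge0 ?sqrtr_ge0 //.
rewrite exprMn !sqr_hmod_norm sqr_sqrtr //.
set b := ip z z + (t ^+ 2)%:C *: ip (x *m z) (x *m z).
apply: le_trans (_ : rnorm b <= _).
  apply: pos_norm_le; first exact: pos_ip.
  rewrite ip_one_sub /b.
  rewrite (_ : _ - _ = t%:C *: (ip z (x *m z) + star (ip z (x *m z)))).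
    by apply: posZ => //; exact: ax.
  by lmod R[i].
apply: le_trans (ler_rnormD _ _) _; rewrite mulrDl mul1r lerD2l rnormZr.
rewrite ger0_norm ?sqr_ge0 // -[leRHS]mulrA ler_wpM2l ?sqr_ge0 //
  -!sqr_hmod_norm.
by rewrite -exprMn ler_pXn2r ?nnegrE ?mulr_ge0 ?hmod_norm_ge0.
Qed.

(** By [ip_mulmx_le] the norm bound becomes an inequality in [B], which gives
    [t a + t^2 M^2 <z, z> >= 0], where [a] is twice the real part of [<z, x z>]. Divide by [t] and
    let [t] tend to 0 in the closed cone. *)
Lemma one_sub_accretive x M : 0 <= M ->
  (forall t z, 0 < t ->
     hmod_norm (one_sub t x *m z) <= Num.sqrt (1 + t ^+ 2 * M ^+ 2) * hmod_norm
       z) ->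
  accretive x.
Proof.
move=> M0 xM z; set a := _ + _.
have sa : star a = a by rewrite /a starD starK addrC.
apply: (@pos_lim _ _ _ (M ^+ 2 * rnorm (ip z z))) => // t t0.
have s0 : 0 <= 1 + t ^+ 2 * M ^+ 2 by rewrite addr_ge0 // mulr_ge0 // sqr_ge0.
have := @ip_mulmx_le (one_sub t x) _ (sqrtr_ge0 _) (fun z => xM t z t0) z.
rewrite sqr_sqrtr // ip_one_sub -/a => p1.
exists (a + (t * M ^+ 2)%:C *: ip z z).
  have p2 : pos ((t ^+ 2)%:C *: ip (x *m z) (x *m z)).
    by apply: posZ; rewrite ?sqr_ge0 //; exact: pos_ip.
  have := posD p1 p2; set b := _ + _ => pb.
  have -> : a + (t * M ^+ 2)%:C *: ip z z = (t^-1)%:C *: b.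
    have -> : b = t%:C *: (a + (t * M ^+ 2)%:C *: ip z z).
      by rewrite /b; lmod R[i].
    by rewrite scalerRR mulVf ?gt_eqF // scale1r.
  by apply: posZ => //; rewrite invr_ge0 ltW.
rewrite opprD addrA subrr sub0r rnormN rnormZr ger0_norm.
  by rewrite -[leLHS]mulrA [leLHS]mulrC.
by rewrite mulr_ge0 ?(ltW t0) // sqr_ge0.
Qed.

End HilbertModule.

(** * The M. Riesz extension theorem and states *)

Section RieszExtension.
Variables (R : realType) (V : lmodType R[i]) (K : set V).
Implicit Types (G : set (V * R)) (x y : V) (p q : V * R) (r c : R).

(** Partial functionals are kept as graphs, ordered by inclusion for Zorn's lemma; they are linear
    over the reals only. *)
Definition linear_graph G := G (0, 0) /\
  forall c p q, G p -> G q -> G (c%:C *: p.1 + q.1, c * p.2 + q.2).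

Definition positive_graph G := linear_graph G /\ forall p, G p -> K p.1 -> 0 <=
  p.2.

Hypotheses (KD : forall x y, K x -> K y -> K (x + y))
  (KZ : forall r x, 0 <= r -> K x -> K (r%:C *: x)) (K0 : K 0).

(** Two values at [x] put [(0, r - r')] and [(0, r' - r)] in the graph, and positivity at 0 makes
    both second components nonnegative. *)
Lemma positive_graph_fun G x r r' :
  positive_graph G -> G (x, r) -> G (x, r') -> r = r'.
Proof.
move=> [[_ linG] posG] Gr Gr'; apply/eqP; rewrite eq_le.
have sub s s' : G (x, s) -> G (x, s') -> s' <= s.
  move=> Gs Gs'; have := linG (-1) _ _ Gs' Gs => /= G0.
  have /= := posG _ G0; rewrite (_ : _ + x = 0); last by lmod R[i].
  by move/(_ K0); lra.
by rewrite !sub.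
Qed.

(** The new value is the supremum of the values at the minorants of [x]; [q] makes this set nonempty
    and [p] bounds it. If [w + c x] lies in [K], then [- w / c] is a minorant of [x] when [c > 0]
    and a majorant when [c < 0], which settles the sign. *)
Lemma positive_graph_adjoin G x p q :
  positive_graph G -> G p -> G q -> K (p.1 - x) -> K (x - q.1) ->
  exists G', [/\ positive_graph G', G `<=` G' & exists r, G' (x, r)].
Proof.
move=> [[G0 linG] posG] Gp Gq Kp Kq.
pose S := [set s | exists2 w, G (w, s) & K (x - w)].
have Sub s s' w w' : G (w, s) -> G (w', s') -> K (x - w) -> K (w' - x) -> s <=
  s'.
  move=> Gs Gs' Kw Kw'; have /= := posG _ (linG (-1) _ _ Gs Gs').
  rewrite (_ : _ + w' = (x - w) + (w' - x)); last by lmod R[i].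
  by move/(_ (KD Kw Kw')); lra.
have supS : has_sup S.
  split; first by exists q.2, q.1; case: q Gq Kq.
  exists p.2 => s [w Gs Kw]; apply: (Sub s p.2 w p.1) => //.
  by case: p Gp Kp.
pose alpha := sup S.
pose G' := [set u | exists w s c, G (w, s) /\ u = (w + c%:C *: x, s + c *
  alpha)].
exists G'; split; first split; first split.
- by exists 0, 0, 0; rewrite scale0r mul0r !addr0.
- move=> c _ _ [w [s [d [Gs ->]]]] [w' [s' [d' [Gs' ->]]]] /=.
  exists (c%:C *: w + w'), (c * s + s'), (c * d + d').
  split; first exact: (linG c _ _ Gs Gs').
  by congr pair; [lmod R[i]|ring].
- move=> _ [w [s [c [Gs ->]]]] /= Kwc.
  have Gsc d : G (d%:C *: w, d * s).
    by have := linG d _ _ Gs G0; rewrite /= !addr0.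
  have [c_lt0|c_gt0|c0] := ltrgt0P c; last first.
  + by rewrite c0 scale0r addr0 in Kwc *; rewrite mul0r addr0;
      exact: posG Gs Kwc.
  + have dc : - c != 0 by rewrite oppr_eq0 lt_eqF.
    have : alpha <= (- c)^-1 * s.
      apply: ge_sup; first by case: supS.
      move=> s' [w' Gs' Kw']; apply: (Sub _ _ _ _ Gs' (Gsc (- c)^-1) Kw').
      rewrite (_ : _ - x = (- c)^-1%:C *: (w + c%:C *: x)).
        by apply: KZ => //; rewrite invr_ge0 oppr_ge0 ltW.
      rewrite scalerDr scalerRR invrN mulNr mulVf ?lt_eqF //.
      by lmod R[i].
    rewrite mulrC ler_pdivlMr ?oppr_gt0 //; lra.
  + have : - c^-1 * s <= alpha.
      apply: sup_upper_bound => //; exists ((- c^-1)%:C *: w); first exact: Gsc.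
      rewrite (_ : x - _ = c^-1%:C *: (w + c%:C *: x)).
        by apply: KZ => //; rewrite invr_ge0 ltW.
      by rewrite scalerDr scalerRR mulVf ?gt_eqF //; lmod R[i].
    rewrite mulNr lerNl mulrC ler_pdivlMr // => H; lra.
- by move=> [w s] Gs; exists w, s, 0; rewrite scale0r mul0r !addr0.
- by exists alpha, 0, 0, 1; rewrite scale1r mul1r !add0r.
Qed.

Lemma positive_graph_maximal G : positive_graph G ->
  exists G', [/\ positive_graph G', G `<=` G' &
    forall G'', positive_graph G'' -> G' `<=` G'' -> G'' `<=` G'].
Proof.
move=> posG; have [|X [posX maxX]] :=
    @Zorn_bigcup _ (fun X => positive_graph (X `|` G)).
  move=> F FP tot; case: posG => [[G0 linG] nonnegG]; split; first split.
  - by right.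
  - move=> c p q [[X FX Xp]|Gp] [[Y FY Yq]|Gq].
    + have [XY|YX] := tot _ _ FX FY.
        have [[_ linY] _] := FP _ FY.
        have [|] := linY c p q (or_introl (XY _ Xp)) (or_introl Yq);
          last by right.
        by left; exists Y.
      have [[_ linX] _] := FP _ FX.
      have [|] := linX c p q (or_introl Xp) (or_introl (YX _ Yq));
        last by right.
      by left; exists X.
    + have [[_ linX] _] := FP _ FX.
      have [|] := linX c p q (or_introl Xp) (or_intror Gq); last by right.
      by left; exists X.
    + have [[_ linY] _] := FP _ FY.
      have [|] := linY c p q (or_intror Gp) (or_introl Yq); last by right.
      by left; exists Y.
    + by right; exact: linG.
  - move=> p [[X FX Xp]|]; last exact: nonnegG.
    by have [_ nn] := FP _ FX; exact: (nn _ (or_introl Xp)).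
exists (X `|` G); split=> //.
move=> G'' posG'' sub.
have GG'' : G `<=` G'' by move=> p Gp; apply: sub; right.
have : ~ X `<` G''.
  by move=> /maxX; rewrite (setUidl GG'').
move=> nXG p G''p; apply: contrapT => nXp; apply: nXG; split.
  by move=> q Xq; apply: sub; left.
by move=> /(_ _ G''p) Xp; apply: nXp; left.
Qed.

Definition dominated G x :=
  (exists2 p, G p & K (p.1 - x)) /\ (exists2 q, G q & K (x - q.1)).

Theorem riesz_extension G : positive_graph G -> exists f : V -> R,
  [/\ forall p, G p -> f p.1 = p.2,
      forall c x y, dominated G x -> dominated G y ->
        f (c%:C *: x + y) = c * f x + f y &
      forall x, dominated G x -> K x -> 0 <= f x].
Proof.
move=> posG; have [G' [posG' GG' maxG']] := positive_graph_maximal posG.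
have domG' x : dominated G x -> exists r, G' (x, r).
  move=> [[p Gp Kp] [q Gq Kq]].
  have [G'' [posG'' G'G'' [r G''r]]] :=
    positive_graph_adjoin posG' (GG' _ Gp) (GG' _ Gq) Kp Kq.
  by exists r; exact: maxG' G''r.
(* Off the domain of the maximal graph [f] takes the default value 0, so linearity is claimed on
   dominated vectors only. *)
pose f x := xget 0 [set r | G' (x, r)].
have fP x r : G' (x, r) -> f x = r.
  by move=> G'r; apply: (positive_graph_fun posG') (G'r);
    exact: (xgetPex 0 (ex_intro [set r | G' (x, r)] r G'r)).
exists f; split=> [[x r] /GG'/fP //|c x y /domG'[r G'r] /domG'[s G's]|x
  /domG'[r G'r] Kx].
- rewrite (fP _ _ G'r) (fP _ _ G's); apply: fP.
  by have [[_ linG'] _] := posG'; exact: (linG' c _ _ G'r G's).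
- by rewrite (fP _ _ G'r); have [_ nn] := posG'; exact: (nn _ G'r).
Qed.

End RieszExtension.

Section States.
Variables (R : realType) (B : cstarAlgType R).
Implicit Types (x y a b c h : B) (r e : R).
Local Notation "r %:I" := (r%:C *: (1 : B))
  (at level 1, left associativity, format "r %:I").

Definition real_state (g : B -> R) :=
  [/\ forall r a b, g (r%:C *: a + b) = r * g a + g b,
      forall a, g (star a) = g a & forall a, pos a -> 0 <= g a].

Lemma star_cart_sa a : star (a + star a) = a + star a.
Proof. by rewrite starD starK addrC. Qed.

(** If [b] is not positive, then [c = |b| - b] is positive of norm [m > l = |b|]. The functional
    [t + s c |-> t + s m] on the span of 1 and [c] is positive, and any positive extension takes the
    value [l - m < 0] at [b]. *)
Lemma separating_state b : star b = b ->
  (forall g, real_state g -> 0 <= g b) -> pos b.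
Proof.
move=> sb nonneg; pose l := rnorm b; pose c := l%:I - b; pose m := rnorm c.
have l0 : 0 <= l by exact: rnorm_ge0.
have m0 : 0 <= m by exact: rnorm_ge0.
have pc : pos c by exact: pos_scal_sub.
have sc : star c = c by exact: pos_sa.
suff : m <= l by move=> ml; split=> //; exists l.
rewrite leNgt; apply/negP => lm.
(* In the zero algebra the norm of 1 is 0; [l < m] rules this out. *)
have n1 : rnorm (1 : B) = 1.
  have := rnorm_starM (1 : B); rewrite star1 mulr1 => n11.
  have : rnorm (1 : B) != 0.
    apply: contraL (le_lt_trans l0 lm) => /eqP n0; rewrite -leNgt /m -[c]mul1r.
    by apply: le_trans (ler_rnormM _ _) _; rewrite n0 mul0r.
  by move=> /mulfI; apply; rewrite mulr1 -expr2.
pose K := [set a : B | pos (a + star a)].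
have KD x y : K x -> K y -> K (x + y).
  by rewrite /K /= => Kx Ky; rewrite starD addrACA; exact: posD.
have KZ r x : 0 <= r -> K x -> K (r%:C *: x).
  by rewrite /K /= => r0 Kx; rewrite starZr -scalerDr; exact: posZ.
have K0 : K 0 by rewrite /K /= star0 addr0; exact: pos0.
have K2 x : star x = x -> K x -> pos x.
  rewrite /K /= => -> px; have -> : x = (2^-1 : R)%:C *: (x + x) by lmod R[i].
  by apply: posZ => //; rewrite invr_ge0.
pose G : set (B * R) := [set u | exists t s, u = (t%:I + s%:C *: c, t + s * m)].
have posG : positive_graph K G.
  split; first split.
  - by exists 0, 0; rewrite !scale0r mul0r !addr0.
  - move=> d _ _ [t [s ->]] [t' [s' ->]] /=.
    exists (d * t + t'), (d * s + s'); congr pair; [lmod R[i]|ring].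
  - move=> _ [t [s ->]] /= /K2; rewrite star_add ?star_scal ?starZr ?sc //.
    move/(_ erefl) => pts; rewrite leNgt; apply/negP => lt0.
    (* For [s >= 0], a negative [t + s m] makes [- (t + s c)] positive too, so [t + s c = 0] and
       [|t| = s m], a contradiction. For [s < 0], positivity says [c <= t / (- s)], whence
       [m <= t / (- s)]. *)
    have [s0|s0] := leP 0 s.
      have nts : pos (- (t%:I + s%:C *: c)).
        have -> : - (t%:I + s%:C *: c) = (- t)%:I - s%:C *: c by lmod R[i].
        apply: pos_scal_sub; first by rewrite starZr sc.
        rewrite rnormZr ger0_norm // -/m; lra.
      have := pos_anti pts nts; move/eqP; rewrite addrC addr_eq0 => /eqP scE.
      have := rnormZr s c; rewrite scE rnormN rnormZr n1 mulr1 (ger0_norm s0)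
        -/m.
      have t0 : t < 0 by have := mulr_ge0 s0 m0; move: lt0 => /=; lra.
      by move: lt0 => /=; rewrite (ltr0_norm t0); lra.
    have u0 : 0 < - s by rewrite oppr_gt0.
    have pt : pos (t%:I : B).
      have -> : t%:I = (t%:I + s%:C *: c) + (- s)%:C *: c by lmod R[i].
      by apply: posD => //; apply: posZ => //; exact: ltW.
    have t0 : 0 <= t.
      rewrite leNgt; apply/negP => t0.
      have ptN : pos (- t%:I : B).
        rewrite -scaleNr -rmorphN; apply: pos_scal; rewrite oppr_ge0;
          exact: ltW.
      have := rnormZr t (1 : B); rewrite (pos_anti pt ptN) rnorm0 n1 mulr1.
      by rewrite ltr0_norm //; lra.
    have : m <= t / (- s).
      apply: pos_norm_le_scal => //; first by rewrite divr_ge0 // ltW.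
      have -> : (t / (- s))%:I - c = (- s)^-1%:C *: (t%:I + s%:C *: c).
        have sV : (- s)^-1 * s = -1 by rewrite invrN mulNr mulVf ?lt_eqF.
        by rewrite scalerDr !scalerRR sV (mulrC t); lmod R[i].
      by apply: posZ => //; rewrite invr_ge0 ltW.
    rewrite ler_pdivlMr //; lra.
have dom x : dominated K G x.
  have r0 := rnorm_ge0 (x + star x).
  split.
    exists ((rnorm (x + star x))%:I, rnorm (x + star x)).
      by exists (rnorm (x + star x)), 0; rewrite scale0r mul0r !addr0.
    rewrite /K /= starD starN star_scal.
    have -> : (rnorm (x + star x))%:I - x + ((rnorm (x + star x))%:I - star x) =
        (2 * rnorm (x + star x))%:I - (x + star x) by lmod R[i].
    by apply: pos_scal_sub; [exact: star_cart_sa|lra].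
  exists (- (rnorm (x + star x))%:I, - rnorm (x + star x)).
    exists (- rnorm (x + star x)), 0; rewrite scale0r mul0r !addr0.
    by congr pair; lmod R[i].
  rewrite /K /= opprK starD star_scal.
  have -> : x + (rnorm (x + star x))%:I + (star x + (rnorm (x + star x))%:I) =
      (2 * rnorm (x + star x))%:I - - (x + star x) by lmod R[i].
  apply: pos_scal_sub; first by rewrite starN star_cart_sa.
  by rewrite rnormN; lra.
have [f [fG flin fpos]] := riesz_extension KD KZ K0 posG.
have fD x y r : f (r%:C *: x + y) = r * f x + f y by exact: flin.
have fK x : K x -> 0 <= f x by exact: fpos.
have sf : real_state f.
  split=> [r a a'|a|a pa]; first exact: fD.
    have K1 : K (star a - a).
      by rewrite /K /= starD starN starK addrC addrA subrK subrr; exact: pos0.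
    have K2' : K (a - star a).
      by rewrite /K /= starD starN starK addrC addrA subrK subrr; exact: pos0.
    have := fK _ K1; have := fK _ K2'.
    have -> : star a - a = (- 1)%:C *: a + star a by lmod R[i].
    have -> : a - star a = (- 1)%:C *: star a + a by lmod R[i].
    by rewrite !fD; lra.
  by apply: fK; rewrite /K /= (pos_sa pa); exact: posD.
have := nonneg _ sf.
have -> : b = (-1)%:C *: (0%:I + 1%:C *: c) + (l%:I + 0%:C *: c).
  by rewrite /c; lmod R[i].
rewrite fD; have /= -> := fG (0%:I + 1%:C *: c, 0 + 1 * m); last by exists 0, 1.
have /= -> := fG (l%:I + 0%:C *: c, l + 0 * m); last by exists l, 0.
lra.
Qed.

End States.

(** * Uniqueness of completely positive extensions *)

Section Forms.
Variables (R : realType) (B : cstarAlgType R) (K : lmodType R[i]).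
Implicit Types (x y a b c h : B) (r e t : R) (v w : K) (q : K -> K -> R)
  (theta : B -> K -> K -> R) (sigma : B -> K -> K) (A : set B).
Local Notation "r %:I" := (r%:C *: (1 : B))
  (at level 1, left associativity, format "r %:I").

(* [theta b v w] stands for Re <Phi(b) v, w>, with [Phi] completely positive.
   Working with real parts loses nothing, as Im <Phi(b) v, w> is the real part
   of <Phi(- i b) v, w>. *)
Record cp_form theta : Prop := CpForm {
  cp_lin : forall r a b v w, theta (r%:C *: a + b) v w = r * theta a v w +
    theta b v w ;
  cp_sym : forall b v w, theta (star b) v w = theta b w v ;
  cp_addl : forall b v v' w, theta b (v + v') w = theta b v w + theta b v' w ;
  cp_scalel : forall b (k : R[i]) v w, theta b (k *: v) w = theta (k *: b) v w ;
  cp_pos : forall s : seq (B * K),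
    0 <= \sum_(u <- s) \sum_(u' <- s) theta (star u.1 * u'.1) u'.2 u.2 }.

(* The real part of a positive semidefinite inner product. *)
Record semi_inner q : Prop := SemiInner {
  si_lin : forall r v v' w, q (r%:C *: v + v') w = r * q v w + q v' w ;
  si_sym : forall v w, q v w = q w v ;
  si_scale : forall (k : R[i]) v w, q (k *: v) w = q v (k^* *: w) ;
  si_ge0 : forall v, 0 <= q v v }.

Record rep A sigma : Prop := Rep {
  rep_alg : unital_subalgebra A ;
  rep1 : forall v, sigma 1 v = v ;
  rep_lin : forall (k : R[i]) a b v, A a -> A b ->
    sigma (k *: a + b) v = k *: sigma a v + sigma b v ;
  rep_mul : forall a b v, A a -> A b -> sigma (a * b) v = sigma a (sigma b v) ;
  rep_linr : forall (k : R[i]) a v w, A a ->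
    sigma a (k *: v + w) = k *: sigma a v + sigma a w }.

Section FormTheory.
Variables (theta : B -> K -> K -> R) (cp : cp_form theta).

Lemma cpD a b v w : theta (a + b) v w = theta a v w + theta b v w.
Proof. by have := cp_lin cp 1 a b v w; rewrite rmorph1 scale1r mul1r. Qed.

Lemma cp0 v w : theta 0 v w = 0.
Proof. by apply: (addrI (theta 0 v w)); rewrite -cpD !addr0. Qed.

Lemma cpZ r a v w : theta (r%:C *: a) v w = r * theta a v w.
Proof. by rewrite -[_ *: a]addr0 (cp_lin cp) cp0 addr0. Qed.

Lemma cpN a v w : theta (- a) v w = - theta a v w.
Proof. by apply: (addrI (theta a v w)); rewrite -cpD !subrr cp0. Qed.

Lemma cp_sum (I : Type) (s : seq I) (P : pred I) (F : I -> B) v w :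
  theta (\sum_(i <- s | P i) F i) v w = \sum_(i <- s | P i) theta (F i) v w.
Proof.
by apply: (big_morph (fun b => theta b v w)) => [a b|]; [exact: cpD|exact: cp0].
Qed.

Lemma cp_star_mul_ge0 y v : 0 <= theta (star y * y) v v.
Proof. by have := cp_pos cp [:: (y, v)]; rewrite !big_seq1. Qed.

Lemma cp_addr b v w w' : theta b v (w + w') = theta b v w + theta b v w'.
Proof. by rewrite -(cp_sym cp b) (cp_addl cp) !(cp_sym cp). Qed.

Lemma cp_scaler b (k : R[i]) v w : theta b v (k *: w) = theta (k^* *: b) v w.
Proof.
by rewrite -(cp_sym cp b) (cp_scalel cp) -(cp_sym cp (_ *: b)) starZ conjCK.
Qed.

Lemma cp_bound b v : `|theta b v v| <= rnorm b * theta 1 v v.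
Proof.
have le_sa h : star h = h -> theta h v v <= rnorm h * theta 1 v v.
  move=> hs; apply/ler_addgt0Pr => e e0.
  have p0 : 0 <= theta 1 v v.
    by have := cp_star_mul_ge0 1 v; rewrite star1 mulr1.
  pose d := e / (theta 1 v v + 1).
  have d0 : 0 < d by rewrite divr_gt0 // ltr_wpDl.
  have [|y [_ yE]] := @scal_sub_sqr _ _ h (rnorm h + d) hs;
    first by rewrite ltrDl.
  have := cp_star_mul_ge0 y v; rewrite -yE cpD cpN cpZ.
  have : d * theta 1 v v <= e.
    rewrite /d mulrAC ler_pdivrMr ?ltr_wpDl // ler_wpM2l ?(ltW e0) //.
    by rewrite lerDl.
  by rewrite mulrDl; lra.
have bE : theta b v v = theta ((2^-1 : R)%:C *: (b + star b)) v v.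
  by rewrite cpZ cpD (cp_sym cp); field.
have hs : star ((2^-1 : R)%:C *: (b + star b)) = (2^-1 : R)%:C *: (b + star b).
  by rewrite starZr star_cart_sa.
have p1 : 0 <= theta 1 v v.
  by have := cp_star_mul_ge0 1 v; rewrite star1 mulr1.
have hb : rnorm ((2^-1 : R)%:C *: (b + star b)) <= rnorm b.
  rewrite rnormZr ger0_norm ?invr_ge0 //.
  by have := ler_rnormD b (star b); rewrite rnorm_star; lra.
rewrite bE; set h := _ *: _ in hs hb *; rewrite ler_norml.
have le1 := le_sa h hs; have := le_sa (- h); rewrite starN hs => /(_ erefl).
rewrite cpN rnormN.
have := ler_wpM2r p1 hb; lra.
Qed.

End FormTheory.

(** The diagonal determines the sum of the values at [(v, w)] and [(w, v)]. Replacing [b] by ['i b]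
    and [w] by ['i w] keeps the first value and changes the sign of the second, which separates
    them. *)
Lemma cp_form_polar theta1 theta2 : cp_form theta1 -> cp_form theta2 ->
  (forall b v, theta1 b v v = theta2 b v v) ->
  forall b v w, theta1 b v w = theta2 b v w.
Proof.
move=> cp1 cp2 diag b v w.
have anti c u u' : theta1 c u u' + theta1 c u' u = theta2 c u u' + theta2 c u'
  u.
  have := diag c (u + u').
  rewrite !(cp_addl cp1, cp_addl cp2, cp_addr cp1, cp_addr cp2) !diag; lra.
have := anti ('i%C *: b) v ('i%C *: w).
rewrite !(cp_scalel cp1, cp_scalel cp2, cp_scaler cp1, cp_scaler cp2).
have ic : ('i%C : R[i])^* = - 'i%C by rewrite complexiE conjCi.
have ii : 'i%C * 'i%C = -1 :> R[i] by rewrite -expr2 sqr_i.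
rewrite !scalerA ic mulNr ii opprK scale1r scaleN1r !(cpN cp1, cpN cp2).
by have := anti b v w; lra.
Qed.

Lemma quadratic_eq0 (D C d : R) : 0 < d ->
  (forall t, `|t| <= d -> 0 <= t * D + t ^+ 2 * C) -> D = 0.
Proof.
move=> d0 H; have D0 s : `|s| = 1 -> 0 <= s * D.
  move=> s1; apply/ler_addgt0Pr => e e0.
  have C0 : 0 < `|C| + 1 by rewrite ltr_wpDl.
  pose t := Num.min d (e / (`|C| + 1)).
  have t0 : 0 < t by rewrite lt_min d0 divr_gt0.
  have td : t <= d by rewrite ge_min lexx.
  have tC : t * C <= e.
    apply: le_trans (_ : t * (`|C| + 1) <= e).
      by rewrite ler_wpM2l ?(ltW t0) // (le_trans (ler_norm C)) // lerDl.
    by rewrite -ler_pdivlMr // ge_min lexx orbT.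
  have := H (s * t); rewrite normrM s1 mul1r gtr0_norm // => /(_ td).
  have ss : s ^+ 2 = 1 by rewrite -real_normK ?num_real // s1 expr1n.
  rewrite exprMn ss mul1r.
  have -> : s * t * D + t ^+ 2 * C = t * (s * D + t * C) by ring.
  by rewrite pmulr_rge0 //; lra.
have := D0 1 (normr1 _); have := D0 (-1); rewrite normrN1 => /(_ erefl); lra.
Qed.

Section Uniqueness.
Variables (A : set B) (sigma : B -> K -> K) (q : K -> K -> R).
Hypotheses (si : semi_inner q) (rA : rep A sigma).

Definition represents theta := forall a v w, A a -> theta a v w = q (sigma a v)
  w.

Lemma represents1 theta : represents theta -> forall v w, theta 1 v w = q v w.
Proof.
by move=> th v w; rewrite th ?(rep1 rA) //; have [] := rep_alg rA.
Qed.

(** In the Stinespring picture this is nonnegativity of the squared norm of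
    [a (x) v - 1 (x) sigma a v]. *)
Lemma kadison_schwarz theta a v : cp_form theta -> represents theta -> A a ->
  q (sigma a v) (sigma a v) <= theta (star a * a) v v.
Proof.
move=> cp th Aa; have := cp_pos cp [:: (a, v); (- 1, sigma a v)].
rewrite !big_cons !big_nil /= starN star1 !(mulrN, mulNr, mulr1, mul1r) opprK.
rewrite !(cpN cp) (cp_sym cp) (represents1 th) (th a) //; lra.
Qed.

Lemma logrigged_le theta1 theta2 b b' v : logrigged A ->
  cp_form theta1 -> cp_form theta2 -> represents theta1 -> represents theta2 ->
  positive b -> b * b' = 1 -> b' * b = 1 ->
  2 * q v v <= theta1 b v v + theta2 b' v v.
Proof.
move=> [_ _ logA] cp1 cp2 th1 th2 pb bb' b'b.
have [n [a [c [Aac ca1 cvg_a cvg_c]]]] := logA b b' pb bb' b'b.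
have [A1 Alin Amul] := rep_alg rA.
have q0 := si_ge0 si v.
(* Replacing the two sums by [b] and [b'] costs at most [e * q v v] each, hence at most [e0] in
   total. *)
apply/ler_addgt0Pr => e0 e00; pose e := e0 / (2 * q v v + 1).
have e_gt0 : 0 < e by rewrite divr_gt0 // ltr_wpDl // mulr_ge0.
have [N aN] := cvg_rnorm cvg_a e_gt0; have [M cM] := cvg_rnorm cvg_c e_gt0.
pose m := maxn N M.
have {aN} am := aN m (leq_maxl _ _); have {cM} cm := cM m (leq_maxr _ _).
set sa := \sum_(k < n m) _ in am; set sc := \sum_(k < n m) _ in cm.
have le1 : \sum_(k < n m) q (sigma (a m k) v) (sigma (a m k) v) <= theta1 sa v
  v.
  rewrite (cp_sum cp1); apply: ler_sum => k _; apply: kadison_schwarz => //.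
  by have [] := Aac m k (ltn_ord k).
have le2 : 2 * q v v <=
    theta2 sc v v + \sum_(k < n m) q (sigma (a m k) v) (sigma (a m k) v).
  have -> : q v v = \sum_(k < n m) q (sigma (c m k) (sigma (a m k) v)) v.
    transitivity (theta1 1 v v); first by rewrite (represents1 th1).
    rewrite -(ca1 m) (cp_sum cp1); apply: eq_bigr => k _.
    have [Aa Ac] := Aac m k (ltn_ord k).
    by rewrite th1 ?(rep_mul rA) //; exact: Amul.
  rewrite (cp_sum cp2) -big_split mulr_sumr /=; apply: ler_sum => k _.
  have [Aa Ac] := Aac m k (ltn_ord k).
  (* The square of [c_k^* (x) v - 1 (x) sigma a_k v] has cross terms
     [- 2 q (sigma c_k (sigma a_k v)) v], and these sum to [- 2 q v v] over [k]. *)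
  have := cp_pos cp2 [:: (star (c m k), v); (- 1, sigma (a m k) v)].
  rewrite !big_cons !big_nil /= starN star1 starK !(mulrN, mulNr, mulr1, mul1r).
  rewrite opprK !(cpN cp2) (cp_sym cp2) (represents1 th2) (th2 (c m k)) //; lra.
have b1 := cp_bound cp1 (sa - b) v; have b2 := cp_bound cp2 (sc - b') v.
rewrite (cpD cp1) (cpN cp1) (represents1 th1) ler_norml in b1.
rewrite (cpD cp2) (cpN cp2) (represents1 th2) ler_norml in b2.
have eq0 : 2 * (e * q v v) <= e0.
  rewrite mulrCA /e mulrAC ler_pdivrMr ?ltr_wpDl ?mulr_ge0 //.
  by rewrite ler_wpM2l ?(ltW e00) // lerDl.
have e1 : rnorm (sa - b) * q v v <= e * q v v by rewrite ler_wpM2r // ltW.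
have e2 : rnorm (sc - b') * q v v <= e * q v v by rewrite ler_wpM2r // ltW.
case/andP: b1 => _ b1; case/andP: b2 => _ b2; lra.
Qed.

Theorem cp_form_unique theta1 theta2 : dirichlet A \/ logrigged A ->
  cp_form theta1 -> cp_form theta2 -> represents theta1 -> represents theta2 ->
  forall b v w, theta1 b v w = theta2 b v w.
Proof.
move=> hA cp1 cp2 th1 th2; apply: cp_form_polar => // b v.
have q0 := si_ge0 si v.
case: hA => [[_ dense]|logA].
  suff small e : 0 < e -> `|theta1 b v v - theta2 b v v| <= e * (2 * q v v).
    apply/eqP; rewrite -subr_eq0 -normr_le0; apply/ler_addgt0Pr => e e0.
    rewrite add0r; apply: le_trans (small (e / (2 * q v v + 1)) _) _.
      by rewrite divr_gt0 // ltr_wpDl // mulr_ge0.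
    rewrite mulrAC ler_pdivrMr ?ltr_wpDl ?mulr_ge0 //.
    by rewrite ler_wpM2l ?(ltW e0) // lerDl.
  move=> e0; have : closure [set x + star y | x in A & y in A] b by rewrite
    dense.
  move=> /(_ (ball b e%:C)) [|_ [[x Ax [y Ay <-]]]].
    by apply: nbhsx_ballx; rewrite ltcR.
  rewrite -ball_normE /= rnormE ltcR => bxy.
  have th_eq : theta1 (x + star y) v v = theta2 (x + star y) v v.
    by rewrite (cpD cp1) (cpD cp2) (cp_sym cp1) (cp_sym cp2) !th1 // !th2.
  have := cp_bound cp1 (b - (x + star y)) v; have := cp_bound cp2 (b - (x +
    star y)) v.
  rewrite (cpD cp1) (cpN cp1) (represents1 th1) (cpD cp2) (cpN cp2)
    (represents1 th2) th_eq.
  rewrite !ler_norml.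
  have e1 : rnorm (b - (x + star y)) * q v v <= e * q v v by rewrite ler_wpM2r
    // ltW.
  move=> /andP[? ?] /andP[? ?]; apply/andP; split; lra.
have sa_eq h : star h = h -> theta1 h v v = theta2 h v v.
  move=> hs; apply/eqP; rewrite -subr_eq0; apply/eqP.
  pose C := 2 * rnorm h ^+ 2 * q v v.
  have h0 := rnorm_ge0 h.
  have h1 : 0 < 2 * (rnorm h + 1) by rewrite mulr_gt0 // ltr_wpDl.
  (* For these [t] one has [|t h| <= 1/2], so [1 + t h] is strictly positive and its inverse [z] has
     norm at most 2; this is the 2 in [C]. *)
  apply: (@quadratic_eq0 _ C (2 * (rnorm h + 1))^-1); first by rewrite invr_gt0.
  move=> t td; have th_le : `|t| * rnorm h <= 2^-1.
    apply: le_trans (_ : (2 * (rnorm h + 1))^-1 * (rnorm h + 1) <= _).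
      by apply: ler_pM => //; rewrite lerDl.
    by rewrite invfM -mulrA mulVf ?mulr1 // gt_eqF // ltr_wpDl.
  have nth : rnorm (- (t%:C *: h)) = `|t| * rnorm h by rewrite rnormN rnormZr.
  have lt1 : rnorm (- (t%:C *: h)) < 1 by rewrite nth; lra.
  have [z [bz zb zn]] := neumann lt1.
  set b0 := 1 - - _ in bz zb; have b0E : b0 = 1 + t%:C *: h by rewrite /b0
    opprK.
  have z2 : rnorm z <= 2.
    have := rnorm_ge0 z; rewrite nth in zn; nra.
  have pb : positive b0.
    have [|y [_ yE]] := @scal_sub_sqr _ _ (- (t%:C *: h)) 1 _ lt1.
      by rewrite starN starZr hs.
    by exists y; rewrite -yE rmorph1 scale1r.
  have := logrigged_le v logA cp1 cp2 th1 th2 pb bz zb.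
  (* In this second-order expansion the constant terms cancel against [2 * q v v], the linear ones
     give [t] times the difference of the two forms at [h], and the rest is at most [t ^+ 2 * C]. *)
  have -> : z = 1 - t%:C *: h + (t ^+ 2)%:C *: (h * (h * z)).
    have z1 : z = 1 - t%:C *: (h * z).
      by rewrite -bz b0E mulrDl mul1r cscalerAl addrK.
    by rewrite {1}z1 {1}z1 mulrBr mulr1 cscalerAr; lmod R[i].
  rewrite b0E !(cpD cp1, cpD cp2, cpN cp1, cpN cp2, cpZ cp1, cpZ cp2).
  rewrite (represents1 th1) (represents1 th2).
  have := cp_bound cp2 (h * (h * z)) v; rewrite (represents1 th2).
  have hhz : rnorm (h * (h * z)) <= 2 * rnorm h ^+ 2.
    have := ler_rnormM h (h * z); have := ler_rnormM h z.
    have := rnorm_ge0 (h * z); have := rnorm_ge0 z; nra.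
  have := ler_wpM2r q0 hhz; rewrite -/C ler_norml => le1 /andP[_ le2] le3.
  have := ler_wpM2l (sqr_ge0 t) (le_trans le2 le1); lra.
(* On the diagonal a form sees only the selfadjoint part of [b], since ['i h] is skew-adjoint. *)
have skew theta h : cp_form theta -> star h = h -> theta ('i%C *: h) v v = 0.
  move=> cp hs; have := cp_sym cp ('i%C *: h) v v.
  by rewrite starZ hs complexiE conjCi scaleNr (cpN cp) -complexiE; lra.
pose x := (2^-1 : R)%:C *: (b + star b).
have xs : star x = x by rewrite /x starZr star_cart_sa.
have ic : ('i%C : R[i])^* = - 'i%C by rewrite complexiE conjCi.
pose y := (2^-1 : R)%:C *: (('i%C)^* *: (b - star b)).
have ys : star y = y.
  rewrite /y starZr starZ conjCK ic starD starN starK.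
  by lmod R[i].
have -> : b = x + 'i%C *: y.
  have ii : 'i%C * ('i%C)^* = 1 :> R[i] by rewrite ic mulrN -expr2 sqr_i opprK.
  by rewrite /y scalerA mulrC -scalerA (scalerA 'i%C) ii /x; lmod R[i].
by rewrite (cpD cp1) (cpD cp2) !skew // sa_eq.
Qed.

End Uniqueness.
End Forms.

(** * Existence of completely positive extensions *)

Section FormExtension.
Variables (R : realType) (B : cstarAlgType R) (K : lmodType R[i]).
Variables (A : set B) (sigma : B -> K -> K) (q : K -> K -> R).
Hypotheses (si : semi_inner q) (rA : rep A sigma).
Variables (V : lmodType R[i]) (E : B -> K -> K -> V) (Kc : set V).
Implicit Types (a b : B) (x y : V) (v w : K) (r t : R) (l : seq (B * K * K)).
Local Notation "r %:I" := (r%:C *: (1 : B))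
  (at level 1, left associativity, format "r %:I").

Hypotheses (KD : forall x y, Kc x -> Kc y -> Kc (x + y))
  (KZ : forall r x, 0 <= r -> Kc x -> Kc (r%:C *: x)) (K0 : Kc 0)
  (E_lin : forall r a b v w, E (r%:C *: a + b) v w = r%:C *: E a v w + E b v w)
  (E_skew : forall b v w, Kc (E (star b) v w - E b w v))
  (E_pos : forall s : seq (B * K),
    Kc (\sum_(u <- s) \sum_(u' <- s) E (star u.1 * u'.1) u'.2 u.2))
  (E_rep : forall l, (forall u, u \in l -> A u.1.1) ->
    Kc (\sum_(u <- l) E u.1.1 u.1.2 u.2) ->
    0 <= \sum_(u <- l) q (sigma u.1.1 u.1.2) u.2).

Lemma si_add v v' w : q (v + v') w = q v w + q v' w.
Proof. by have := si_lin si 1 v v' w; rewrite rmorph1 scale1r mul1r. Qed.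

Lemma si0 w : q 0 w = 0.
Proof. by apply: (addrI (q 0 w)); rewrite -si_add !addr0. Qed.

Lemma siZ r v w : q (r%:C *: v) w = r * q v w.
Proof. by rewrite -[_ *: v]addr0 (si_lin si) si0 addr0. Qed.

Lemma si_sum (I : Type) (s : seq I) (F : I -> K) w :
  q (\sum_(i <- s) F i) w = \sum_(i <- s) q (F i) w.
Proof. by apply: (big_morph (fun v => q v w)) => [v v'|];
  [exact: si_add|exact: si0]. Qed.

Lemma ED a b v w : E (a + b) v w = E a v w + E b v w.
Proof. by have := E_lin 1 a b v w; rewrite rmorph1 !scale1r. Qed.

Lemma E0 v w : E 0 v w = 0.
Proof. by apply: (addrI (E 0 v w)); rewrite -ED !addr0. Qed.

Lemma EZ r a v w : E (r%:C *: a) v w = r%:C *: E a v w.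
Proof. by rewrite -[_ *: a]addr0 E_lin E0 addr0. Qed.

Lemma EN a v w : E (- a) v w = - E a v w.
Proof. by apply: (addrI (E a v w)); rewrite -ED !subrr E0. Qed.

(** Different lists may have the same first component; that they then have the same second one is a
    consequence of [E_rep]. *)
Definition rep_graph : set (V * R) :=
  [set p | exists2 l, (forall u, u \in l -> A u.1.1) &
    p = (\sum_(u <- l) E u.1.1 u.1.2 u.2, \sum_(u <- l) q (sigma u.1.1 u.1.2)
      u.2)].

Let algA := rep_alg rA.

Lemma alg_scal (k : R[i]) : A (k *: (1 : B)).
Proof.
have [A1 Alin _] := algA; have := Alin (k - 1) 1 1 A1 A1.
by rewrite scalerBl scale1r subrK.
Qed.

Lemma algZ (k : R[i]) a : A a -> A (k *: a).
Proof.
have [_ _ Amul] := algA; move=> /(Amul _ _ (alg_scal k)).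
by rewrite cscalerAl mul1r.
Qed.

Lemma rep_scal (k : R[i]) v : sigma (k *: (1 : B)) v = k *: v.
Proof.
have [A1 _ _] := algA; have := rep_lin rA (k - 1) v A1 A1.
by rewrite scalerBl scale1r subrK (rep1 rA) scalerBl scale1r subrK.
Qed.

Lemma repZ (k : R[i]) a v : A a -> sigma (k *: a) v = k *: sigma a v.
Proof.
move=> Aa; have := rep_mul rA v (alg_scal k) Aa.
by rewrite cscalerAl mul1r rep_scal.
Qed.

Lemma rep_graph_positive : positive_graph Kc rep_graph.
Proof.
split; last by move=> _ [l Al ->] /=; exact: E_rep.
split; first by exists [::]; rewrite ?big_nil.
move=> c _ _ [l Al ->] [l' Al' ->] /=.
exists ([seq (c%:C *: u.1.1, u.1.2, u.2) | u <- l] ++ l').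
  move=> u; rewrite mem_cat => /orP[/mapP[u' ul ->]|/Al'//] /=.
  by apply: algZ; exact: Al.
rewrite !big_cat !big_map /= scaler_sumr mulr_sumr; congr (_ + _, _ + _).
  by apply: eq_bigr => u _; rewrite EZ.
by rewrite !big_seq; apply: eq_bigr => u /Al Au; rewrite repZ // siZ.
Qed.

Lemma dominatedD x y : dominated Kc rep_graph x -> dominated Kc rep_graph y ->
  dominated Kc rep_graph (x + y).
Proof.
have [[_ linG] _] := rep_graph_positive.
have addG p p' : rep_graph p -> rep_graph p' -> rep_graph (p.1 + p'.1, p.2 +
  p'.2).
  by move=> Gp /(linG 1 _ _ Gp); rewrite rmorph1 scale1r mul1r.
move=> [[p Gp Kp] [p' Gp' Kp']] [[u Gu Ku] [u' Gu' Ku']]; split.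
  exists (p.1 + u.1, p.2 + u.2); first exact: addG.
  by rewrite /= opprD addrACA; exact: KD.
exists (p'.1 + u'.1, p'.2 + u'.2); first exact: addG.
by rewrite /= opprD addrACA; exact: KD.
Qed.

(** This is [2 Re <b v, w> <= |w|^2 + |b v|^2 <= |w|^2 + r |v|^2], with [y^* y = r - b^* b] for the
    second step and [E_skew] to identify the two cross terms. The majorant is in the graph because
    scalars lie in [A]. *)
Lemma E_above b v w : exists2 p, rep_graph p & Kc (p.1 - E b v w).
Proof.
pose r := rnorm (star b * b) + 1.
have [||y [_ yE]] := @scal_sub_sqr _ _ (star b * b) r;
  first by rewrite starM starK.
  by rewrite ltrDl.
pose l := [:: ((2^-1)%:I, w, w); ((r / 2)%:I, v, v)].
exists (\sum_(u <- l) E u.1.1 u.1.2 u.2, \sum_(u <- l) q (sigma u.1.1 u.1.2)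
  u.2).
  exists l => // u; rewrite !inE => /orP[]/eqP-> /=; exact: alg_scal.
rewrite /l !big_cons big_nil /= addr0.
have := E_pos [:: (1, w); (- b, v)]; rewrite !big_cons !big_nil /= !addr0.
rewrite starN star1 !(mulrN, mulNr, mulr1, mul1r) opprK !EN => p1.
have := E_pos [:: (y, v)]; rewrite !big_seq1 /= -yE ED EN EZ => p2.
have := KD (KD p1 p2) (E_skew b w v); set u := _ + (_ - _) => p3.
have : Kc ((2^-1)%:C *: u) by apply: KZ => //; rewrite invr_ge0.
congr Kc; rewrite /u !EZ; lmod R[i].
Qed.

Lemma E_dominated b v w : dominated Kc rep_graph (E b v w).
Proof.
have [[G0 linG] _] := rep_graph_positive.
split; first exact: E_above.
have [p Gp Kp] := E_above (- b) v w.
exists (- p.1, - p.2).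
  have := linG (-1) _ _ Gp G0; congr rep_graph.
  by congr pair; rewrite /= addr0; [lmod R[i]|rewrite mulN1r].
by move: Kp; rewrite EN /= !opprK addrC.
Qed.

Lemma dominated_sum (I : Type) (s : seq I) (F : I -> V) :
  (forall i, dominated Kc rep_graph (F i)) ->
  dominated Kc rep_graph (\sum_(i <- s) F i).
Proof.
move=> domF; apply: (big_ind (dominated Kc rep_graph)) => //.
  by rewrite -(E0 0 0); exact: E_dominated.
exact: dominatedD.
Qed.

(** Applied twice: to [module_form] and the inner product of [H] for existence, and to [op_form] and
    the form of a state for isometry. Positivity on all of [Kc] is kept in the conclusion because
    norm estimates are drawn from it. *)
Theorem cp_form_extension : exists theta,
  [/\ cp_form theta, represents A sigma q theta &
    forall l, Kc (\sum_(u <- l) E u.1.1 u.1.2 u.2) ->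
      0 <= \sum_(u <- l) theta u.1.1 u.1.2 u.2].
Proof.
have [f [fG flin fpos]] := riesz_extension KD KZ K0 rep_graph_positive.
pose dom := dominated Kc rep_graph.
have fD x y : dom x -> dom y -> f (x + y) = f x + f y.
  by move=> dx dy; have := flin 1 x y dx dy; rewrite rmorph1 scale1r mul1r.
have dom0 : dom 0 by rewrite -(E0 0 0); exact: E_dominated.
have f0 : f 0 = 0 by apply: (addrI (f 0)); rewrite -fD // !addr0.
have f_sum (I : Type) (s : seq I) (F : I -> V) : (forall i, dom (F i)) ->
    f (\sum_(i <- s) F i) = \sum_(i <- s) f (F i).
  move=> domF; elim: s => [|i s IH]; first by rewrite !big_nil.
  by rewrite !big_cons fD ?IH //; exact: dominated_sum.
pose theta b v w := f (E b v w).
have th_lin r a b v w : theta (r%:C *: a + b) v w = r * theta a v w + theta b v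
  w.
  by rewrite /theta E_lin flin //; exact: E_dominated.
have thD a b v w : theta (a + b) v w = theta a v w + theta b v w.
  by have := th_lin 1 a b v w; rewrite rmorph1 scale1r mul1r.
have th0 v w : theta 0 v w = 0 by rewrite /theta E0.
have thN b v w : theta (- b) v w = - theta b v w.
  by apply: (addrI (theta b v w)); rewrite -thD !subrr.
have thZ r b v w : theta (r%:C *: b) v w = r * theta b v w.
  by rewrite -[_ *: b]addr0 th_lin th0 addr0.
have th_rep : represents A sigma q theta.
  move=> a v w Aa; have := fG (E a v w, q (sigma a v) w); apply.
  by exists [:: (a, v, w)]; rewrite ?big_seq1 // => u /[!inE]/eqP->.
have th_pos l : Kc (\sum_(u <- l) E u.1.1 u.1.2 u.2) ->
    0 <= \sum_(u <- l) theta u.1.1 u.1.2 u.2.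
  move=> Kl; rewrite -f_sum; last by move=> u; exact: E_dominated.
  by apply: fpos => //; apply: dominated_sum => u; exact: E_dominated.
have th_pos2 (s : seq (B * K)) :
    0 <= \sum_(u <- s) \sum_(u' <- s) theta (star u.1 * u'.1) u'.2 u.2.
  have -> : \sum_(u <- s) \sum_(u' <- s) theta (star u.1 * u'.1) u'.2 u.2 =
      f (\sum_(u <- s) \sum_(u' <- s) E (star u.1 * u'.1) u'.2 u.2).
    rewrite f_sum => [|u]; last by apply: dominated_sum => u';
      exact: E_dominated.
    by apply: eq_bigr => u _; rewrite f_sum // => u'; exact: E_dominated.
  apply: fpos => //; apply: dominated_sum => u; apply: dominated_sum => u'.
  exact: E_dominated.
have th_sym b v w : theta (star b) v w = theta b w v.
  have le c v' w' : theta c w' v' <= theta (star c) v' w'.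
    have : 0 <= f (E (star c) v' w' + E (- c) w' v').
      apply: fpos; last by rewrite EN; exact: E_skew.
      by apply: dominatedD; exact: E_dominated.
    rewrite fD; [|exact: E_dominated|exact: E_dominated].
    by rewrite -/(theta _ _ _) -/(theta _ _ _) thN; lra.
  by apply/eqP; rewrite eq_le le andbT -[X in _ <= theta X _ _]starK le.
(* A list of vectors with vanishing combination is null for the positive form,
   so by Cauchy-Schwarz it pairs to zero with everything. *)
have th_null (s : seq (R[i] * K)) b w : \sum_(u <- s) u.1 *: u.2 = 0 ->
    \sum_(u <- s) theta (u.1 *: b) u.2 w = 0.
  move=> s0; set S := \sum_(u <- s) _.
  apply: (@quadratic_eq0 _ _ (theta (b * star b) w w / 2) 1) => // t _.
  have := th_pos2 ((t%:C *: star b, w) :: [seq (u.1 *: (1 : B), u.2) | u <- s]).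
  rewrite !big_cons /= !big_map /=.
  have -> : \sum_(u <- s) theta (star (t%:C *: star b) * (u.1 *: (1 : B))) u.2
    w = t * S.
    rewrite /S mulr_sumr; apply: eq_bigr => u _.
    by rewrite starZr starK cscalerAl cscalerAr mulr1 thZ.
  under eq_bigr => u _.
    rewrite big_cons /= big_map -th_sym starM !starZ !star1 !starK conjCK.
    rewrite cscalerAl cscalerAr mulr1 conj_real thZ.
    over.
  rewrite big_split /= -mulr_sumr -/S.
  have -> : \sum_(u <- s) \sum_(u' <- s) theta (((u.1)^* *: (1 : B)) * (u'.1 *:
    (1 : B))) u'.2 u.2 = 0.
    transitivity (\sum_(u <- s) q 0 (u.1 *: u.2)).
      apply: eq_bigr => u _; rewrite -s0 si_sum; apply: eq_bigr => u' _.
      rewrite cscalerAl mul1r scalerA.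
      by rewrite th_rep ?rep_scal; [rewrite -scalerA (si_scale si)
        conjCK|exact: alg_scal].
    by rewrite big1 // => u _; rewrite si0.
  rewrite starZr starK cscalerAl cscalerAr !thZ; lra.
exists theta; split=> //; split=> //.
- move=> b v v' w; have := th_null [:: (1, v + v'); (- 1, v); (- 1, v')] b w.
  rewrite !big_cons !big_nil /= !scale1r !scaleN1r !thN => H.
  by have := H (_ : _ = 0); rewrite !addr0 -opprD subrr => /(_ erefl); lra.
- move=> b k v w; have := th_null [:: (1, k *: v); (- k, v)] b w.
  rewrite !big_cons !big_nil /= !scale1r !scaleNr !thN !addr0 subrr.
  by move=> /(_ erefl); lra.
Qed.

End FormExtension.

(** * Hilbert spaces and matrices of operators *)

Section ComplexParts.
Variable R : realType.
Implicit Types z : R[i].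

Lemma ReD z z' : complex.Re (z + z') = complex.Re z + complex.Re z'.
Proof. by case: z => a b; case: z' => c d. Qed.

Lemma ReN z : complex.Re (- z) = - complex.Re z.
Proof. by case: z. Qed.

Lemma ImD z z' : complex.Im (z + z') = complex.Im z + complex.Im z'.
Proof. by case: z => a b; case: z' => c d. Qed.

Lemma Re_sum (I : Type) (s : seq I) (P : pred I) (F : I -> R[i]) :
  complex.Re (\sum_(i <- s | P i) F i) = \sum_(i <- s | P i) complex.Re (F i).
Proof. by apply: (big_morph (@complex.Re R)) => // z z'; exact: ReD. Qed.

Lemma ReZ (r : R) z : complex.Re (r%:C * z) = r * complex.Re z.
Proof. by case: z => a b; rewrite /= mul0r subr0. Qed.

Lemma Re_conj z : complex.Re z^* = complex.Re z.
Proof. by case: z. Qed.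

Lemma Re_mulNi z : complex.Re (- 'i%C * z) = complex.Im z.
Proof. by case: z => a b; rewrite /= oppr0 mul0r sub0r mulN1r opprK. Qed.

Lemma Im_muli z : complex.Im ('i%C * z) = complex.Re z.
Proof. by case: z => a b; rewrite /= mul0r add0r mul1r. Qed.

Lemma Im_mulNi z : complex.Im (- 'i%C * z) = - complex.Re z.
Proof. by case: z => a b; rewrite /= oppr0 mul0r add0r mulN1r. Qed.

Lemma Re_ge0 z : 0 <= z -> 0 <= complex.Re z.
Proof. by rewrite lecE => /andP[]. Qed.

Lemma Im_ge0 z : 0 <= z -> complex.Im z = 0.
Proof. exact: ger0_Im. Qed.

End ComplexParts.

Section HilbertSpace.
Variables (R : realType) (H : hilbertType R).
Implicit Types (v w u : H) (r t : R) (k : R[i]).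

Definition rdot v w : R := complex.Re (dot v w).

Lemma dotD v v' w : dot (v + v') w = dot v w + dot v' w.
Proof. by have := dot_linear 1 v v' w; rewrite scale1r mul1r. Qed.

Lemma dot0 w : dot (0 : H) w = 0.
Proof. by apply: (addrI (dot 0 w)); rewrite -dotD !addr0. Qed.

Lemma dotZ k v w : dot (k *: v) w = k * dot v w.
Proof. by rewrite -[k *: v]addr0 dot_linear dot0 addr0. Qed.

Lemma dot_sum (I : Type) (s : seq I) (P : pred I) (F : I -> H) w :
  dot (\sum_(i <- s | P i) F i) w = \sum_(i <- s | P i) dot (F i) w.
Proof.
by apply: (big_morph (fun v => dot v w)) => [v v'|]; [exact: dotD|exact: dot0].
Qed.

Lemma rdot_lin r v v' w : rdot (r%:C *: v + v') w = r * rdot v w + rdot v' w.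
Proof. by rewrite /rdot dot_linear ReD ReZ. Qed.

Lemma rdotC v w : rdot v w = rdot w v.
Proof. by rewrite /rdot [dot w v]dot_conj Re_conj. Qed.

Lemma rdot_scale k v w : rdot (k *: v) w = rdot v (k^* *: w).
Proof.
rewrite /rdot dotZ [dot v (_ *: _)]dot_conj dotZ Re_conj [dot w v]dot_conj.
by rewrite -rmorphM Re_conj.
Qed.

Lemma rdot_sqr v : rdot v v = rnorm v ^+ 2.
Proof. by rewrite /rdot -dot_norm rnormE -rmorphXn. Qed.

Lemma rdot_semi_inner : semi_inner rdot.
Proof.
split; [exact: rdot_lin|exact: rdotC|exact: rdot_scale|].
by move=> v; rewrite rdot_sqr sqr_ge0.
Qed.

Lemma rdotD v v' w : rdot (v + v') w = rdot v w + rdot v' w.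
Proof. exact: (si_add rdot_semi_inner). Qed.

Lemma rdotZ r v w : rdot (r%:C *: v) w = r * rdot v w.
Proof. exact: (siZ rdot_semi_inner). Qed.

Lemma rdotN v w : rdot (- v) w = - rdot v w.
Proof. by have := rdotZ (-1) v w; rewrite rmorphN rmorph1 scaleN1r mulN1r. Qed.

Lemma rdotB v v' w : rdot (v - v') w = rdot v w - rdot v' w.
Proof. by rewrite rdotD rdotN. Qed.

Lemma rdot_sum (I : Type) (s : seq I) (P : pred I) (F : I -> H) w :
  rdot (\sum_(i <- s | P i) F i) w = \sum_(i <- s | P i) rdot (F i) w.
Proof.
apply: (big_morph (fun v => rdot v w)) => [v v'|]; first exact: rdotD.
exact: (si0 rdot_semi_inner).
Qed.

Lemma rdot_inj v w : (forall u, rdot v u = rdot w u) -> v = w.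
Proof.
move=> vw; apply/eqP; rewrite -subr_eq0; apply/eqP/rnorm_eq0/eqP.
by rewrite -sqrf_eq0 -rdot_sqr rdotB vw subrr.
Qed.

Lemma sqr_rnormD v w : rnorm (v + w) ^+ 2 = rnorm v ^+ 2 + 2 * rdot v w + rnorm
  w ^+ 2.
Proof.
rewrite -!rdot_sqr rdotD (rdotC v) (rdotC w (v + w)) !rdotD (rdotC w v); ring.
Qed.

Lemma quadratic_discr (P Q D : R) : 0 <= P -> (forall t, 0 <= t ^+ 2 * P - 2 *
  t * D + Q) ->
  D ^+ 2 <= P * Q.
Proof.
move=> P_ge0 nn; have Q0 : 0 <= Q by have := nn 0; rewrite expr0n /=; lra.
have [P0|P0|P0] := ltrgt0P P.
- have := nn (D / P); rewrite expr_div_n.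
  have -> : D ^+ 2 / P ^+ 2 * P - 2 * (D / P) * D + Q = (P * Q - D ^+ 2) / P.
    by field; rewrite gt_eqF.
  by rewrite pmulr_lge0 ?invr_gt0 // subr_ge0.
- by move: P_ge0; rewrite leNgt P0.
- rewrite P0 mul0r; have [->|D0] := eqVneq D 0; first by rewrite expr0n.
  have := nn ((Q + 1) / D); rewrite P0 mulr0.
  have -> : 0 - 2 * ((Q + 1) / D) * D + Q = - Q - 2 by field.
  lra.
Qed.

Lemma rdot_le v w : rdot v w <= rnorm v * rnorm w.
Proof.
have : rdot v w ^+ 2 <= rnorm v ^+ 2 * rnorm w ^+ 2.
  apply: quadratic_discr => [|t]; first exact: sqr_ge0.
  have := sqr_rnormD (t%:C *: v) (- w); rewrite rdotC rdotN rdotC rdotZ rnormN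
    rnormZr.
  rewrite exprMn real_normK ?num_real // => E.
  have := sqr_ge0 (rnorm (t%:C *: v - w)); rewrite E; lra.
rewrite -exprMn => le2; have p0 : 0 <= rnorm v * rnorm w by rewrite mulr_ge0
  ?rnorm_ge0.
have [d0|d0] := leP 0 (rdot v w); last exact: le_trans (ltW d0) p0.
by rewrite -(@ler_pXn2r _ 2) ?nnegrE.
Qed.

(* The representing vector minimises |v|^2 - 2 f v; minimising sequences are
   Cauchy by the parallelogram identity. *)
Theorem riesz_representation (f : H -> R) (C : R) :
  (forall r v w, f (r%:C *: v + w) = r * f v + f w) ->
  (forall v, f v <= C * rnorm v) ->
  exists u, forall v, f v = rdot u v.
Proof.
move=> flin fC; pose J v := rnorm v ^+ 2 - 2 * f v.
have JC v : - C ^+ 2 <= J v.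
  have := fC v; have := sqr_ge0 (rnorm v - C); rewrite /J; nra.
have infJ : has_inf (range J).
  by split; [exists (J 0), 0|exists (- C ^+ 2) => _ [v _ <-]].
pose m := inf (range J).
have mJ v : m <= J v by apply: ge_inf; [case: infJ|exists v].
have /choice [u uJ] (n : nat) : exists v, J v < m + n.+1%:R^-1.
  have [|_ [v _ <-] Jv] := @inf_adherent _ (range J) n.+1%:R^-1 _ infJ.
    by rewrite invr_gt0.
  by exists v.
have fD v w : f (v + w) = f v + f w by have := flin 1 v w;
  rewrite rmorph1 scale1r mul1r.
have f0 : f 0 = 0 by apply: (addrI (f 0)); rewrite -fD !addr0.
have fZ r v : f (r%:C *: v) = r * f v by rewrite -[_ *: v]addr0 flin f0 addr0.
have small (e : R) : 0 < e -> exists n, forall i, (n <= i)%N -> i.+1%:R^-1 < e.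
  move=> e0; exists (Num.truncn e^-1) => i ni.
  rewrite invf_plt ?posrE //; apply: lt_le_trans (truncnS_gt _) _.
  by rewrite ler_nat.
have u_dist i j : rnorm (u i - u j) ^+ 2 <= 2 * (i.+1%:R^-1 + j.+1%:R^-1).
  have := mJ ((2^-1 : R)%:C *: (u i + u j)); have := uJ i; have := uJ j.
  rewrite /J fZ fD rnormZr ger0_norm ?invr_ge0 // exprMn (sqr_rnormD (u i) (u
    j)).
  rewrite (sqr_rnormD (u i) (- u j)) (rdotC _ (- u j)) rdotN (rdotC (u j))
    rnormN.
  have -> : 2^-1 ^+ 2 = 4^-1 :> R by field.
  move: (f _) (f _) (rdot _ _) (rnorm _ ^+ 2) (rnorm _ ^+ 2) (_^-1) (_^-1) => *.
  lra.
have [|x xu] := @rnorm_complete _ _ u.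
  move=> e e0; have [|n nP] := small (e ^+ 2 / 4);
    first by rewrite divr_gt0 ?exprn_gt0.
  exists n => i j /nP ni /nP nj.
  rewrite -(@ltr_pXn2r _ 2) ?nnegrE ?rnorm_ge0 ?(ltW e0) //.
  apply: le_lt_trans (u_dist i j) _.
  by move: (i.+1%:R^-1) (j.+1%:R^-1) ni nj => a b; lra.
exists x => v; apply/eqP; rewrite -subr_eq0 -oppr_eq0; apply/eqP.
(* The variation of [J] in the direction [v] is taken at [u n], where [J] is within [e] of its
   infimum; the term in [rdot (u n - x) v] is absorbed into the error. *)
apply: (@quadratic_eq0 _ _ (rnorm v ^+ 2 / 2) 1) => // t _.
apply/ler_addgt0Pr => e e0.
have c0 : 0 < `|t| * rnorm v + 1 by rewrite ltr_wpDl // mulr_ge0 ?rnorm_ge0.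
have [|N xN] := xu (e / 2 / (`|t| * rnorm v + 1)); first by rewrite !divr_gt0.
have [|M eM] := small e; first by [].
pose n := maxn N M; have {xN} := xN n (leq_maxl _ _).
have {eM} := eM n (leq_maxr _ _) => en.
rewrite ltr_pdivlMr // mulrDr mulr1 => xn.
have := mJ (u n + t%:C *: v); have := uJ n.
rewrite /J fD fZ sqr_rnormD rdotC rdotZ rnormZr exprMn real_normK ?num_real //.
rewrite (rdotC v).
have le1 : t * rdot (u n - x) v <= rnorm (u n - x) * (`|t| * rnorm v).
  rewrite rdotC -rdotZ rdotC.
  by apply: le_trans (rdot_le _ _) _; rewrite rnormZr.
rewrite rdotB in le1.
have := rnorm_ge0 (u n - x).
move: (t ^+ 2) (n.+1%:R^-1) (rnorm v ^+ 2) (rnorm (u n) ^+ 2) en le1 xn => t2 d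
  v2 u2.
move: (rnorm (u n - x) * _) => z; rewrite mulrBr; lra.
Qed.

End HilbertSpace.

Section OperatorNorms.
Variable R : realType.

Lemma ge_sup_operator (X Y : Type) (p : X -> R) (q : Y -> R) (f : X -> Y) (M :
  R) :
  0 <= M -> (exists x, p x <= 1) -> (forall x, q (f x) <= M * p x) ->
  sup [set q (f x) | x in [set x | p x <= 1]] <= M.
Proof.
move=> M0 [x0 px0] fM; apply: ge_sup; first by exists (q (f x0)), x0.
by move=> _ [x /= px <-]; apply: le_trans (fM x) _; rewrite ler_piMr.
Qed.

(** The rescaling [sc] is abstract so that [colmul] on [B^n] and scaling on [H^n] are both covered.
    The bound [M] makes the set bounded, without which its [sup] would be a default value. *)
Lemma sup_operator_bound (X Y : Type) (p : X -> R) (q : Y -> R) (f : X -> Y)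
    (sc : R -> X -> X) (M : R) :
  0 <= M -> (forall x, 0 <= p x) -> (forall x, q (f x) <= M * p x) ->
  (forall r x, 0 < r -> p (sc r x) = r * p x /\ q (f (sc r x)) = r * q (f x)) ->
  forall x, q (f x) <= sup [set q (f x) | x in [set x | p x <= 1]] * p x.
Proof.
move=> M0 p0 fM psc x; set S := [set _ | _ in _].
have [px0|px_neq0] := eqVneq (p x) 0.
  by apply: le_trans (fM x) _; rewrite px0 !mulr0.
have px_gt0 : 0 < p x by rewrite lt0r px_neq0 p0.
rewrite -ler_pdivrMr //; apply: ub_le_sup.
  by exists M => _ [y /= py <-]; apply: le_trans (fM y) _; rewrite ler_piMr.
have [|pr qr] := psc (p x)^-1 x; first by rewrite invr_gt0.
by exists (sc (p x)^-1 x); [rewrite /= pr mulVf|rewrite qr mulrC].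
Qed.

Lemma sup_nonneg (S : set R) : (forall r, S r -> 0 <= r) -> 0 <= sup S.
Proof.
move=> S0; have [supS|/sup_out-> //] := pselect (has_sup S).
have [[r Sr] _] := supS; apply: le_trans (S0 r Sr) _.
exact: sup_upper_bound.
Qed.

Section CStarMatrices.
Variables (B : cstarAlgType R) (n : nat).
Implicit Types (x : 'M[B]_n) (z : 'cV[B]_n).

Lemma hmod_norm0 : hmod_norm (0 : 'cV[B]_n) = 0.
Proof.
by rewrite /hmod_norm big1 ?rnorm0 ?sqrtr0 // => i _; rewrite !mxE mulr0.
Qed.

Lemma cstar_mx_norm_le x M : 0 <= M ->
  (forall z, hmod_norm (x *m z) <= M * hmod_norm z) -> cstar_mx_norm x <= M.
Proof.
by move=> M0; apply: ge_sup_operator => //; exists 0; rewrite hmod_norm0.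
Qed.

Lemma cstar_mx_norm_bound x z :
  hmod_norm (x *m z) <= cstar_mx_norm x * hmod_norm z.
Proof.
have [M M0 xM] := mx_bounded x.
apply: (@sup_operator_bound _ _ _ _ (mulmx x)
  (fun r z => colmul z (r%:C *: (1 : B))) M M0 _ xM) => [z'|r z' r0].
  exact: hmod_norm_ge0.
by rewrite mulmx_colmul !hmod_norm_colmul gtr0_norm.
Qed.

Lemma cstar_mx_norm_ge0 x : 0 <= cstar_mx_norm x.
Proof.
apply: sup_nonneg => _ [z _ <-]; exact: hmod_norm_ge0.
Qed.

End CStarMatrices.

Variable H : hilbertType R.
Implicit Types (v w : H) (r : R).

Lemma bounded_opP (T : H -> H) : bounded_op T <->
  linear T /\ exists2 C, 0 <= C & forall v, rnorm (T v) <= C * rnorm v.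
Proof.
split=> [[linT cT]|[linT [C C0 TC]]]; split=> //.
- have T0 : T 0 = 0.
    by have := linT (- 1) 0 0; rewrite !scaleN1r oppr0 addr0 addNr.
  have TZ (k : R[i]) v : T (k *: v) = k *: T v.
    by have := linT k v 0; rewrite !addr0 T0 addr0.
  have /cvgrPdist_lt /(_ 1 ltr01) := cT 0.
  move=> /nbhs_ballP[d /= d0 dP].
  have dE : d = (complex.Re d)%:C by rewrite RRe_real // gtr0_real.
  have rd0 : 0 < complex.Re d by rewrite -ltcR -dE.
  have small v : rnorm v < complex.Re d -> rnorm (T v) < 1.
    move=> vd; have := dP v; rewrite -ball_normE /= !sub0r T0 !normrN.
    rewrite sub0r normrN.
    by rewrite !rnormE dE ltcR => /(_ vd) lt1; rewrite -ltcR.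
  exists (2 / complex.Re d); first by rewrite divr_ge0 // ltW.
  move=> v; have [v0|v0] := eqVneq (rnorm v) 0.
    by rewrite (rnorm_eq0 v0) T0 !rnorm0 mulr0.
  have vgt0 : 0 < rnorm v by rewrite lt0r v0 rnorm_ge0.
  pose t := complex.Re d / 2 / rnorm v.
  have t0 : 0 < t by rewrite !divr_gt0.
  have := small (t%:C *: v); rewrite TZ !rnormZr gtr0_norm // /t divfK //.
  move=> /(_ _); rewrite ltr_pdivrMr // ltr_pMr // ltr1n => /(_ erefl).
  rewrite mulrAC ltr_pdivrMr // mul1r => lt1.
  by rewrite mulrAC ler_pdivlMr // ltW //; lra.
- have TB v w : T v - T w = T (v - w).
    by have := linT (- 1) w v; rewrite !scaleN1r addrC => <-; rewrite addrC.
  move=> v; apply/cvgrPdist_lt => e e0.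
  have eE : e = (complex.Re e)%:C by rewrite RRe_real // gtr0_real.
  have re0 : 0 < complex.Re e by rewrite -ltcR -eE.
  have C1 : 0 < C + 1 by rewrite ltr_wpDl.
  apply/nbhs_ballP; exists (complex.Re e / (C + 1))%:C => /=.
    by rewrite ltcR divr_gt0.
  move=> w; rewrite -ball_normE /= TB !rnormE eE !ltcR ltr_pdivlMr // => lt1.
  apply: le_lt_trans (TC _) (le_lt_trans _ lt1).
  by rewrite mulrC ler_wpM2l ?rnorm_ge0 // lerDl.
Qed.

Section OperatorMatrices.
Variable n : nat.
Implicit Types (T : 'M[H -> H]_n) (xi : 'I_n -> H).

Lemma vec_norm_ge0 xi : 0 <= vec_norm xi.
Proof. exact: sqrtr_ge0. Qed.

Lemma sqr_vec_norm xi : vec_norm xi ^+ 2 = \sum_i rnorm (xi i) ^+ 2.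
Proof. by rewrite sqr_sqrtr // sumr_ge0 // => i _; rewrite sqr_ge0. Qed.

Lemma vec_normZ r xi : vec_norm (fun i => r%:C *: xi i) = `|r| * vec_norm xi.
Proof.
apply/eqP; rewrite -(@eqrXn2 _ 2) ?mulr_ge0 ?vec_norm_ge0 //.
rewrite exprMn !sqr_vec_norm mulr_sumr; apply/eqP; apply: eq_bigr => i _.
by rewrite rnormZr exprMn.
Qed.

Lemma rnorm_coord_le xi i : rnorm (xi i) <= vec_norm xi.
Proof.
rewrite -(@ler_pXn2r _ 2) ?nnegrE ?vec_norm_ge0 ?rnorm_ge0 // sqr_vec_norm.
by rewrite (bigD1 i) //= lerDl sumr_ge0 // => j _; rewrite sqr_ge0.
Qed.

Lemma opmx_bounded T : (forall i j, bounded_op (T i j)) ->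
  exists2 M, 0 <= M & forall xi, vec_norm (opmx_apply T xi) <= M * vec_norm xi.
Proof.
move=> bT; have /choice [c cP] (ij : 'I_n * 'I_n) : exists C,
    0 <= C /\ forall v, rnorm (T ij.1 ij.2 v) <= C * rnorm v.
  by have /bounded_opP[_ [C C0 TC]] := bT ij.1 ij.2; exists C.
pose C := \sum_i \sum_j c (i, j).
have c0 i j : 0 <= c (i, j) by have [] := cP (i, j).
have C0 : 0 <= C by apply: sumr_ge0 => i _; apply: sumr_ge0 => j _.
exists (n%:R * C) => [|xi]; first by rewrite mulr_ge0.
have entry i : rnorm (opmx_apply T xi i) <= C * vec_norm xi.
  apply: le_trans (rnorm_sum _ _ _) _.
  apply: le_trans (_ : \sum_j c (i, j) * vec_norm xi <= _).
    apply: ler_sum => j _; have [_ /(_ (xi j)) /= le1] := cP (i, j).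
    by apply: le_trans le1 _; rewrite ler_wpM2l // rnorm_coord_le.
  rewrite -mulr_suml ler_wpM2r ?vec_norm_ge0 // /C [leRHS](bigD1 i) //= lerDl.
  by apply: sumr_ge0 => k _; apply: sumr_ge0 => j _.
have K0 : 0 <= C * vec_norm xi by rewrite mulr_ge0 ?vec_norm_ge0.
rewrite -(@ler_pXn2r _ 2) ?nnegrE ?mulr_ge0 ?vec_norm_ge0 // sqr_vec_norm.
apply: le_trans (_ : \sum_(i < n) (C * vec_norm xi) ^+ 2 <= _).
  by apply: ler_sum => i _; rewrite ler_pXn2r ?nnegrE ?rnorm_ge0.
rewrite sumr_const card_ord -mulrA [leRHS]exprMn -[leLHS]mulr_natl.
rewrite ler_wpM2r ?sqr_ge0 //.
by case: (n) => [|k]; rewrite ?expr0n // -natrX ler_nat leq_pmulr.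
Qed.

Lemma opmx_norm_le T M : 0 <= M ->
  (forall xi, vec_norm (opmx_apply T xi) <= M * vec_norm xi) -> opmx_norm T <=
    M.
Proof.
move=> M0; apply: ge_sup_operator => //; exists (fun=> 0).
rewrite -(@ler_pXn2r _ 2) ?nnegrE ?vec_norm_ge0 // sqr_vec_norm expr1n.
by rewrite big1 // => i _; rewrite rnorm0 expr0n.
Qed.

Lemma opmx_norm_bound T xi : (forall i j, bounded_op (T i j)) ->
  vec_norm (opmx_apply T xi) <= opmx_norm T * vec_norm xi.
Proof.
move=> bT; have [M M0 TM] := opmx_bounded bT.
apply: (@sup_operator_bound _ _ (@vec_norm R H n) (@vec_norm R H n) (opmx_apply
  T)
  (fun r xi i => r%:C *: xi i) M M0 _ TM) => [xi'|r xi' r0].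
  exact: vec_norm_ge0.
split; first by rewrite vec_normZ gtr0_norm.
rewrite -[X in X * _](gtr0_norm r0) -vec_normZ; congr vec_norm;
  apply/funext => i.
rewrite /opmx_apply scaler_sumr; apply: eq_bigr => j _.
have [linT _] := bT i j; have T0 : T i j 0 = 0.
  by have := linT (- 1) 0 0; rewrite !scaleN1r oppr0 addr0 addNr.
by have := linT r%:C (xi' j) 0; rewrite !addr0 T0 addr0.
Qed.

Lemma opmx_norm_ge0 T : 0 <= opmx_norm T.
Proof. apply: sup_nonneg => _ [xi _ <-]; exact: vec_norm_ge0. Qed.

Definition vdot xi eta : R := \sum_(i < n) rdot (xi i) (eta i).

Lemma vdot_sqr xi : vdot xi xi = vec_norm xi ^+ 2.
Proof. by rewrite sqr_vec_norm; apply: eq_bigr => i _; rewrite rdot_sqr. Qed.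

Lemma sqr_vec_normB t xi eta : vec_norm (fun i => xi i - t%:C *: eta i) ^+ 2 =
  vec_norm xi ^+ 2 - 2 * t * vdot eta xi + t ^+ 2 * vec_norm eta ^+ 2.
Proof.
rewrite !sqr_vec_norm /vdot !mulr_sumr -sumrB -big_split /=.
apply: eq_bigr => i _; rewrite sqr_rnormD rnormN rnormZr rdotC rdotN rdotZ.
by rewrite exprMn real_normK ?num_real //; ring.
Qed.

End OperatorMatrices.
End OperatorNorms.

(** * Completely positive maps and their forms *)

Section CompletelyPositiveForms.
Variables (R : realType) (B : cstarAlgType R) (H : hilbertType R).
Implicit Types (Phi : B -> H -> H) (b : B) (v w : H).

Lemma cp_list_ge0 Phi (s : seq (B * H)) : completely_positive bounded_op Phi ->
  0 <= \sum_(u <- s) \sum_(u' <- s) dot (Phi (star u.1 * u'.1) u'.2) u.2.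
Proof.
move=> [_ _ cpPhi]; case: s => [|u0 s]; first by rewrite big_nil.
set l := u0 :: s; pose n := size s; pose a (i : 'I_n.+1) := (nth u0 l i).1.
(* Only the first row of [y] is nonzero, so [y^* y] has exactly the entries [a_i^* a_j]. *)
pose y : 'M[B]_n.+1 := \matrix_(i, j) if i == 0 then a j else 0.
have := cpPhi _ (star_mx y *m y) (ex_intro _ y erefl) (fun i => (nth u0 l i).2).
congr (0 <= _); rewrite (big_nth u0) big_mkord; apply: eq_bigr => i _.
rewrite /opmx_apply dot_sum.
rewrite (big_nth u0) big_mkord; apply: eq_bigr => j _.
rewrite mxE; congr (dot (Phi _ _) _); rewrite mxE big_ord_recl big1 ?addr0 =>
  [|k _].
  by rewrite !mxE.
by rewrite !mxE /= mulr0.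
Qed.

Lemma cp_form_of_cp Phi : completely_positive bounded_op Phi ->
  cp_form (fun b v w => rdot (Phi b v) w).
Proof.
move=> cp; have [bPhi linPhi _] := cp.
have PhiD a b v : Phi (a + b) v = Phi a v + Phi b v.
  by have := linPhi 1 a b; rewrite !scale1r => ->.
have Phi0 v : Phi 0 v = 0 by apply: (addrI (Phi 0 v)); rewrite -PhiD !addr0.
have PhiZ (k : R[i]) b v : Phi (k *: b) v = k *: Phi b v.
  have E := linPhi k b 0; rewrite (_ : Phi 0 = 0) ?addr0 in E;
    last exact/funext.
  by rewrite E.
have linb b v w (k : R[i]) : Phi b (k *: v + w) = k *: Phi b v + Phi b w.
  by have [lb _] := bPhi b; exact: lb.
have Pb0 b : Phi b 0 = 0.
  by have := linb b 0 0 (- 1); rewrite !scaleN1r oppr0 addr0 addNr.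
(* The off-diagonal terms of a positive 2x2 sum have opposite imaginary parts;
   applied to [b] and ['i b] this gives the symmetry. *)
have im b v w : complex.Im (dot (Phi b v) w) = - complex.Im (dot (Phi (star b)
  w) v).
  have := Im_ge0 (cp_list_ge0 [:: (1, w); (b, v)] cp).
  have := Im_ge0 (cp_list_ge0 [:: (1, w)] cp).
  have := Im_ge0 (cp_list_ge0 [:: (b, v)] cp).
  rewrite !big_seq1 !big_cons !big_nil /= !addr0 !star1 !mul1r !mulr1 !ImD =>
    -> ->.
  by lra.
split.
- by move=> r a b v w; rewrite PhiD PhiZ rdot_lin.
- move=> b v w; have := im ('i%C *: b) w v.
  rewrite starZ !PhiZ !dotZ complexiE conjCi -complexiE.
  by rewrite Im_muli Im_mulNi opprK => E; rewrite /rdot E.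
- by move=> b v v' w; have := linb b v v' 1; rewrite !scale1r => ->;
    rewrite rdotD.
- by move=> b k v w; have := linb b v 0 k; rewrite !addr0 Pb0 addr0 PhiZ => ->.
- move=> s; have := Re_ge0 (cp_list_ge0 s cp); congr (0 <= _).
  by rewrite Re_sum; apply: eq_bigr => u _; rewrite Re_sum.
Qed.

Lemma cp_form_le theta b v w : cp_form theta ->
  (forall v w, theta 1 v w = rdot v w) ->
  theta b v w <= rnorm b * rnorm v * rnorm w.
Proof.
move=> cp th1; have le2 : theta b v w ^+ 2 <= rnorm w ^+ 2 * (rnorm b * rnorm
  v) ^+ 2.
  apply: quadratic_discr => [|t]; first exact: sqr_ge0.
  have := cp_pos cp [:: (t%:C *: (1 : B), w); (- b, v)].
  rewrite !big_cons !big_nil /= !addr0 starN starZr star1.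
  rewrite !(mulrN, mulNr, mulr1, mul1r) opprK !(cscalerAl, cscalerAr) !(mulr1,
    mul1r).
  rewrite !(cpN cp, cpZ cp) (cp_sym cp) th1 rdot_sqr.
  have := cp_bound cp (star b * b) v.
  rewrite th1 rdot_sqr rnorm_starM ler_norml => /andP[_]; rewrite exprMn; lra.
rewrite -exprMn in le2.
have p0 : 0 <= rnorm b * rnorm v * rnorm w by rewrite !mulr_ge0 ?rnorm_ge0.
have [d0|d0] := leP 0 (theta b v w); last exact: le_trans (ltW d0) p0.
by rewrite -(@ler_pXn2r _ 2) ?nnegrE // [X in _ <= X ^+ 2]mulrC.
Qed.

Lemma cp_of_form theta : cp_form theta -> (forall v w, theta 1 v w = rdot v w)
  ->
  exists Phi, completely_positive bounded_op Phi /\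
    forall b v w, rdot (Phi b v) w = theta b v w.
Proof.
move=> cp th1.
have ex (bv : B * H) : exists u, forall w, theta bv.1 bv.2 w = rdot u w.
  have [r v' w|v'|u uP] :=
    @riesz_representation _ _ (theta bv.1 bv.2) (rnorm bv.1 * rnorm bv.2).
  - rewrite (cp_addr cp) (cp_scaler cp) conj_real.
    by rewrite -[_ *: bv.1]addr0 (cp_lin cp) (cp0 cp) addr0.
  - exact: cp_form_le.
  - by exists u => w; rewrite uP rdotC.
have [F FP] := choice ex; pose Phi b v := F (b, v).
have PhiP b v w : rdot (Phi b v) w = theta b v w by rewrite -(FP (b, v)).
have linb b v w (k : R[i]) : Phi b (k *: v + w) = k *: Phi b v + Phi b w.
  apply: rdot_inj => u; rewrite rdotD rdot_scale !PhiP (cp_addl cp).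
  by rewrite (cp_scalel cp) (cp_scaler cp) conjCK.
have PhiZ (k : R[i]) b v : Phi (k *: b) v = k *: Phi b v.
  by apply: rdot_inj => u; rewrite rdot_scale !PhiP (cp_scaler cp) conjCK.
have PhiD a b v : Phi (a + b) v = Phi a v + Phi b v.
  by apply: rdot_inj => u; rewrite rdotD !PhiP (cpD cp).
exists Phi; split=> //; split.
- move=> b; apply/bounded_opP; split; first by move=> k v w; exact: linb.
  exists (rnorm b) => [|v]; first exact: rnorm_ge0.
  have := cp_form_le b v (Phi b v) cp th1; rewrite -PhiP rdot_sqr.
  have := rnorm_ge0 (Phi b v); rewrite le_eqVlt => /predU1P[<- _|gt0].
    by rewrite mulr_ge0 ?rnorm_ge0.
  by rewrite expr2 ler_pM2r.
- by move=> k a b; apply/funext => v; rewrite PhiD PhiZ.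
- move=> n x [y xE] xi; set S := \sum_i _.
  have SE (k : R[i]) : complex.Re (k * S) =
      \sum_i \sum_j theta (k *: x i j) (xi j) (xi i).
    rewrite mulr_sumr Re_sum; apply: eq_bigr => i _.
    rewrite /opmx_apply -dotZ scaler_sumr -/(rdot _ _) rdot_sum.
    by apply: eq_bigr => j _; rewrite mxE -PhiP PhiZ.
  have xh i j : star (x i j) = x j i.
    rewrite xE !mxE star_sum; apply: eq_bigr => k _.
    by rewrite !mxE starM starK.
  rewrite lecE; apply/andP; split.
    apply/eqP; rewrite -Re_mulNi SE /=.
    (* Exchanging [i] and [j], and using that [x] is hermitian, the imaginary part equals its
       opposite. *)
    have anti : \sum_i \sum_j theta (- 'i%C *: x i j) (xi j) (xi i) =
        - \sum_i \sum_j theta (- 'i%C *: x i j) (xi j) (xi i).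
      rewrite [LHS]exchange_big -sumrN; apply: eq_bigr => i _.
      rewrite -sumrN; apply: eq_bigr => j _.
      have icN : (- 'i%C : R[i])^* = 'i%C by rewrite complexiE -conjCi conjCK.
      by rewrite -(cp_sym cp (_ *: x j i)) starZ icN xh -(cpN cp) scaleNr opprK.
    lra.
  rewrite -[S]mul1r SE /=.
  (* [x = y^* y] splits over the rows of [y], and each row is a list to which [cp_pos] applies. *)
  have -> : \sum_i \sum_j theta (1 *: x i j) (xi j) (xi i) =
      \sum_k \sum_i \sum_j theta (star (y k i) * y k j) (xi j) (xi i).
    rewrite [RHS]exchange_big; apply: eq_bigr => i _ /=.
    rewrite [RHS]exchange_big /=; apply: eq_bigr => j _;
      rewrite scale1r xE mxE (cp_sum cp).
    by apply: eq_bigr => k _; rewrite !mxE.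
  apply: sumr_ge0 => k _.
  have := cp_pos cp [seq (y k i, xi i) | i <- index_enum 'I_n].
  rewrite big_map; congr (0 <= _); apply: eq_bigr => i _; rewrite big_map.
  by [].
Qed.

End CompletelyPositiveForms.

(** * Completely contractive homomorphisms *)

Section Merging.
Variables (R : realType) (B : cstarAlgType R) (K : lmodType R[i]).
Variables (l : seq (B * K * K)).

(** A list may repeat vectors, whereas test families such as [z : H -> B] give one coefficient per
    vector. Collecting the entries over distinct vectors turns the list into a genuine matrix
    [merge_mx], for which every column is the restriction of a test family. *)
Definition support_seq := undup ([seq u.1.2 | u <- l] ++ [seq u.2 | u <- l]).
Local Notation n := (size support_seq).

Definition support_vec (i : 'I_n) : K := support_seq`_i.

Definition merge_mx : 'M[B]_n :=
  \matrix_(i, j) \sum_(u <- l | (u.2 == support_vec i) && (u.1.2 == support_vec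
    j)) u.1.1.

Lemma support_vec_inj : injective support_vec.
Proof.
move=> i j /eqP; rewrite /support_vec nth_uniq ?undup_uniq // => /eqP.
exact: val_inj.
Qed.

Lemma support_vecP v : v \in support_seq -> exists i, v = support_vec i.
Proof.
move=> vs; have lt_i : (index v support_seq < n)%N by rewrite index_mem.
by exists (Ordinal lt_i); rewrite /support_vec /= nth_index.
Qed.

Lemma merge_sum (M : nmodType) (F : B -> K -> K -> M) :
  (forall P v w, F (\sum_(u <- l | P u) u.1.1) v w = \sum_(u <- l | P u) F
    u.1.1 v w) ->
  \sum_(u <- l) F u.1.1 u.1.2 u.2 =
  \sum_i \sum_j F (merge_mx i j) (support_vec j) (support_vec i).
Proof.
move=> Fsum; under [RHS]eq_bigr => i _.
  under eq_bigr => j _ do rewrite mxE Fsum big_mkcond.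
  rewrite exchange_big /=; over.
rewrite exchange_big /= big_seq [RHS]big_seq; apply: eq_bigr => u ul.
have /support_vecP[i ui] : u.2 \in support_seq.
  by rewrite mem_undup mem_cat; apply/orP; right; apply: map_f.
have /support_vecP[j uj] : u.1.2 \in support_seq.
  by rewrite mem_undup mem_cat; apply/orP; left; apply/mapP; exists u.
rewrite (bigD1 i) //= (bigD1 j) //= -ui -uj !eqxx /= !big1 ?addr0 //.
- move=> i' /negPf i'i; rewrite big1 // => j' _.
  by rewrite ui (inj_eq support_vec_inj) eq_sym i'i.
- move=> j' /negPf j'j.
  by rewrite uj (inj_eq support_vec_inj) eq_sym j'j ?andbF.
Qed.

Definition extend_vec (T : Type) (t0 : T) (z : 'I_n -> T) (v : K) : T :=
  if insub (index v support_seq) is Some i then z i else t0.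

Lemma extend_vecE (T : Type) (t0 : T) (z : 'I_n -> T) i :
  extend_vec t0 z (support_vec i) = z i.
Proof.
by rewrite /extend_vec /support_vec index_uniq ?undup_uniq // valK.
Qed.

End Merging.

Section Homomorphism.
Variables (R : realType) (B : cstarAlgType R) (H : hilbertType R).
Variables (A : set B) (phi : B -> H -> H).
Hypotheses (algA : unital_subalgebra A) (homphi : unital_hom A bounded_op phi).
Implicit Types (a b : B) (v w : H) (r t : R).

Lemma alg_sum (I : Type) (s : seq I) (P : pred I) (F : I -> B) :
  (forall i, P i -> A (F i)) -> A (\sum_(i <- s | P i) F i).
Proof.
have [A1 Alin _] := algA; have A0 : A 0.
  by have := Alin (- 1) 1 1 A1 A1; rewrite scaleN1r addNr.
move=> AF; elim/big_ind: _ => // a b Aa Ab.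
by have := Alin 1 a b Aa Ab; rewrite scale1r.
Qed.

Lemma hom_rep : rep A phi.
Proof.
have [bphi phi1 philin phiM] := homphi; split=> //.
- by move=> v; rewrite phi1.
- by move=> k a b v Aa Ab; rewrite philin.
- by move=> a b v Aa Ab; rewrite phiM.
- by move=> k a v w Aa; have [lin _] := bphi a Aa; rewrite lin.
Qed.

Lemma hom0 v : phi 0 v = 0.
Proof.
have [A1 _ _] := algA.
have := rep_lin hom_rep (- 1) v A1 A1; rewrite scaleN1r addNr => ->.
by rewrite scaleN1r addNr.
Qed.

Lemma hom_sum (I : Type) (s : seq I) (P : pred I) (F : I -> B) v :
  (forall i, P i -> A (F i)) ->
  phi (\sum_(i <- s | P i) F i) v = \sum_(i <- s | P i) phi (F i) v.
Proof.
move=> AF; elim: s => [|i s IH]; first by rewrite !big_nil hom0.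
rewrite !big_cons; case: ifP => Pi //; rewrite -IH.
have := rep_lin hom_rep 1 v (AF i Pi) (alg_sum s AF); rewrite !scale1r.
by [].
Qed.

Section OneSub.
Variables (n : nat) (x : 'M[B]_n).
Hypothesis Ax : forall i j, A (x i j).

Lemma alg_one_sub t i j : A (one_sub t x i j).
Proof.
have [A1 Alin _] := algA; rewrite mxE.
have -> : (i == j)%:R - t%:C *: x i j = (- t)%:C *: x i j + ((i == j)%:R :
  R[i]) *: (1 : B).
  by case: (i == j); rewrite ?mulr1n ?mulr0n; lmod R[i].
by apply: Alin => //; exact: (alg_scal hom_rep).
Qed.

Lemma opmx_one_sub t (xi : 'I_n -> H) i :
  opmx_apply (map_mx phi (one_sub t x)) xi i =
  xi i - t%:C *: opmx_apply (map_mx phi x) xi i.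
Proof.
rewrite /opmx_apply; transitivity (\sum_j ((i == j)%:R *: xi j - t%:C *: phi (x
  i j) (xi j))).
  apply: eq_bigr => j _; rewrite !mxE.
  have -> : (i == j)%:R - t%:C *: x i j = (- t)%:C *: x i j + ((i == j)%:R :
    R[i]) *: (1 : B).
    by case: (i == j); rewrite ?mulr1n ?mulr0n; lmod R[i].
  rewrite (rep_lin hom_rep) ?(rep_scal hom_rep) //;
    last exact: (alg_scal hom_rep).
  by lmod R[i].
rewrite sumrB (bigD1 i) //= eqxx scale1r big1 ?addr0.
  by rewrite scaler_sumr; congr (_ - _); apply: eq_bigr => j _; rewrite mxE.
by move=> j; rewrite eq_sym => /negPf->; rewrite scale0r.
Qed.

Lemma hom_bounded_mx (y : 'M[B]_n) : (forall i j, A (y i j)) ->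
  forall i j, bounded_op (map_mx phi y i j).
Proof. by have [bphi _ _ _] := homphi; move=> Ay i j; rewrite mxE;
  exact: bphi. Qed.

End OneSub.

(** Expanding the square and dropping [t^2 |eta|^2] leaves [- 2 t <eta, xi> <= t^2 C |xi|^2].
    Dividing by [2 t], the choice [t = 2 e / D] makes the right-hand side at most [e]. *)
Lemma vdot_ge0_of_norm n (xi eta : 'I_n -> H) (C : R) :
  (forall t, 0 < t -> vec_norm (fun i => xi i - t%:C *: eta i) ^+ 2 <=
     (1 + t ^+ 2 * C) * vec_norm xi ^+ 2) -> 0 <= vdot eta xi.
Proof.
move=> le_norm; apply/ler_addgt0Pr => e e0.
pose D := `|C| * vec_norm xi ^+ 2 + 1.
have D0 : 0 < D by rewrite ltr_wpDl // mulr_ge0 // sqr_ge0.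
pose t := 2 * e / D; have t0 : 0 < t by rewrite divr_gt0 // mulr_gt0.
have := le_norm t t0; rewrite sqr_vec_normB.
have CD : C * vec_norm xi ^+ 2 <= D.
  rewrite /D; have := ler_wpM2r (sqr_ge0 (vec_norm xi)) (ler_norm C); lra.
have tD : t * D = 2 * e by rewrite /t divfK // gt_eqF.
have eta0 := sqr_ge0 (vec_norm eta).
have t2 : 0 <= t ^+ 2 * vec_norm eta ^+ 2 by rewrite mulr_ge0 ?sqr_ge0.
have tC : t * (t * (C * vec_norm xi ^+ 2)) <= t * (2 * e).
  by rewrite -tD ler_pM2l // ler_pM2l.
move=> le1; have : 0 <= t * (2 * (vdot eta xi + e)).
  move: le1 tC t2; rewrite expr2; lra.
by rewrite pmulr_rge0 // pmulr_rge0.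
Qed.

End Homomorphism.

Section Existence.
Variables (R : realType) (B : cstarAlgType R) (H : hilbertType R).
Variables (A : set B) (phi : B -> H -> H).
Hypotheses (algA : unital_subalgebra A) (homphi : unital_hom A bounded_op phi).
Implicit Types (a b : B) (v w : H) (r t : R).

Let rA := hom_rep algA homphi.

Lemma merge_mx_alg (K : lmodType R[i]) (l : seq (B * K * K)) :
  (forall u, u \in l -> A u.1.1) -> forall i j, A (merge_mx l i j).
Proof.
move=> Al i j; rewrite mxE big_seq_cond; apply: (alg_sum algA) => u /andP[ul _].
exact: Al.
Qed.

Lemma vdot_merge (K : lmodType R[i]) (l : seq (B * K * K)) (xi : K -> H) :
  (forall u, u \in l -> A u.1.1) ->
  \sum_(u <- l) rdot (phi u.1.1 (xi u.1.2)) (xi u.2) =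
  vdot (opmx_apply (map_mx phi (merge_mx l)) (xi \o @support_vec _ _ _ l))
    (xi \o @support_vec _ _ _ l).
Proof.
move=> Al; rewrite (@merge_sum _ _ _ l _ (fun a k k' => rdot (phi a (xi k)) (xi
  k'))).
  apply: eq_bigr => i _; rewrite /opmx_apply rdot_sum.
  by apply: eq_bigr => j _; rewrite [in RHS]mxE.
move=> P k k'; rewrite big_seq_cond (hom_sum algA homphi) // => [|u /andP[ul
  _]]; last exact: Al.
by rewrite rdot_sum -big_seq_cond.
Qed.

(* [module_form b v w] is the quadratic form on finitely supported families in
   [B] indexed by [H] of the matrix with [b] as its [(w, v)] entry. *)
Definition module_form b v w : (H -> B) -> B := fun z => star (z w) * b * z v.

Definition module_cone : set ((H -> B) -> B) :=
  [set g | forall z, pos (g z + star (g z))].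

Lemma sum_fctE (T : Type) (W : nmodType) (I : Type) (s : seq I) (F : I -> T ->
  W) z :
  (\sum_(i <- s) F i) z = \sum_(i <- s) F i z.
Proof. by elim: s => [|i s IH]; rewrite ?big_nil // !big_cons -IH. Qed.

(** Testing the cone on families carried by the support says that the merged matrix [x] is
    accretive. The bound on [1 - t x] passes through [phi] and returns as positivity on [H^n]. *)
Lemma module_cone_rep (l : seq (B * H * H)) : completely_contractive_on A phi ->
  (forall u, u \in l -> A u.1.1) ->
  module_cone (\sum_(u <- l) module_form u.1.1 u.1.2 u.2) ->
  0 <= \sum_(u <- l) rdot (phi u.1.1 u.1.2) u.2.
Proof.
move=> cc Al Kl; have Ax := merge_mx_alg Al; set x := merge_mx l in Ax *.
have acc : accretive x.
  move=> z; have := Kl (extend_vec 0 (fun i => z i 0)); rewrite sum_fctE.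
  have -> : \sum_(u <- l) module_form u.1.1 u.1.2 u.2 (extend_vec 0 (fun i => z
    i 0)) =
      ip z (x *m z); last by [].
  rewrite (@merge_sum _ _ _ l _
    (fun a v w => module_form a v w (extend_vec 0 (fun i => z i 0)))).
    apply: eq_bigr => i _; rewrite !mxE mulr_sumr; apply: eq_bigr => j _.
    by rewrite /module_form !extend_vecE mulrA.
  by move=> P v w; rewrite /module_form mulr_sumr mulr_suml.
have [M M0 xM] := mx_bounded x.
rewrite (vdot_merge id Al) -/x; set xi := _ \o _.
apply: (@vdot_ge0_of_norm _ _ _ _ _ (M ^+ 2)) => t t0.
have s0 : 0 <= 1 + t ^+ 2 * M ^+ 2 by rewrite addr_ge0 // mulr_ge0 // sqr_ge0.
have Ay := alg_one_sub algA homphi Ax t.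
have le1 := cstar_mx_norm_le (sqrtr_ge0 _) (accretive_one_sub acc M0 (ltW t0)
  xM).
have := opmx_norm_bound xi (hom_bounded_mx homphi Ay).
have -> : opmx_apply (map_mx phi (one_sub t x)) xi =
    (fun i => xi i - t%:C *: opmx_apply (map_mx phi x) xi i).
  by apply/funext => i; exact: (opmx_one_sub algA homphi Ax).
move=> le2; have := le_trans le2 (ler_wpM2r (vec_norm_ge0 _) (le_trans (cc _ _
  Ay) le1)).
rewrite -(@ler_pXn2r _ 2) ?nnegrE ?mulr_ge0 ?vec_norm_ge0 ?sqrtr_ge0 //.
by rewrite exprMn (sqr_sqrtr s0).
Qed.

Lemma cc_form_extension : completely_contractive_on A phi -> exists theta,
  [/\ cp_form theta, represents A phi (@rdot R H) theta &
    forall l : seq (B * H * H), module_cone (\sum_(u <- l) module_form u.1.1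
      u.1.2 u.2) ->
      0 <= \sum_(u <- l) theta u.1.1 u.1.2 u.2].
Proof.
move=> cc; apply: (cp_form_extension (rdot_semi_inner H) rA).
- by move=> f g Kf Kg z; have := posD (Kf z) (Kg z); rewrite /= starD addrACA.
- by move=> r f r0 Kf z; have := posZ r0 (Kf z); rewrite /= starZr scalerDr.
- by move=> z; rewrite /= star0 addr0; exact: pos0.
- move=> r a b v w; apply/funext => z.
  by rewrite /module_form mulrDr mulrDl cscalerAr cscalerAl.
- move=> b v w z; have -> : (module_form (star b) v w - module_form b w v) z =
    star (z w) * star b * z v - star (z v) * b * z w by [].
  rewrite starD starN !starM !starK !mulrA; set c := _ - _ + _.
  have -> : c = 0 by rewrite /c; lmod R[i].
  exact: pos0.
- move=> s z; rewrite sum_fctE.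
  have -> : \sum_(u <- s) (\sum_(u' <- s) module_form (star u.1 * u'.1) u'.2
    u.2) z =
      star (\sum_(u <- s) u.1 * z u.2) * \sum_(u <- s) u.1 * z u.2.
    rewrite star_sum mulr_suml; apply: eq_bigr => u _.
    rewrite sum_fctE mulr_sumr; apply: eq_bigr => u' _.
    by rewrite /module_form starM !mulrA.
  by rewrite starM starK; apply: posD; exact: pos_star_mul.
- by move=> l Al; exact: module_cone_rep.
Qed.

(** Multiplied by [m], the expression is [|m z1 - x z2|^2 + (m^2 |z2|^2 - |x z2|^2)], and the second
    summand is positive by [ip_mulmx_le]. *)
Lemma accretive_block n (x : 'M[B]_n) (m : R) (z1 z2 : 'cV[B]_n) : 0 < m ->
  (forall z, hmod_norm (x *m z) <= m * hmod_norm z) ->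
  pos (m%:C *: ip z1 z1 + m%:C *: ip z2 z2 - (ip z1 (x *m z2) + ip (x *m z2)
    z1)).
Proof.
move=> m0 xm; set y := x *m z2.
have p1 : pos (m%:C *: (m%:C *: ip z1 z1) - m%:C *: (ip z1 y + ip y z1) + ip y
  y).
  have -> : m%:C *: (m%:C *: ip z1 z1) - m%:C *: (ip z1 y + ip y z1) + ip y y =
      ip (\col_i (m%:C *: z1 i 0 - y i 0)) (\col_i (m%:C *: z1 i 0 - y i 0)).
    rewrite /ip -big_split !scaler_sumr -sumrB -big_split /=.
    apply: eq_bigr => i _; rewrite !mxE starD starN starZr.
    by rewrite !(mulrDr, mulrDl, mulrN, mulNr, cscalerAl, cscalerAr); lmod R[i].
  exact: pos_ip.
have p2 := ip_mulmx_le (ltW m0) xm z2.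
have := posD p1 p2; set c := _ + _ => pc.
have -> : m%:C *: ip z1 z1 + m%:C *: ip z2 z2 - (ip z1 y + ip y z1) = m^-1%:C
  *: c.
  have -> : c = m%:C *: (m%:C *: ip z1 z1 + m%:C *: ip z2 z2 - (ip z1 y + ip y
    z1)).
    by rewrite /c -/y; lmod R[i].
  by rewrite scalerRR mulVf ?gt_eqF // scale1r.
by apply: posZ; rewrite // invr_ge0 ltW.
Qed.

(* The entries of the block matrix [[m, - 2 x], [0, m]], whose real part is
   positive as soon as [m] bounds the norm of [x]. *)
Definition block_seq (K : Type) n (x : 'M[B]_n) (m : R) (v w : 'I_n -> K) : seq
  (B * K * K) :=
  [seq (m%:C *: (1 : B), v i, v i) | i <- index_enum 'I_n] ++
  [seq (m%:C *: (1 : B), w i, w i) | i <- index_enum 'I_n] ++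
  [seq ((- 2)%:C *: x ij.1 ij.2, w ij.2, v ij.1) | ij <- index_enum ('I_n *
    'I_n)%type].

Lemma block_sum (K : Type) (M : nmodType) (F : B -> K -> K -> M) n (x : 'M[B]_n)
    (m : R) (v w : 'I_n -> K) :
  \sum_(u <- block_seq x m v w) F u.1.1 u.1.2 u.2 =
  \sum_i F (m%:C *: (1 : B)) (v i) (v i) + \sum_i F (m%:C *: (1 : B)) (w i) (w
    i) +
  \sum_i \sum_j F ((- 2)%:C *: x i j) (w j) (v i).
Proof. by rewrite /block_seq !big_cat !big_map /= pair_big addrA. Qed.

(** With [y] the image of [eta] under the matrix of [Phi], the block matrix is tested at [y / m] and
    [eta]. The result [|y|^2 / m + m |eta|^2 - 2 |y|^2 / m >= 0] says [|y| <= m |eta|]. *)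
Lemma cc_of_form theta Phi : cp_form theta ->
  (forall v w, theta 1 v w = rdot v w) ->
  (forall l : seq (B * H * H), module_cone (\sum_(u <- l) module_form u.1.1
    u.1.2 u.2) ->
      0 <= \sum_(u <- l) theta u.1.1 u.1.2 u.2) ->
  (forall b v w, rdot (Phi b v) w = theta b v w) ->
  completely_contractive_on setT Phi.
Proof.
move=> cp th1 thK PhiP n x _; apply: opmx_norm_le => [|eta].
  exact: cstar_mx_norm_ge0.
apply/ler_addgt0Pr => e e0.
have n0 := vec_norm_ge0 eta.
pose d := e / (vec_norm eta + 1); pose m := cstar_mx_norm x + d.
have d0 : 0 < d by rewrite divr_gt0 // ltr_wpDl.
have m0 : 0 < m by rewrite ltr_wpDl // cstar_mx_norm_ge0.
have dn : d * vec_norm eta <= e.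
  rewrite /d mulrAC ler_pdivrMr ?ltr_wpDl // ler_wpM2l ?(ltW e0) //.
  by rewrite lerDl.
have xm z : hmod_norm (x *m z) <= m * hmod_norm z.
  apply: le_trans (cstar_mx_norm_bound x z) _.
  by rewrite ler_wpM2r ?hmod_norm_ge0 // lerDl ltW.
suff : vec_norm (opmx_apply (map_mx Phi x) eta) <= m * vec_norm eta.
  by rewrite /m mulrDl; lra.
pose y := opmx_apply (map_mx Phi x) eta; pose xi i := m^-1%:C *: y i.
have := thK (block_seq x m xi eta); rewrite (block_sum theta).
have -> : \sum_i \sum_j theta ((- 2)%:C *: x i j) (eta j) (xi i) =
    - 2 * (m^-1 * vec_norm y ^+ 2).
  rewrite -vdot_sqr /vdot !mulr_sumr; apply: eq_bigr => i _.
  rewrite [in RHS]/y {1}/opmx_apply rdot_sum !mulr_sumr; apply: eq_bigr => j _.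
  by rewrite (cpZ cp) (cp_scaler cp) conj_real (cpZ cp) mxE PhiP.
have sumE (u : 'I_n -> H) : \sum_i theta (m%:C *: (1 : B)) (u i) (u i) = m *
  vec_norm u ^+ 2.
  rewrite -vdot_sqr /vdot mulr_sumr; apply: eq_bigr => i _.
  by rewrite (cpZ cp) th1.
rewrite !sumE vec_normZ exprMn real_normK ?num_real // => H1.
have {H1} : 0 <= m * (m^-1 ^+ 2 * vec_norm y ^+ 2) + m * vec_norm eta ^+ 2 +
    - 2 * (m^-1 * vec_norm y ^+ 2).
  apply: H1 => z; rewrite sum_fctE.
  rewrite (block_sum (fun a v w => module_form a v w z)) /module_form.
  pose z1 : 'cV[B]_n := \col_i z (xi i); pose z2 : 'cV[B]_n := \col_i z (eta i).
  have diagE (u : 'I_n -> H) : \sum_i star (z (u i)) * (m%:C *: (1 : B)) * z (u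
    i) =
      m%:C *: ip (\col_i z (u i)) (\col_i z (u i)).
    rewrite /ip scaler_sumr; apply: eq_bigr => i _.
    by rewrite !mxE cscalerAr mulr1 cscalerAl.
  have crossE : \sum_i \sum_j star (z (xi i)) * ((- 2)%:C *: x i j) * z (eta j)
    =
      (- 2)%:C *: ip z1 (x *m z2).
    rewrite /ip scaler_sumr; apply: eq_bigr => i _.
    rewrite !mxE mulr_sumr scaler_sumr; apply: eq_bigr => j _.
    by rewrite !mxE cscalerAr cscalerAl mulrA.
  rewrite !diagE crossE -/z1 -/z2.
  have pb := accretive_block z1 z2 m0 xm; have := posD pb pb; congr pos.
  by rewrite !starD !starZr !star_ip; lmod R[i].
rewrite -/y => H2; rewrite -(@ler_pXn2r _ 2) ?nnegrE ?mulr_ge0 ?vec_norm_ge0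
  ?(ltW m0) //.
rewrite exprMn -subr_ge0 -(@pmulr_rge0 _ m^-1) ?invr_gt0 //; move: H2.
by congr (0 <= _); field; rewrite gt_eqF.
Qed.

End Existence.

(** * Completely isometric homomorphisms *)

Section GNS.
Variables (R : realType) (B : cstarAlgType R) (g : B -> R).
Hypothesis sg : real_state g.
Implicit Types (a b v w : B).

Definition state_form v w : R := g (star w * v).

Let g_lin := let: And3 h _ _ := sg in h.
Let g_star := let: And3 _ h _ := sg in h.
Let g_pos := let: And3 _ _ h := sg in h.

Lemma stateD a b : g (a + b) = g a + g b.
Proof. by have := g_lin 1 a b; rewrite rmorph1 scale1r mul1r. Qed.

Lemma state0 : g 0 = 0.
Proof. by apply: (addrI (g 0)); rewrite -stateD !addr0. Qed.

Lemma stateZ r a : g (r%:C *: a) = r * g a.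
Proof. by rewrite -[_ *: a]addr0 g_lin state0 addr0. Qed.

Lemma state_sum (I : Type) (s : seq I) (P : pred I) (F : I -> B) :
  g (\sum_(i <- s | P i) F i) = \sum_(i <- s | P i) g (F i).
Proof. by apply: (big_morph g) => [a b|]; [exact: stateD|exact: state0]. Qed.

Lemma state_semi_inner : semi_inner state_form.
Proof.
rewrite /state_form; split=> [r v v' w|v w|k v w|v].
- by rewrite mulrDr cscalerAr g_lin.
- by rewrite -g_star starM starK.
- by rewrite starZ conjCK cscalerAr cscalerAl.
- exact/g_pos/pos_star_mul.
Qed.

Lemma state_cp_form : cp_form (fun b v w : B => state_form (b * v) w).
Proof.
rewrite /state_form; split=> [r a b v w|b v w|b v v' w|b k v w|s].
- by rewrite mulrDl cscalerAl mulrDr cscalerAr g_lin.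
- by rewrite -g_star !starM !starK mulrA.
- by rewrite !mulrDr stateD.
- by rewrite cscalerAr cscalerAl.
- have -> : \sum_(u <- s) \sum_(u' <- s) g (star u.2 * (star u.1 * u'.1 *
    u'.2)) =
      g (star (\sum_(u <- s) u.1 * u.2) * \sum_(u <- s) u.1 * u.2).
    rewrite star_sum mulr_suml state_sum; apply: eq_bigr => u _.
    rewrite mulr_sumr state_sum; apply: eq_bigr => u' _.
    by rewrite starM !mulrA.
  exact/g_pos/pos_star_mul.
Qed.

Lemma mul_rep (A : set B) : unital_subalgebra A -> rep A (fun a v : B => a * v).
Proof.
move=> algA; split=> // [v|k a b v _ _|a b v _ _|k a v w _].
- by rewrite mul1r.
- by rewrite mulrDl cscalerAl.
- by rewrite mulrA.
- by rewrite mulrDr cscalerAr.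
Qed.

End GNS.

Section Isometry.
Variables (R : realType) (B : cstarAlgType R) (H : hilbertType R).
Variables (A : set B) (phi Phi : B -> H -> H).
Hypotheses (hA : dirichlet A \/ logrigged A).
Hypotheses (algA : unital_subalgebra A) (homphi : unital_hom A bounded_op phi).
Hypotheses (iso : completely_isometric_on A phi) (ext : extends A phi Phi).
Hypothesis (cpPhi : completely_positive bounded_op Phi).
Local Notation "r %:I" := (r%:C *: (1 : B))
  (at level 1, left associativity, format "r %:I").

Let theta b v w := rdot (Phi b v) w.
Let cp : cp_form theta. Proof. exact: cp_form_of_cp. Qed.

(** The counterpart of [module_form] with [B] and [H] exchanged: matrices indexed by elements of [B]
    are tested on families of vectors of [H]. [R[i]^o] is the scalar field as a module over
    itself. *)
Definition op_form (b v w : B) : (B -> H) -> R[i]^o :=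
  fun h => dot (Phi b (h v)) (h w).

Definition op_cone : set ((B -> H) -> R[i]^o) :=
  [set f | forall h, 0 <= complex.Re (f h)].

(** The argument of [module_cone_rep] run backwards: positivity on [H^n] bounds [1 - t phi(x)],
    isometry transfers the bound to [1 - t x], and [one_sub_accretive] makes [x] accretive.
    Evaluating at the column of support vectors and applying [g] gives the sum. *)
Lemma op_cone_rep g (l : seq (B * B * B)) : real_state g ->
  (forall u, u \in l -> A u.1.1) ->
  op_cone (\sum_(u <- l) op_form u.1.1 u.1.2 u.2) ->
  0 <= \sum_(u <- l) state_form g (u.1.1 * u.1.2) u.2.
Proof.
move=> sg Al Kl; have Ax := merge_mx_alg algA Al; set x := merge_mx l in Ax *.
have vdot0 (h : 'I_(size (support_seq l)) -> H) :
    0 <= vdot (opmx_apply (map_mx phi x) h) h.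
  have hE : h = extend_vec 0 h \o @support_vec _ _ _ l.
    by apply/funext => i /=; rewrite extend_vecE.
  rewrite hE -(vdot_merge algA homphi _ Al) //; have := Kl (extend_vec 0 h).
  rewrite sum_fctE Re_sum; congr (0 <= _).
  rewrite !big_seq; apply: eq_bigr => u ul; rewrite /op_form ext //.
  exact: Al.
have [M M0 TM] := opmx_bounded (hom_bounded_mx homphi Ax).
have acc : accretive x.
  apply: (one_sub_accretive M0) => t z t0.
  have s0 : 0 <= 1 + t ^+ 2 * M ^+ 2 by rewrite addr_ge0 // mulr_ge0 // sqr_ge0.
  apply: le_trans (cstar_mx_norm_bound _ _) _.
  rewrite ler_wpM2r ?hmod_norm_ge0 // -iso; last exact: (alg_one_sub algA
    homphi Ax t).
  apply: opmx_norm_le => [|xi]; first exact: sqrtr_ge0.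
  rewrite -(@ler_pXn2r _ 2) ?nnegrE ?mulr_ge0 ?vec_norm_ge0 ?sqrtr_ge0 //.
  rewrite exprMn (sqr_sqrtr s0).
  have -> : opmx_apply (map_mx phi (one_sub t x)) xi =
      (fun i => xi i - t%:C *: opmx_apply (map_mx phi x) xi i).
    by apply/funext => i; exact: (opmx_one_sub algA homphi Ax).
  rewrite sqr_vec_normB mulrDl mul1r.
  have p1 : 0 <= 2 * t * vdot (opmx_apply (map_mx phi x) xi) xi.
    by rewrite !mulr_ge0 // ltW.
  have p2 : t ^+ 2 * vec_norm (opmx_apply (map_mx phi x) xi) ^+ 2 <=
      t ^+ 2 * M ^+ 2 * vec_norm xi ^+ 2.
    rewrite -[leRHS]mulrA ler_wpM2l ?sqr_ge0 // -exprMn.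
    by rewrite ler_pXn2r ?nnegrE ?mulr_ge0 ?vec_norm_ge0.
  by lra.
pose z : 'cV[B]_(size (support_seq l)) := \col_i support_vec i.
have [_ g_star g_pos] := sg.
have := g_pos _ (acc z); rewrite (stateD sg) g_star.
have -> : g (ip z (x *m z)) = \sum_(u <- l) state_form g (u.1.1 * u.1.2) u.2.
  rewrite (@merge_sum _ _ _ l _ (fun a v w => state_form g (a * v) w)).
    rewrite (state_sum sg); apply: eq_bigr => i _.
    rewrite !mxE mulr_sumr (state_sum sg); apply: eq_bigr => j _.
    by rewrite /z !mxE.
  by move=> P v w; rewrite /state_form mulr_suml mulr_sumr (state_sum sg).
lra.
Qed.

Lemma op_cone_state g (l : seq (B * B * B)) : real_state g ->
  op_cone (\sum_(u <- l) op_form u.1.1 u.1.2 u.2) ->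
  0 <= \sum_(u <- l) state_form g (u.1.1 * u.1.2) u.2.
Proof.
move=> sg; have rmul := mul_rep algA.
have [|||||||th [cpth repth thK]] := @cp_form_extension _ _ _ _ _ _
  (state_semi_inner sg) rmul _ op_form op_cone.
- by move=> f f' Kf Kf' h; rewrite ReD addr_ge0 // ?Kf ?Kf'.
- move=> r f r0 Kf h; rewrite [(_ *: _) h]/(r%:C * f h) ReZ mulr_ge0 //;
    exact: Kf.
- by move=> h.
- move=> r a b v w; apply/funext => h.
  rewrite [RHS]/(r%:C * dot (Phi a (h v)) (h w) + dot (Phi b (h v)) (h w)).
  by have [_ lin _] := cpPhi; rewrite /op_form lin dot_linear.
- move=> b v w h; rewrite [(_ - _) h]/(op_form (star b) v w h - op_form b w v
    h).
  by rewrite ReD ReN -!/(rdot _ _) -!/(theta _ _ _) (cp_sym cp) subrr.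
- move=> s h; rewrite sum_fctE Re_sum.
  have := cp_pos cp [seq (u.1, h u.2) | u <- s]; rewrite big_map;
    congr (0 <= _).
  apply: eq_bigr => u _; rewrite big_map sum_fctE Re_sum.
  by [].
- by move=> l'; exact: op_cone_rep.
move=> /thK; congr (0 <= _); apply: eq_bigr => u _.
have := cp_form_unique (state_semi_inner sg) rmul hA cpth (state_cp_form sg)
  repth.
by apply.
Qed.

(** The computation of [cc_of_form] with [B^n] and [H^n] exchanged: the block matrix of [x] lies in
    [op_cone] as soon as [m] bounds the matrix of [Phi], and a state tested at [y / m] and [z] gives
    [g <y, y> <= m^2 g <z, z>]. States separate, so the inequality holds in [B]. *)
Lemma completely_isometric_extension : completely_contractive_on setT Phi ->
  completely_isometric_on setT Phi.
Proof.
move=> cc n x xT; apply/eqP; rewrite eq_le cc //=.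
have [bPhi linPhi _] := cpPhi.
have Phi1 v : Phi 1 v = v.
  by rewrite ext; [have [_ -> _ _] := homphi|have [] := algA].
have bT i j : bounded_op (map_mx Phi x i j) by rewrite mxE.
set T := map_mx Phi x in bT *.
apply/ler_addgt0Pr => e e0; pose m := opmx_norm T + e.
have m0 : 0 < m by rewrite ltr_wpDl // opmx_norm_ge0.
apply: cstar_mx_norm_le => [|z]; first exact: ltW.
have Tm xi : vec_norm (opmx_apply T xi) <= m * vec_norm xi.
  apply: le_trans (opmx_norm_bound xi bT) _.
  by rewrite ler_wpM2r ?vec_norm_ge0 // lerDl ltW.
pose y := x *m z.
have state_le g : real_state g -> 0 <= g ((m ^+ 2)%:C *: ip z z - ip y y).
  move=> sg.
  have := @op_cone_state g (block_seq x m (fun i => m^-1%:C *: y i 0) (fun i =>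
    z i 0)) sg.
  rewrite (block_sum (fun b v w => state_form g (b * v) w)).
  have -> : \sum_i state_form g (m%:I * (m^-1%:C *: y i 0)) (m^-1%:C *: y i 0) =
      m^-1 * g (ip y y).
    rewrite /ip (state_sum sg) mulr_sumr; apply: eq_bigr => i _.
    rewrite /state_form starZr !(cscalerAl, cscalerAr) mul1r scalerRR scalerRR.
    by rewrite (stateZ sg) mulVf ?mul1r ?mulr1 // gt_eqF.
  have -> : \sum_i state_form g (m%:I * z i 0) (z i 0) = m * g (ip z z).
    rewrite /ip (state_sum sg) mulr_sumr; apply: eq_bigr => i _.
    by rewrite /state_form cscalerAl cscalerAr mul1r (stateZ sg).
  have -> : \sum_i \sum_j
      state_form g ((- 2)%:C *: x i j * z j 0) (m^-1%:C *: y i 0) =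
      - 2 * (m^-1 * g (ip y y)).
    rewrite /ip (state_sum sg) !mulr_sumr; apply: eq_bigr => i _.
    rewrite {3}/y mxE mulr_sumr (state_sum sg) !mulr_sumr;
      apply: eq_bigr => j _.
    rewrite /state_form starZr !(cscalerAl, cscalerAr) scalerRR (stateZ sg).
    by ring.
  move=> H1; have {H1} : 0 <= m^-1 * g (ip y y) + m * g (ip z z) +
      - 2 * (m^-1 * g (ip y y)).
    apply: H1 => h; rewrite sum_fctE (block_sum (fun b v w => op_form b v w h)).
    pose h1 i := h (m^-1%:C *: y i 0); pose h2 i := h (z i 0).
    have diagR (u : 'I_n -> B) : complex.Re (\sum_i op_form m%:I (u i) (u i) h)
      =
        m * vec_norm (fun i => h (u i)) ^+ 2.
      rewrite Re_sum -vdot_sqr mulr_sumr; apply: eq_bigr => i _.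
      by rewrite -[LHS]/(theta m%:I (h (u i)) (h (u i))) (cpZ cp) /theta Phi1.
    have crossR : complex.Re (\sum_i \sum_j op_form ((- 2)%:C *: x i j) (z j 0)
        (m^-1%:C *: y i 0) h) = - 2 * vdot (opmx_apply T h2) h1.
      rewrite Re_sum mulr_sumr; apply: eq_bigr => i _.
      rewrite Re_sum /opmx_apply rdot_sum mulr_sumr; apply: eq_bigr => j _.
      by rewrite -[LHS]/(theta ((- 2)%:C *: x i j) (h2 j) (h1 i)) (cpZ cp) [in
        RHS]mxE.
    rewrite !ReD !diagR crossR -/h1 -/h2.
    (* Completing the square: the real part of the block form is at least [m |h1 - T h2 / m|^2],
       because [|T h2| <= m |h2|]. *)
    have := sqr_vec_normB m^-1 h1 (opmx_apply T h2).
    have := sqr_ge0 (vec_norm (fun i => h1 i - m^-1%:C *: opmx_apply T h2 i)).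
    set V := vdot _ _ => le2 E; rewrite {}E in le2.
    have le1 : vec_norm (opmx_apply T h2) ^+ 2 <= m ^+ 2 * vec_norm h2 ^+ 2.
      by rewrite -exprMn ler_pXn2r ?nnegrE ?mulr_ge0 ?vec_norm_ge0 ?(ltW m0).
    have {le1} le1 : m^-1 ^+ 2 * vec_norm (opmx_apply T h2) ^+ 2 <= vec_norm h2
      ^+ 2.
      by rewrite exprVn mulrC ler_pdivrMr ?exprn_gt0 // mulrC.
    have : 0 <= m * (vec_norm h1 ^+ 2 - 2 * m^-1 * V + vec_norm h2 ^+ 2).
      by rewrite mulr_ge0 ?(ltW m0) //; lra.
    by congr (0 <= _); field; rewrite gt_eqF.
  have -> : (m ^+ 2)%:C *: ip z z - ip y y = (m ^+ 2)%:C *: ip z z + (- 1)%:C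
    *: ip y y.
    by lmod R[i].
  rewrite (stateD sg) !(stateZ sg) => H1.
  rewrite -(@pmulr_rge0 _ m^-1) ?invr_gt0 //; move: H1.
  by congr (0 <= _); field; rewrite gt_eqF.
have : pos ((m ^+ 2)%:C *: ip z z - ip y y).
  apply: separating_state => //.
  by apply: star_sub; rewrite ?starZr star_ip.
move=> pm; rewrite -(@ler_pXn2r _ 2) ?nnegrE ?mulr_ge0 ?hmod_norm_ge0 ?(ltW m0)
  //.
rewrite exprMn !sqr_hmod_norm -/y.
apply: le_trans (pos_norm_le (pos_ip y) pm) _.
by rewrite rnormZr ger0_norm ?sqr_ge0.
Qed.

End Isometry.

(** * Existence and uniqueness of the extending maps *)

Section Extension.
Variables (R : realType) (B : cstarAlgType R) (H : hilbertType R).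
Variables (A : set B) (phi : B -> H -> H).
Hypotheses (algA : unital_subalgebra A) (homphi : unital_hom A bounded_op phi).

Lemma cc_extension : completely_contractive_on A phi -> exists Phi,
  [/\ extends A phi Phi, completely_positive bounded_op Phi
    & completely_contractive_on setT Phi].
Proof.
move=> cc; have [theta [cp th thK]] := cc_form_extension algA homphi cc.
have th1 := represents1 (hom_rep algA homphi) th.
have [Phi [cpPhi PhiP]] := cp_of_form cp th1.
exists Phi; split=> //; last exact: cc_of_form cp th1 thK PhiP.
move=> a Aa; apply/funext => v; apply: rdot_inj => w.
by rewrite PhiP th.
Qed.

Lemma cp_extension_unique Phi Psi : dirichlet A \/ logrigged A ->
  extends A phi Phi -> extends A phi Psi ->
  completely_positive bounded_op Phi -> completely_positive bounded_op Psi ->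
  Phi = Psi.
Proof.
move=> hA extPhi extPsi cpPhi cpPsi; apply/funext => b; apply/funext => v.
apply: rdot_inj => w.
apply: (cp_form_unique (rdot_semi_inner H) (hom_rep algA homphi) hA
  (cp_form_of_cp cpPhi) (cp_form_of_cp cpPsi)).
  by move=> a v' w' Aa; rewrite extPhi.
by move=> a v' w' Aa; rewrite extPsi.
Qed.

End Extension.

Theorem theorem4p4 (R : realType) (B : cstarAlgType R) (A : set B) :
  dirichlet A \/ logrigged A ->
  [/\ forall (H : hilbertType R) (phi : B -> H -> H),
        unital_hom A bounded_op phi -> completely_contractive_on A phi ->
        exists! Phi : B -> H -> H,
          [/\ extends A phi Phi, completely_positive bounded_op Phi
            & completely_contractive_on setT Phi],
      forall (H : hilbertType R) (phi : B -> H -> H),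
        unital_hom A bounded_op phi -> completely_isometric_on A phi ->
        exists! Phi : B -> H -> H,
          [/\ extends A phi Phi, completely_positive bounded_op Phi
            & completely_isometric_on setT Phi]
    & forall (H : hilbertType R) (C : set (H -> H)) (phi : B -> H -> H),
        unital_operator_algebra C ->
        unital_hom A C phi -> contractive_on A phi ->
        (exists Phi : B -> H -> H,
           extends A phi Phi /\ completely_positive C Phi) ->
        exists! Phi : B -> H -> H,
          extends A phi Phi /\ completely_positive C Phi].
Proof.
move=> hA; have algA : unital_subalgebra A by case: hA => [[]|[]].
split=> [H phi homphi cc|H phi homphi iso|H C phi [Cb _ _ _ _] homphi _].
- have [Phi [extPhi cpPhi ccPhi]] := cc_extension algA homphi cc.
  exists Phi; split=> // Psi [extPsi cpPsi _].
  exact: (cp_extension_unique algA homphi).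
- have cc : completely_contractive_on A phi by move=> n x Ax; rewrite iso.
  have [Phi [extPhi cpPhi ccPhi]] := cc_extension algA homphi cc.
  exists Phi; split=> [|Psi [extPsi cpPsi _]].
    by split=> //; exact: (completely_isometric_extension hA algA homphi iso).
  exact: (cp_extension_unique algA homphi).
- have homb : unital_hom A bounded_op phi.
    by have [Cphi phi1 lin mul] := homphi; split=> // a /Cphi/Cb.
  have cpb Phi : completely_positive C Phi -> completely_positive bounded_op Phi.
    by move=> [CPhi lin pos]; split=> // b; exact: Cb.
  move=> [Phi [extPhi cpPhi]]; exists Phi; split=> // Psi [extPsi cpPsi].
  by apply: (cp_extension_unique algA homb) => //; exact: cpb.
Qed.
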